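(* Let $m\ge 2$, let $f:\mathbb{R}\to\mathbb{R}$ be locally Lipschitz and satisfy (L1) and (L2) of the context, and let $\{\gamma_{ij}\}$ be a connected interconnection of locally Lipschitz functions. For $\omega>0$ consider the array of coupled Lienard oscillators $$\dot q_i=\omega p_i,\qquad \dot p_i=-\omega q_i-f(q_i)p_i+\sum_{j\ne i}\gamma_{ij}(p_j-p_i),\qquad i=1,\ldots,m,$$ with $\xi_i=[q_i\ p_i]^T\in\mathbb{R}^2$ and $\xi=[\xi_1^T\ \cdots\ \xi_m^T]^T\in\mathbb{R}^{2m}$, regarded as a system in $\mathbb{R}^{2m}$ with parameter $\omega$. Let $\rho>0$ and the sets $\mathcal{B},\mathcal{R}\subset\mathbb{R}^{2m}$ be as defined in the context. Then: (I) The set $\mathcal{B}$ is semiglobally practically asymptotically stable (with respect to $\omega$). (II) For each pair $(\mathcal{D},\delta)$, where $\mathcal{D}\subset\mathbb{R}^2$ is a compact convex set that does not include the origin and $\delta>0$, there exists $\omega^*>0$ such that for all $\omega\ge\omega^*$ the following hold. (a) There exists $\varepsilon>0$ such that $|\xi(0)|_{\mathcal{R}}\le\varepsilon$ implies $|\xi(t)|_{\mathcal{R}}\le\delta$ for all $t\ge0$. (b) There exists $r>0$ such that $\xi(0)\in\mathcal{D}^m$ implies $|\xi(t)|_{\mathcal{R}}\le r$ for all $t\ge0$. (c) There exists $T>0$ such that $\xi(0)\in\mathcal{D}^m$ implies $|\xi(t)|_{\mathcal{R}}\le\delta$ for all $t\ge T$.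
   Context: $|\cdot|$ is the Euclidean norm; for a closed set $\mathcal{S}\subset\mathbb{R}^n$, $|x|_{\mathcal{S}}$ is the Euclidean distance from $x$ to $\mathcal{S}$. A function $\alpha:\mathbb{R}_{\ge0}\to\mathbb{R}_{\ge0}$ is of class $\mathcal{K}$ if it is continuous, zero at zero and strictly increasing. $\xi\in\mathcal{D}^m$ means $\xi_i\in\mathcal{D}$ for all $i$. Conditions on $f$, with $F(s):=\int_0^s f(\sigma)\,d\sigma$: (L1) $f$ is even. (L2) there is $s_0>0$ with $F(s_0)=0$; $F$ is negative on $(0,s_0)$; $F$ is positive, nondecreasing and unbounded on $(s_0,\infty)$. Interconnection: a set of functions $\{\gamma_{ij}:\mathbb{R}\to\mathbb{R}\}$, $i,j=1,\ldots,m$, $i\neq j$, such that for all $i,j$: (G1) $\gamma_{ij}(0)=0$ and $s\gamma_{ij}(s)\ge0$ for all $s\in\mathbb{R}$; (G2) either $\gamma_{ij}\equiv0$, or there exists $\alpha$ of class $\mathcal{K}$ with $|\gamma_{ij}(s)|\ge\alpha(|s|)$ for all $s\in\mathbb{R}$. Its graph has nodes $n_1,\ldots,n_m$ and a directed edge $(n_i,n_j)$ iff $\gamma_{ij}\not\equiv0$. The interconnection is connected if its graph has a node to which there is a directed path from every other node. Constant $\rho$: define $\kappa(s):=\frac{2}{\pi}\int_0^s f(\sigma)\sqrt{1-\sigma^2/s^2}\,d\sigma$ for $s>0$. Under (L1), (L2) there is a unique $\rho>0$ with $\kappa(\rho)=0$; this is $\rho$. Sets: writing points of $\mathbb{R}^{2m}$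 as $\eta=[\eta_1^T\ \cdots\ \eta_m^T]^T$ with $\eta_i\in\mathbb{R}^2$, $\mathcal{B}:=\{\eta:|\eta_i|\le\rho\ \text{for all } i\}$ and $\mathcal{R}:=\{\eta:\eta_i=\eta_j,\ |\eta_i|=\rho\ \text{for all } i,j\}$. Semiglobal practical asymptotic stability: for a system $\dot x=g(x,\omega,t)$, a closed set $\mathcal{S}$ is semiglobally practically asymptotically stable (with respect to $\omega$) if for each pair $(\Delta,\delta)$ of positive numbers there exists $\omega^*>0$ such that for all $\omega\ge\omega^*$ the following hold (for solutions $x(\cdot)$ with initial time $t_0$): (a) for each $r>\delta$ there exists $\varepsilon>0$ such that $|x(t_0)|_{\mathcal{S}}\le\varepsilon\Rightarrow|x(t)|_{\mathcal{S}}\le r$ for all $t\ge t_0$; (b) for each $\varepsilon<\Delta$ there exists $r>0$ such that $|x(t_0)|_{\mathcal{S}}\le\varepsilon\Rightarrow|x(t)|_{\mathcal{S}}\le r$ for all $t\ge t_0$; (c) for each $r<\Delta$ and $\varepsilon>\delta$ there exists $T>0$ such that $|x(t_0)|_{\mathcal{S}}\le r\Rightarrow|x(t)|_{\mathcal{S}}\le\varepsilon$ for all $t\ge t_0+T$. *)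

(* Defs.v *)
From HB Require Import structures.
From mathcomp Require Import ssreflect ssrfun ssrbool eqtype ssrnat fintype bigop.
From Stdlib Require Import Reals Lra List Relations.
From Coquelicot Require Import Coquelicot.

Set Implicit Arguments.
Unset Strict Implicit.
Unset Printing Implicit Defensive.

Open Scope R_scope.

(* Makes the monoid lemmas of bigop available for sums of reals. *)
HB.instance Definition _ :=
  Monoid.isComLaw.Build R 0 Rplus
    (fun x y z => esym (Rplus_assoc x y z)) Rplus_comm Rplus_0_l.

Definition locally_lipschitz (f : R -> R) : Prop :=
  forall x, exists d L, 0 < d /\
    forall y z, Rabs (y - x) < d -> Rabs (z - x) < d ->
      Rabs (f y - f z) <= L * Rabs (y - z).

(* Functions on [0, +oo) are total functions constrained only there. *)
Definition class_K (alpha : R -> R) : Prop :=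
  continuous_on (fun s => 0 <= s) alpha /\
  alpha 0 = 0 /\
  (forall s t, 0 <= s -> s < t -> alpha s < alpha t).

Definition cond_L1 (f : R -> R) : Prop := forall s, f (- s) = f s.

Definition primitive (f : R -> R) (s : R) : R := RInt f 0 s.

Definition cond_L2 (f : R -> R) : Prop :=
  let F := primitive f in
  exists s0, 0 < s0 /\
    F s0 = 0 /\
    (forall s, 0 < s -> s < s0 -> F s < 0) /\
    (forall s, s0 < s -> 0 < F s) /\
    (forall s t, s0 < s -> s <= t -> F s <= F t) /\
    (forall M, exists s, s0 < s /\ M < F s).

Definition kappa (f : R -> R) (s : R) : R :=
  2 / PI * RInt (fun sigma => f sigma * sqrt (1 - sigma ^ 2 / s ^ 2)) 0 s.

(* The diagonal entries gamma i i of an interconnection are never used. *)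

Definition cond_G1 (g : R -> R) : Prop :=
  g 0 = 0 /\ forall s, 0 <= s * g s.

Definition cond_G2 (g : R -> R) : Prop :=
  (forall s, g s = 0) \/
  exists alpha, class_K alpha /\ forall s, alpha (Rabs s) <= Rabs (g s).

Definition interconnection (m : nat) (gamma : 'I_m -> 'I_m -> R -> R) : Prop :=
  forall i j, i <> j -> cond_G1 (gamma i j) /\ cond_G2 (gamma i j).

Definition edge (m : nat) (gamma : 'I_m -> 'I_m -> R -> R) (i j : 'I_m) : Prop :=
  i <> j /\ ~ (forall s, gamma i j s = 0).

Definition connected_interconnection (m : nat)
    (gamma : 'I_m -> 'I_m -> R -> R) : Prop :=
  exists k, forall i, i <> k -> clos_trans 'I_m (edge gamma) i k.

(* Coquelicot's product norm is the Euclidean one: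
   norm (q, p) = sqrt (|q|^2 + |p|^2). *)
Definition plane : NormedModule R_AbsRing :=
  prod_NormedModule R_AbsRing R_NormedModule R_NormedModule.

(* R^(2m) as m blocks in the plane. *)
Definition state (m : nat) : Type := 'I_m -> plane.

Definition state_norm (m : nat) (x : state m) : R :=
  sqrt (\big[Rplus/0]_i (norm (x i) ^ 2)).

Definition state_dist (m : nat) (x y : state m) : R :=
  state_norm (fun i => minus (x i) (y i)).

(* The infimum is finite whenever S is nonempty. *)
Definition dist_set (m : nat) (S : state m -> Prop) (x : state m) : R :=
  real (Glb_Rbar (fun d => exists y, S y /\ d = state_dist x y)).

Definition set_B (m : nat) (rho : R) (eta : state m) : Prop :=
  forall i, norm (eta i) <= rho.

Definition set_R (m : nat) (rho : R) (eta : state m) : Prop :=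
  forall i j, eta i = eta j /\ norm (eta i) = rho.

Definition compact_set (T : UniformSpace) (K : T -> Prop) : Prop :=
  forall (J : Type) (U : J -> T -> Prop),
    (forall j, open (U j)) ->
    (forall x, K x -> exists j, U j x) ->
    exists l : list J, forall x, K x -> exists j, In j l /\ U j x.

Definition convex_set (D : plane -> Prop) : Prop :=
  forall x y lambda, D x -> D y -> 0 <= lambda -> lambda <= 1 ->
    D (plus (scal lambda x) (scal (1 - lambda) y)).

(* x solves x' = v x t on [t0, b), b possibly +oo.  Differentiability is
   required on the open interval only, so that values of x before t0 are
   irrelevant; at t0 the (one-sided) continuity is required. *)
Definition solution (m : nat) (v : state m -> R -> state m)
    (t0 : R) (b : Rbar) (x : R -> state m) : Prop :=
  forall i,
    continuous_on (fun t => t0 <= t /\ Rbar_lt t b) (fun t => x t i) /\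
    forall t, t0 < t -> Rbar_lt t b -> is_derive (fun s => x s i) t (v (x t) t i).

(* "x(t0) in P implies Q t (x(t)) for all t >= t0": the conclusion includes
   that solutions exist for all t >= t0, and the bound is also required along
   every solution defined on a shorter interval. *)
Definition forward_implies (m : nat) (v : state m -> R -> state m) (t0 : R)
    (P : state m -> Prop) (Q : R -> state m -> Prop) : Prop :=
  forall x0, P x0 ->
    (exists x, solution v t0 p_infty x /\ x t0 = x0) /\
    (forall b x, solution v t0 b x -> x t0 = x0 ->
      forall t, t0 <= t -> Rbar_lt t b -> Q t (x t)).

(* For x' = g x omega t; the gains do not depend on the initial time t0. *)
Definition semiglobally_practically_asymptotically_stable (m : nat)
    (g : state m -> R -> R -> state m) (S : state m -> Prop) : Prop :=
  forall Delta delta, 0 < Delta -> 0 < delta ->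
  exists omega_star, 0 < omega_star /\
  forall omega, omega_star <= omega ->
  let v := fun x t => g x omega t in
  (forall r, delta < r -> exists eps, 0 < eps /\
     forall t0, forward_implies v t0
       (fun x => dist_set S x <= eps) (fun _ x => dist_set S x <= r)) /\
  (forall eps, eps < Delta -> exists r, 0 < r /\
     forall t0, forward_implies v t0
       (fun x => dist_set S x <= eps) (fun _ x => dist_set S x <= r)) /\
  (forall r eps, r < Delta -> delta < eps -> exists T, 0 < T /\
     forall t0, forward_implies v t0
       (fun x => dist_set S x <= r)
       (fun t x => t0 + T <= t -> dist_set S x <= eps)).

Definition lienard (m : nat) (f : R -> R) (gamma : 'I_m -> 'I_m -> R -> R)
    (xi : state m) (omega t : R) : state m :=
  fun i =>
    let q j := fst (xi j) in
    let p j := snd (xi j) in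
    (omega * p i,
     - omega * q i - f (q i) * p i +
       \big[Rplus/0]_(j | j != i) gamma i j (p j - p i)).

(* Main.v *)
Require Import Defs.
From mathcomp Require Import ssreflect ssrfun ssrbool eqtype ssrnat seq fintype bigop.
From Stdlib Require Import Reals Lra Lia Relations.
From Coquelicot Require Import Coquelicot.
From mathcomp Require Import zify.
Open Scope R_scope.

(** For large [omega] each oscillator is a fast rotation, perturbed by the force
    [- f(q_i) p_i + sum_j gamma_ij (p_j - p_i)]. Seen from the rotating frame, a state
    moves under the force alone ([rotating_frame_derive]); over one period
    [T = 2 pi / omega], after which the frame is back in place, it changes by [T] times
    the mean of the force along a circle, up to [O(T^2)] ([period_step]). The mean is
    explicit: the friction contributes [- damp f xi_i] times [xi_i] and each coupling
    [gain gamma_ij (xi_j - xi_i)] times [xi_j - xi_i], since the components orthogonal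
    to these vectors are means of exact derivatives ([damp_mean], [gain_mean]). Hence
    the solution sampled once per period obeys a recursion [avg_step] in which every
    state moves towards a convex combination of the others and is scaled radially.

    The factor [damp f z] is [kappa(|z|) / |z|]. It is negative inside the circle of
    radius [rho] and positive outside ([damp_neg], [damp_pos]): up to [s0] because
    [kappa] is a weighted mean of [F], and beyond because [s kappa(s)] increases
    ([semicircle_moment_increasing]). The gains are nonnegative, and bounded away from
    0 on the edges of the graph as long as the two states are apart ([gain_lower]).

    Convergence to the set [B] follows since the coupling never increases the largest
    norm, while the damping makes it decrease at a definite speed until it is close to
    [rho] ([norm_invariant]).

    For the set [R], the compact convex set [D] lies in a cone of opening less than pi
    with apex at the origin ([separation]). The two half-planes that bound a cone are
    preserved by the averaged recursion, as the damping acts radially and the coupling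
    takes convex combinations ([cone_slope_step]); and within a cone no state can
    approach the origin, where the damping is negative ([cone_level_step]). The root of
    the graph is far from one of the two sides of the cone. This margin spreads along
    the edges until every node has it ([stage_margin], [depth_margin]), so that this
    side can be moved inwards by a fixed amount ([subwindow]). Repeating this makes the
    cone as narrow as desired; in a narrow cone the smallest projection on the axis
    then climbs close to [rho], while the largest norm sinks close to [rho]: the states
    are near a common point of the circle ([capture]). The common phase is not
    controlled, and the averaging errors add up over infinite time; but over one window
    they are [O(T)], and the contraction at the end of the window makes up for them, so
    the argument can be repeated for ever with a new axis each time ([lock_forever]).

    All these bounds hold for every solution on every interval. Existence is deduced
    from them, by Picard iteration for a clipped vector field ([solution_exists]). *)

(** * Real induction, finite choice and finite sums *)

(** This replaces every argument about the first time at which a bound fails. *)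
Lemma real_induction (a b : R) (P : R -> Prop) :
  P a ->
  (forall x, a <= x < b -> (forall y, a <= y <= x -> P y) ->
     exists e, 0 < e /\ forall y, x < y < x + e -> y <= b -> P y) ->
  (forall x, a < x <= b -> (forall y, a <= y < x -> P y) -> P x) ->
  forall x, a <= x <= b -> P x.
Proof.
move=> Pa right left x [ax xb].
pose E y := a <= y <= b /\ forall z, a <= z <= y -> P z.
have Ea : E a by split; [lra | move=> z hz; have -> : z = a by lra].
have Eb : bound E by exists b => y [hy _]; lra.
have [c [ub lub]] := completeness E Eb (ex_intro _ a Ea).
have ac : a <= c by apply: ub.
have cb : c <= b by apply: lub => y [hy _]; lra.
have below y : a <= y < c -> P y.
  move=> hy; apply: Classical_Prop.NNPP => nP.
  have : c <= y; last lra.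
  apply: lub => z [hz Pz]; case: (Rle_lt_dec z y) => // yz.
  by exfalso; apply: nP; apply: Pz; lra.
have Pc : P c.
  case: (Rle_lt_or_eq_dec _ _ ac) => [lt_ac | <- //].
  by apply: left.
have Pall y : a <= y <= c -> P y.
  by move=> hy; case: (Rle_lt_or_eq_dec _ _ (proj2 hy)) => [lt | -> //]; apply: below; lra.
case: (Rle_lt_or_eq_dec _ _ cb) => [lt_cb | e]; last by apply: Pall; lra.
have [e [e0 he]] := right c (conj ac lt_cb) Pall.
have : Rmin b (c + e / 2) <= c; last by rewrite /Rmin; case: Rle_dec; lra.
apply: ub; split; first by rewrite /Rmin; case: Rle_dec; lra.
move=> z hz; case: (Rle_lt_dec z c) => zc; first by apply: Pall; lra.
by apply: he; move: hz; rewrite /Rmin; case: Rle_dec; lra.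
Qed.

(** Constants found node by node are merged into one. *)
Lemma fin_uniform (I : finType) (A : Type) (le : A -> A -> Prop)
    (P : I -> A -> Prop) (a0 : A) :
  (forall a b, exists c, le a c /\ le b c) ->
  (forall i a b, le a b -> P i a -> P i b) ->
  (forall i, exists a, P i a) -> exists a, forall i, P i a.
Proof.
move=> dir mono ex.
suff [a ha] : exists a, forall i, i \in enum I -> P i a.
  by exists a => i; apply: ha; rewrite mem_enum.
elim: (enum I) => [|i s [a ha]]; first by exists a0.
have [b hb] := ex i; have [c [ac bc]] := dir a b.
exists c => j; rewrite in_cons => /orP [/eqP -> | js].
  exact: mono bc hb.
exact: mono ac (ha _ js).
Qed.

Lemma fin_small (I : finType) (P : I -> R -> Prop) :
  (forall i e e', 0 < e' <= e -> P i e -> P i e') ->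
  (forall i, exists e, 0 < e /\ P i e) ->
  exists e, 0 < e /\ forall i, P i e.
Proof.
move=> mono ex.
have [//|||e he] := @fin_uniform I posreal (fun a b => b <= a) (fun i e => P i e) (mkposreal 1 Rlt_0_1).
- move=> a b; have ab : 0 < Rmin a b by apply: Rmin_case; apply: cond_pos.
  by exists (mkposreal _ ab); split; [apply: Rmin_l | apply: Rmin_r].
- by move=> i a b ab; apply: mono; split=> //; apply: cond_pos.
- by move=> i; have [e [e0 he]] := ex i; exists (mkposreal _ e0).
by exists e; split=> //; apply: cond_pos.
Qed.

Lemma fin_large (I : finType) (P : I -> R -> Prop) :
  (forall i L L', L <= L' -> P i L -> P i L') ->
  (forall i, exists L, P i L) -> exists L, 0 <= L /\ forall i, P i L.
Proof.
move=> mono ex.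
have [|||L hL] := @fin_uniform I R Rle P 0.
- by move=> a b; exists (Rmax a b); split; [apply: Rmax_l | apply: Rmax_r].
- by move=> i a b ab; apply: mono.
- by [].
exists (Rmax 0 L); split; first exact: Rmax_l.
by move=> i; apply: mono (hL i); apply: Rmax_r.
Qed.

Lemma sum_le (I : finType) (P : pred I) (F G : I -> R) :
  (forall j, P j -> F j <= G j) ->
  \big[Rplus/0]_(j | P j) F j <= \big[Rplus/0]_(j | P j) G j.
Proof. by move=> h; elim/big_rec2: _ => [|j x y Pj hxy]; [lra | have := h j Pj; lra]. Qed.

Lemma sum_distr (I : finType) (P : pred I) (c : R) (F : I -> R) :
  c * \big[Rplus/0]_(j | P j) F j = \big[Rplus/0]_(j | P j) (c * F j).
Proof. by elim/big_rec2: _ => [|j x y Pj <-]; ring. Qed.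

Lemma sum_sub (I : finType) (P : pred I) (F G : I -> R) :
  \big[Rplus/0]_(j | P j) F j - \big[Rplus/0]_(j | P j) G j
  = \big[Rplus/0]_(j | P j) (F j - G j).
Proof. by elim/big_rec3: _ => [|j x y z Pj <-]; ring. Qed.

Lemma sum_const (m : nat) (c : R) : \big[Rplus/0]_(j < m) c = INR m * c.
Proof.
elim: m => [|m IH]; first by rewrite big_ord0 /=; ring.
by rewrite big_ord_recl IH S_INR; ring.
Qed.

Lemma sum_nonneg_subset (I : finType) (P : pred I) (F : I -> R) :
  (forall j, 0 <= F j) ->
  \big[Rplus/0]_(j | P j) F j <= \big[Rplus/0]_j F j.
Proof.
move=> h; rewrite (big_mkcond P); apply: sum_le => j _.
by case: (P j); [lra | apply: h].
Qed.

Lemma sum_nonneg (I : finType) (P : pred I) (F : I -> R) :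
  (forall j, P j -> 0 <= F j) -> 0 <= \big[Rplus/0]_(j | P j) F j.
Proof. by move=> h; elim/big_rec: _ => [|j x Pj hx]; [lra | have := h j Pj; lra]. Qed.

Lemma sum_abs (I : finType) (P : pred I) (F : I -> R) :
  Rabs (\big[Rplus/0]_(j | P j) F j) <= \big[Rplus/0]_(j | P j) Rabs (F j).
Proof.
elim/big_rec2: _ => [|j x y Pj hxy]; first by rewrite Rabs_R0; lra.
by have := Rabs_triang (F j) y; lra.
Qed.

Lemma sum_bound (m : nat) (P : pred 'I_m) (F : 'I_m -> R) (c : R) :
  0 <= c -> (forall j, P j -> Rabs (F j) <= c) ->
  Rabs (\big[Rplus/0]_(j | P j) F j) <= INR m * c.
Proof.
move=> c0 h; apply: Rle_trans (sum_abs _ _ _) _.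
apply: (Rle_trans _ (\big[Rplus/0]_(j | P j) c)); first exact: sum_le.
by rewrite -sum_const; apply: sum_nonneg_subset.
Qed.

Lemma sum_ge_term (I : finType) (P : pred I) (F : I -> R) (j : I) :
  P j -> (forall k, P k -> 0 <= F k) -> F j <= \big[Rplus/0]_(k | P k) F k.
Proof.
move=> Pj h; rewrite (bigD1 j) //=.
have := @sum_nonneg I (fun k => P k && (k != j)) F.
by move=> /(_ (fun k Pk => h k (proj1 (andP Pk)))); lra.
Qed.

(** * Lipschitz bounds and increments *)

Definition lipschitz_on (f : R -> R) (a b L : R) : Prop :=
  forall x y, a <= x <= b -> a <= y <= b -> Rabs (f x - f y) <= L * Rabs (x - y).

Lemma lipschitz_on_glue f a c b L1 L2 :
  a <= c <= b -> lipschitz_on f a c L1 -> lipschitz_on f c b L2 ->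
  lipschitz_on f a b (Rmax L1 L2).
Proof.
move=> acb h1 h2.
have key x y : a <= x <= b -> a <= y <= b -> x <= y ->
    Rabs (f x - f y) <= Rmax L1 L2 * Rabs (x - y).
  move=> hx hy xy; have m1 := Rmax_l L1 L2; have m2 := Rmax_r L1 L2.
  have e0 := Rabs_pos (x - y).
  case: (Rle_lt_dec y c) => yc.
    by have := h1 x y; nra.
  case: (Rle_lt_dec c x) => cx.
    by have := h2 x y; nra.
  have H1 := h1 x c; have H2 := h2 c y.
  have H3 := Rabs_triang (f x - f c) (f c - f y).
  rewrite (_ : f x - f c + (f c - f y) = f x - f y) in H3; last ring.
  rewrite (Rabs_left1 (x - y)); last lra.
  move: H1 H2; rewrite (Rabs_left1 (x - c)) ?(Rabs_left1 (c - y)); try lra.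
  by move=> H1 H2; have := H1 ltac:(lra) ltac:(lra); have := H2 ltac:(lra) ltac:(lra); nra.
move=> x y hx hy; case: (Rle_lt_dec x y) => xy; first exact: key.
by rewrite Rabs_minus_sym (Rabs_minus_sym x); apply: key => //; lra.
Qed.

(** Both the comparison of the force with its value on a circle and the existence
    of solutions need one Lipschitz constant for a whole bounded region. *)
Lemma locally_lipschitz_segment f M :
  locally_lipschitz f -> exists L, 0 <= L /\ lipschitz_on f (- M) M L.
Proof.
move=> loc; case: (Rlt_le_dec M 0) => M0.
  by exists 0; split; [lra | move=> x y; lra].
suff [L hL] : exists L, lipschitz_on f (- M) M L.
  exists (Rmax 0 L); split; first exact: Rmax_l.
  move=> x y hx hy; apply: Rle_trans (hL x y hx hy) _.
  by apply: Rmult_le_compat_r; [apply: Rabs_pos | apply: Rmax_r].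
apply: (real_induction (- M) M (fun b => exists L, lipschitz_on f (- M) b L)); last lra.
- exists 0 => x y hx hy; rewrite (_ : x = y); last lra.
  by rewrite !Rminus_diag Rabs_R0; lra.
- move=> x hx /(_ x) [| L1 h1]; first lra.
  have [d [L2 [d0 h2]]] := loc x.
  exists d; split=> // y hy _; exists (Rmax L1 L2).
  apply: (lipschitz_on_glue _ _ x) => //; first lra.
  by move=> u v hu hv; apply: h2; rewrite Rabs_pos_eq; lra.
- move=> x hx before; have [d [L2 [d0 h2]]] := loc x.
  have [|L1 h1] := before (Rmax (- M) (x - d / 2)).
    by rewrite /Rmax; case: Rle_dec; lra.
  exists (Rmax L1 L2).
  apply: (lipschitz_on_glue _ _ (Rmax (- M) (x - d / 2))); [| exact: h1 |].
    by rewrite /Rmax; case: Rle_dec; lra.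
  move=> u v hu hv; apply: h2; rewrite Rabs_left1; move: hu hv;
    by rewrite /Rmax; case: Rle_dec; lra.
Qed.

Lemma locally_lipschitz_continuous f x : locally_lipschitz f -> continuous f x.
Proof.
move=> loc; have [d [L [d0 h]]] := loc x.
apply/continuity_pt_filterlim => e e0.
have K0 : 0 < Rabs L + 1 by have := Rabs_pos L; lra.
exists (Rmin d (e / (Rabs L + 1))); split.
  by apply: Rmin_case => //; apply: Rdiv_lt_0_compat.
move=> y [_]; rewrite /dist /= /R_dist => hy.
have y1 : Rabs (y - x) < d by apply: Rlt_le_trans hy (Rmin_l _ _).
have y2 : Rabs (y - x) < e / (Rabs L + 1) by apply: Rlt_le_trans hy (Rmin_r _ _).
have := h y x y1; rewrite Rminus_diag Rabs_R0 => /(_ d0) H.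
apply: Rle_lt_trans H _.
have := Rmult_lt_compat_l _ _ _ K0 y2.
rewrite (_ : (Rabs L + 1) * (e / (Rabs L + 1)) = e); last by field; lra.
have := Rle_abs L; have := Rabs_pos (y - x); nra.
Qed.

Lemma Rmin_spec a b : (a <= b /\ Rmin a b = a) \/ (b < a /\ Rmin a b = b).
Proof. by rewrite /Rmin; case: Rle_dec; [left | right]; lra. Qed.

Lemma Rmax_spec a b : (a <= b /\ Rmax a b = b) \/ (b < a /\ Rmax a b = a).
Proof. by rewrite /Rmax; case: Rle_dec; [left | right]; lra. Qed.

Lemma clamp_contraction a b s t : a <= b ->
  Rabs (Rmax a (Rmin b s) - Rmax a (Rmin b t)) <= Rabs (s - t).
Proof.
move=> ab.
by case: (Rmin_spec b s) => -[? ?]; case: (Rmin_spec b t) => -[? ?];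
  case: (Rmax_spec a (Rmin b s)) => -[? ?]; case: (Rmax_spec a (Rmin b t)) => -[? ?];
  split_Rabs; lra.
Qed.

Lemma clamp_in a b s : a <= b -> a <= Rmax a (Rmin b s) <= b.
Proof. move=> ab.
by case: (Rmin_spec b s) => -[? ?]; case: (Rmax_spec a (Rmin b s)) => -[? ?]; lra.
Qed.

Lemma clamp_id a b s : a <= s <= b -> Rmax a (Rmin b s) = s.
Proof. by move=> h; rewrite Rmin_right ?Rmax_right; lra. Qed.

(** Only one-sided continuity is available at the initial time of a solution, so
    the mean value theorem is applied to the function frozen outside [a, b]. *)
Lemma increment_bound (f df : R -> R) a b C :
  a <= b -> continuous_on (fun t => a <= t <= b) f ->
  (forall t, a < t < b -> is_derive f t (df t) /\ Rabs (df t) <= C) ->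
  Rabs (f b - f a) <= C * (b - a).
Proof.
move=> ab cont der.
case: (Rle_lt_or_eq_dec _ _ ab) => [lt_ab | <-]; last first.
  by rewrite !Rminus_diag Rabs_R0; lra.
pose g t := f (Rmax a (Rmin b t)).
have ga : g a = f a by rewrite /g clamp_id //; lra.
have gb : g b = f b by rewrite /g clamp_id //; lra.
have dg t : a < t < b -> is_derive g t (df t).
  move=> ht; apply: (is_derive_ext_loc f); last exact: (proj1 (der t ht)).
  have e0 : 0 < Rmin (t - a) (b - t) by apply: Rmin_case; lra.
  exists (mkposreal _ e0) => y /=; rewrite /ball /= /AbsRing_ball /abs /= /minus /plus /opp /= => hy.
  rewrite /g clamp_id //; have := Rmin_l (t - a) (b - t); have := Rmin_r (t - a) (b - t).
  by move: hy; rewrite /Rabs; case: Rcase_abs; lra.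
have cg t : continuity_pt g t.
  apply/continuity_pt_filterlim => P hP.
  have [e he] := cont _ (clamp_in a b t ab) P hP.
  exists e => y hy; apply: he; last exact: clamp_in.
  by apply: Rle_lt_trans hy; apply: clamp_contraction.
pose df' t := if Rlt_dec a t then if Rlt_dec t b then df t else 0 else 0.
have C0 : 0 <= C.
  by have := Rabs_pos (df ((a + b) / 2)); have [] := der ((a + b) / 2) ltac:(lra); lra.
have bd t : Rabs (df' t) <= C.
  rewrite /df'; case: Rlt_dec => h1; last by rewrite Rabs_R0.
  case: Rlt_dec => h2; last by rewrite Rabs_R0.
  by case: (der t (conj h1 h2)).
have [||c [_ e]] := MVT_gen g a b df'.
- move=> x; rewrite Rmin_left ?Rmax_right; try lra.
  by move=> hx; rewrite /df'; do 2 (case: Rlt_dec => ?; last lra); apply: dg.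
- by move=> x _; apply: cg.
rewrite -ga -gb e Rabs_mult (Rabs_pos_eq (b - a)); last lra.
by apply: Rmult_le_compat_r; [lra | apply: bd].
Qed.

(** * Integrals of continuous functions *)

Lemma continuous_times (f g : R -> R) x :
  continuous f x -> continuous g x -> continuous (fun t => f t * g t) x.
Proof. by move=> hf hg; apply: (continuous_mult f g). Qed.

Lemma continuous_comp_all (f g : R -> R) x :
  (forall y, continuous f y) -> continuous g x -> continuous (fun t => f (g t)) x.
Proof. by move=> cf cg; apply: continuous_comp. Qed.

Lemma ex_RInt_all (f : R -> R) a b : (forall x, continuous f x) -> ex_RInt f a b.
Proof. by move=> h; apply: ex_RInt_continuous => z _; apply: h. Qed.

Lemma RInt_times (g : R -> R) a b c : (forall x, continuous g x) ->
  RInt (fun x => c * g x) a b = c * RInt g a b.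
Proof. by move=> cg; apply: (RInt_scal g); apply: ex_RInt_all. Qed.

Lemma RInt_sub (g h : R -> R) a b :
  (forall x, continuous g x) -> (forall x, continuous h x) ->
  RInt (fun x => g x - h x) a b = RInt g a b - RInt h a b.
Proof. by move=> cg ch; apply: (RInt_minus g h); apply: ex_RInt_all. Qed.

Lemma RInt_exact (G g : R -> R) a b : a <= b ->
  (forall x, a <= x <= b -> is_derive G x (g x)) ->
  (forall x, a <= x <= b -> continuous g x) -> RInt g a b = G b - G a.
Proof.
move=> ab dG cg; apply: is_RInt_unique; apply: (is_RInt_derive G g) => x;
  rewrite Rmin_left ?Rmax_right //; [exact: dG | exact: cg].
Qed.

Lemma primitive_derive (h : R -> R) t :
  (forall s, continuous h s) -> is_derive (fun u => RInt h 0 u) t (h t).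
Proof.
move=> ch; apply: is_derive_RInt => //.
by apply: filter_forall => u; apply: RInt_correct; apply: ex_RInt_all.
Qed.

(** * Forward solutions of globally Lipschitz equations *)

Lemma lipschitz_continuous (h : R -> R) K :
  (forall s t, Rabs (h s - h t) <= K * Rabs (s - t)) -> forall t, continuous h t.
Proof.
move=> lip t; apply: locally_lipschitz_continuous => x.
by exists 1, K; split; [lra | move=> y z _ _; apply: lip].
Qed.

Lemma zero_of_le_geom a C : (forall n, Rabs a <= C * (/ 2) ^ n) -> a = 0.
Proof.
move=> h.
have lim : is_lim_seq (fun n => C * (/ 2) ^ n) (C * 0).
  apply: (is_lim_seq_scal_l _ C (Finite 0)); apply: is_lim_seq_geom.
  by rewrite Rabs_pos_eq; lra.
have /= := is_lim_seq_le _ _ (Finite (Rabs a)) (Finite (C * 0)) h (is_lim_seq_const _) lim.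
by rewrite Rmult_0_r; split_Rabs; lra.
Qed.

Section Picard.

Variables (I : Type) (g : (I -> R) -> I -> R) (B L : R) (x0 : I -> R).
Hypotheses (L_gt0 : 0 < L) (g_bound : forall x i, Rabs (g x i) <= B).
Hypothesis g_lip : forall x y D, (forall j, Rabs (x j - y j) <= D) ->
  forall i, Rabs (g x i - g y i) <= L * D.

Lemma picard_bound_ge0 (i : I) : 0 <= B.
Proof. by have := g_bound x0 i; have := Rabs_pos (g x0 i); lra. Qed.

Fixpoint picard_iter (n : nat) (t : R) (i : I) : R :=
  if n is S n' then x0 i + RInt (fun s => g (picard_iter n' s) i) 0 t else x0 i.

Lemma picard_iterS n t i :
  picard_iter n.+1 t i = x0 i + RInt (fun s => g (picard_iter n s) i) 0 t.
Proof. by []. Qed.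

Lemma picard_field_continuous (x : R -> I -> R) :
  (forall s t i, Rabs (x s i - x t i) <= B * Rabs (s - t)) ->
  forall i t, continuous (fun s => g (x s) i) t.
Proof.
move=> lip i; apply: (lipschitz_continuous _ (L * B)) => s t.
by rewrite Rmult_assoc; apply: g_lip => j; apply: lip.
Qed.

(** A Lipschitz bound in time that is common to all coordinates makes the field
    continuous along the iterates, whatever the index type. *)
Lemma picard_iter_lip n s t i :
  Rabs (picard_iter n s i - picard_iter n t i) <= B * Rabs (s - t).
Proof.
elim: n s t i => [|n IH] s t i /=.
  rewrite Rminus_diag Rabs_R0; apply: Rmult_le_pos; last exact: Rabs_pos.
  by have := g_bound x0 i; have := Rabs_pos (g x0 i); lra.
have cont := picard_field_continuous (picard_iter n) IH i.
rewrite (_ : _ - _ = RInt (fun u => g (picard_iter n u) i) 0 s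
                     - RInt (fun u => g (picard_iter n u) i) 0 t); last ring.
apply: (bounded_variation _ (fun u => g (picard_iter n u) i)) => u _.
by split; [apply: primitive_derive | apply: g_bound].
Qed.

Lemma picard_iter_continuous n i t : continuous (fun s => g (picard_iter n s) i) t.
Proof. by apply: picard_field_continuous; apply: picard_iter_lip. Qed.

(** The weight [exp (2 L t)] makes each iteration a contraction by one half on
    the whole half-line, so that no gluing of short time intervals is needed. *)
Lemma picard_step_bound n t i : 0 <= t ->
  Rabs (picard_iter n.+1 t i - picard_iter n t i)
    <= B / (2 * L) * (/ 2) ^ n * exp (2 * L * t).
Proof.
elim: n t i => [|n IH] t i t0.
  have -> : picard_iter 1 t i - picard_iter 0 t i =
      RInt (fun s => g (picard_iter 0 s) i) 0 t.
    by rewrite picard_iterS; set r := RInt _ _ _; rewrite /=; ring.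
  have B0 := picard_bound_ge0 i.
  have H := abs_RInt_le_const (fun s => g (picard_iter 0 s) i) 0 t B t0
              (ex_RInt_const 0 t (g x0 i)) (fun _ _ => g_bound _ i).
  apply: Rle_trans H _; have e := exp_ineq1_le (2 * L * t).
  rewrite (_ : (t - 0) * B = B / (2 * L) * (2 * L * t)); last by field; lra.
  rewrite /= Rmult_1_r; apply: Rmult_le_compat_l; last lra.
  by apply: Rdiv_le_0_compat; lra.
set C := B / (2 * L) * (/ 2) ^ n.
have -> : picard_iter n.+2 t i - picard_iter n.+1 t i =
    RInt (fun s => g (picard_iter n.+1 s) i - g (picard_iter n s) i) 0 t.
  rewrite (RInt_minus (fun s => g (picard_iter n.+1 s) i) (fun s => g (picard_iter n s) i)).
  - rewrite 2!picard_iterS /minus /plus /opp; cbn -[picard_iter]; ring.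
  - by apply: ex_RInt_continuous => z _; apply: picard_iter_continuous.
  - by apply: ex_RInt_continuous => z _; apply: picard_iter_continuous.
have int : is_RInt (fun s => L * (C * exp (2 * L * s))) 0 t
    (minus (C / 2 * exp (2 * L * t)) (C / 2 * exp (2 * L * 0))).
  apply: (is_RInt_derive (fun s => C / 2 * exp (2 * L * s))) => s _.
    by auto_derive => //; field.
  by apply: ex_derive_continuous; auto_derive.
apply: (Rle_trans _ (minus (C / 2 * exp (2 * L * t)) (C / 2 * exp (2 * L * 0)))).
  apply: (norm_RInt_le (fun s => g (picard_iter n.+1 s) i - g (picard_iter n s) i)
            (fun s => L * (C * exp (2 * L * s))) 0 t _ _ t0 _ _ int).
    by move=> s hs; apply: g_lip => j; apply: IH; lra.
  apply: RInt_correct; apply: ex_RInt_continuous => z _.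
  by apply: (continuous_minus (fun s => g (picard_iter n.+1 s) i)); apply: picard_iter_continuous.
- rewrite /minus /plus /opp /= Rmult_0_r exp_0.
  have C0 : 0 <= C.
    apply: Rmult_le_pos; last by apply: pow_le; lra.
    apply: Rdiv_le_0_compat; last lra.
    by have := g_bound x0 i; have := Rabs_pos (g x0 i); lra.
  rewrite (_ : B / (2 * L) * (/ 2 * (/ 2) ^ n) = C / 2); last by rewrite /C; field; lra.
  by lra.
Qed.

Lemma picard_tail_bound n k t i : 0 <= t ->
  Rabs (picard_iter (k + n) t i - picard_iter n t i)
    <= 2 * (B / (2 * L) * exp (2 * L * t)) * (/ 2) ^ n * (1 - (/ 2) ^ k).
Proof.
move=> t0; elim: k => [|k IH].
  by rewrite add0n Rminus_diag Rabs_R0 /=; lra.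
have := picard_step_bound (k + n) t i t0; rewrite addSn pow_add.
have := Rabs_triang (picard_iter (k + n).+1 t i - picard_iter (k + n) t i)
          (picard_iter (k + n) t i - picard_iter n t i).
rewrite (_ : _ - _ + (_ - _) = picard_iter (k + n).+1 t i - picard_iter n t i); last ring.
move=> h1 h2; apply: Rle_trans h1 _.
apply: Rle_trans (Rplus_le_compat _ _ _ _ h2 IH) _; right => /=; field; lra.
Qed.

(** Time is cut at 0 because the iterates are only controlled forwards. *)
Definition picard_limit (t : R) (i : I) : R :=
  real (Lim_seq (fun n => picard_iter n (Rmax 0 t) i)).

Lemma picard_limit_lim t i :
  is_lim_seq (fun n => picard_iter n (Rmax 0 t) i) (picard_limit t i).
Proof.
apply: Lim_seq_correct'; apply/ex_lim_seq_cauchy_corr => e.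
have s0 : 0 <= Rmax 0 t by apply: Rmax_l.
set s := Rmax 0 t in s0 *; set C := 2 * (B / (2 * L) * exp (2 * L * s)).
have B0 := picard_bound_ge0 i.
have C0 : 0 <= C.
  apply: Rmult_le_pos; first lra.
  by apply: Rmult_le_pos; [apply: Rdiv_le_0_compat; lra | apply: Rlt_le; apply: exp_pos].
have lim : is_lim_seq (fun n => C * (/ 2) ^ n) (C * 0).
  apply: (is_lim_seq_scal_l _ C (Finite 0)); apply: is_lim_seq_geom.
  by rewrite Rabs_pos_eq; lra.
have e4 : 0 < e / 4 by have := cond_pos e; lra.
move: lim; rewrite Rmult_0_r => /is_lim_seq_spec /(_ (mkposreal _ e4)) [N hN].
have tail p : (N <= p)%coq_nat -> Rabs (picard_iter p s i - picard_iter N s i) < e / 4.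
  move=> Np; have := picard_tail_bound N (p - N) s i s0.
  rewrite (_ : (p - N + N)%nat = p); last lia.
  have := hN N (le_n _) => /=; rewrite Rminus_0_r => h1 h2; apply: Rle_lt_trans h2 _.
  have q0 : 0 <= (/ 2) ^ N by apply: pow_le; lra.
  have q1 : 0 <= (/ 2) ^ (p - N) by apply: pow_le; lra.
  rewrite Rabs_pos_eq in h1; last by apply: Rmult_le_pos.
  have := Rmult_le_pos _ _ (Rmult_le_pos _ _ C0 q0) q1.
  by rewrite -/C; lra.
exists N => p q /tail hp /tail hq; have := cond_pos e.
by move: hp hq; split_Rabs; lra.
Qed.

Lemma picard_limit_bound n t i : 0 <= t ->
  Rabs (picard_limit t i - picard_iter n t i)
    <= 2 * (B / (2 * L) * exp (2 * L * t)) * (/ 2) ^ n.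
Proof.
move=> t0; have lim := picard_limit_lim t i; rewrite Rmax_right // in lim.
have B0 := picard_bound_ge0 i.
have C0 : 0 <= 2 * (B / (2 * L) * exp (2 * L * t)) * (/ 2) ^ n.
  apply: Rmult_le_pos; last by apply: pow_le; lra.
  apply: Rmult_le_pos; first lra.
  by apply: Rmult_le_pos; [apply: Rdiv_le_0_compat; lra | apply: Rlt_le; apply: exp_pos].
have lim' : is_lim_seq (fun k => Rabs (picard_iter (k + n) t i - picard_iter n t i))
    (Rbar_abs (picard_limit t i - picard_iter n t i)).
  apply: is_lim_seq_abs; apply: is_lim_seq_minus'; last exact: is_lim_seq_const.
  by apply/(is_lim_seq_incr_n (fun k => picard_iter k t i) n).
apply: (is_lim_seq_le _ _ (Finite _) (Finite _) _ lim' (is_lim_seq_const _)) => k.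
have := picard_tail_bound n k t i t0.
have q1 : 0 <= (/ 2) ^ k by apply: pow_le; lra.
by have := Rmult_le_pos _ _ C0 q1; lra.
Qed.

Lemma picard_limit_lip s t i :
  Rabs (picard_limit s i - picard_limit t i) <= B * Rabs (s - t).
Proof.
have B0 := picard_bound_ge0 i.
have lim : is_lim_seq
    (fun n => Rabs (picard_iter n (Rmax 0 s) i - picard_iter n (Rmax 0 t) i))
    (Rbar_abs (picard_limit s i - picard_limit t i)).
  by apply: is_lim_seq_abs; apply: is_lim_seq_minus'; apply: picard_limit_lim.
apply: (is_lim_seq_le _ _ (Finite _) (Finite _) _ lim (is_lim_seq_const _)) => n.
apply: Rle_trans (picard_iter_lip n _ _ i) _; apply: Rmult_le_compat_l => //.
by case: (Rmax_spec 0 s) => -[? ->]; case: (Rmax_spec 0 t) => -[? ->]; split_Rabs; lra.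
Qed.

Lemma picard_limit_equation t i : 0 <= t ->
  picard_limit t i = x0 i + RInt (fun s => g (picard_limit s) i) 0 t.
Proof.
move=> t0; have B0 := picard_bound_ge0 i.
set C := 2 * (B / (2 * L) * exp (2 * L * t)).
have K0 : 0 <= B / (2 * L) by apply: Rdiv_le_0_compat; lra.
have C0 : 0 <= C by have := exp_pos (2 * L * t); rewrite /C; nra.
apply: Rminus_diag_uniq; apply: (zero_of_le_geom _ (C + t * (L * C))) => n.
have cl := picard_field_continuous picard_limit picard_limit_lip i.
have H1 := picard_limit_bound n.+1 t i t0.
have : Rabs (RInt (fun s => g (picard_iter n s) i - g (picard_limit s) i) 0 t)
    <= (t - 0) * (L * (C * (/ 2) ^ n)).
  apply: abs_RInt_le_const => //.
    apply: ex_RInt_continuous => z _.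
    by apply: (continuous_minus (fun s => g (picard_iter n s) i)); [apply: picard_iter_continuous | apply: cl].
  move=> s hs; apply: g_lip => j; rewrite Rabs_minus_sym.
  apply: Rle_trans (picard_limit_bound n s j _) _; first lra.
  apply: Rmult_le_compat_r; first by apply: pow_le; lra.
  apply: Rmult_le_compat_l; first lra.
  apply: Rmult_le_compat_l => //.
  by case: (Rle_lt_or_eq_dec s t (proj2 hs)) => [lt | ->]; [left; apply: exp_increasing; nra | lra].
rewrite (RInt_minus (fun s => g (picard_iter n s) i) (fun s => g (picard_limit s) i)); first last.
- by apply: ex_RInt_continuous => z _; apply: cl.
- by apply: ex_RInt_continuous => z _; apply: picard_iter_continuous.
rewrite /minus /plus /opp /= => H2; rewrite /= in H1.
have q0 : 0 <= (/ 2) ^ n by apply: pow_le; lra.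
have := Rmult_le_pos _ _ C0 q0; rewrite -/C in H1.
move: H1 H2; split_Rabs; nra.
Qed.

Theorem picard_forward_solution : exists x : R -> I -> R,
  (forall i, x 0 i = x0 i) /\
  (forall t i, continuous (fun s => x s i) t) /\
  forall t i, 0 < t -> is_derive (fun s => x s i) t (g (x t) i).
Proof.
exists picard_limit; split; [|split].
- by move=> i; rewrite picard_limit_equation ?RInt_point /zero /=; lra.
- move=> t i; apply: (lipschitz_continuous _ B) => u v; exact: picard_limit_lip.
move=> t i t0.
apply: (is_derive_ext_loc (fun t => x0 i + RInt (fun s => g (picard_limit s) i) 0 t)).
  exists (mkposreal _ t0) => y; rewrite /ball /= /AbsRing_ball /abs /minus /plus /opp /= => hy.
  by rewrite -picard_limit_equation //; move: hy; split_Rabs; lra.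
rewrite -(Rplus_0_l (g _ _)); apply: is_derive_plus; first exact: is_derive_const.
apply: primitive_derive; apply: picard_field_continuous; exact: picard_limit_lip.
Qed.

End Picard.

(** * The plane *)

Lemma plane_eq (x y : plane) : fst x = fst y :> R -> snd x = snd y :> R -> x = y.
Proof. exact: injective_projections. Qed.

Definition dot (w z : plane) : R := fst w * fst z + snd w * snd z.

Lemma norm_plane (z : plane) : norm z = sqrt (dot z z).
Proof.
case: z => x y; rewrite /norm /= /prod_norm /dot /norm /= /abs /=.
by congr sqrt; have := pow2_abs x; have := pow2_abs y; rewrite /=; lra.
Qed.

Lemma dot_self_ge0 z : 0 <= dot z z.
Proof. by rewrite /dot; nra. Qed.

Lemma norm_sq (z : plane) : norm z * norm z = dot z z.
Proof. by rewrite norm_plane; apply: sqrt_sqrt; apply: dot_self_ge0. Qed.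

Lemma norm_pos (z : plane) : 0 <= norm z.
Proof. by rewrite norm_plane; apply: sqrt_pos. Qed.

Lemma norm_le_of_sq (z : plane) r : 0 <= r -> dot z z <= r * r -> norm z <= r.
Proof. by rewrite -norm_sq; have := norm_pos z; nra. Qed.

Lemma dot_norm (w z : plane) : Rabs (dot w z) <= norm w * norm z.
Proof.
apply: Rsqr_incr_0; last 2 first.
- exact: Rabs_pos.
- by apply: Rmult_le_pos; apply: norm_pos.
rewrite -Rsqr_abs /Rsqr (_ : _ * _ * _ = (norm w * norm w) * (norm z * norm z)); last ring.
rewrite !norm_sq /dot.
have : 0 <= (fst w * snd z - snd w * fst z) ^ 2 by apply: pow2_ge_0.
by nra.
Qed.

Lemma fst_le_norm (z : plane) : Rabs (fst z) <= norm z.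
Proof.
rewrite norm_plane -sqrt_Rsqr_abs; apply: sqrt_le_1_alt; rewrite /dot /Rsqr.
by have := pow2_ge_0 (fst z); have := pow2_ge_0 (snd z); nra.
Qed.

Lemma snd_le_norm (z : plane) : Rabs (snd z) <= norm z.
Proof.
rewrite norm_plane -sqrt_Rsqr_abs; apply: sqrt_le_1_alt; rewrite /dot /Rsqr.
by have := pow2_ge_0 (fst z); have := pow2_ge_0 (snd z); nra.
Qed.

(** Every norm bound below is read off linear functionals, on which the recursion
    acts by scalar convex combinations. *)
Lemma norm_dual (z : plane) : exists w : plane, norm w = 1 /\ dot w z = norm z.
Proof.
case: (Req_dec (norm z) 0) => n0.
  exists ((1, 0) : plane); split.
    by rewrite norm_plane /dot /= (_ : _ + _ = 1) ?sqrt_1; lra.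
  have := fst_le_norm z; rewrite n0 /dot /= => h.
  by move: h; split_Rabs; lra.
have e := norm_sq z; set n := norm z in n0 e *; rewrite /dot in e.
have [x [y [ex ey]]] : exists x y : R, fst z = x /\ snd z = y by exists (fst z), (snd z).
exists ((x / n, y / n) : plane); move: e; rewrite norm_plane /dot /= ex ey => e.
split; last by apply: (Rmult_eq_reg_r n) => //; rewrite e; field.
rewrite (_ : _ + _ = (x * x + y * y) / (n * n)); last by field.
by rewrite -e /Rdiv Rinv_r ?sqrt_1 //; apply: Rmult_integral_contrapositive.
Qed.

Lemma fst_minus (x y : plane) : fst (minus x y) = fst x - fst y :> R.
Proof. by []. Qed.

Lemma snd_minus (x y : plane) : snd (minus x y) = snd x - snd y :> R.
Proof. by []. Qed.

Lemma dot_minus w (x y : plane) : dot w (minus x y) = dot w x - dot w y.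
Proof. by rewrite /dot fst_minus snd_minus; ring. Qed.

Lemma fst_scal c (z : plane) : fst (scal c z) = c * fst z :> R.
Proof. by []. Qed.

Lemma snd_scal c (z : plane) : snd (scal c z) = c * snd z :> R.
Proof. by []. Qed.

Lemma dot_scal w c (z : plane) : dot w (scal c z) = c * dot w z.
Proof. by rewrite /dot fst_scal snd_scal; ring. Qed.

Lemma dot_scal_l w c (z : plane) : dot (scal c w) z = c * dot w z.
Proof. by rewrite /dot fst_scal snd_scal; ring. Qed.

Lemma norm_scal_nonneg c (z : plane) : 0 <= c -> norm (scal c z) = c * norm z.
Proof.
move=> c0; rewrite !norm_plane dot_scal dot_scal_l -Rmult_assoc.
by rewrite sqrt_mult_alt ?sqrt_square //; nra.
Qed.

Lemma norm_minus_le (x y : plane) : norm (minus x y) <= norm x + norm y.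
Proof.
by apply: Rle_trans (norm_triangle x (opp y)) _; rewrite norm_opp; apply: Rle_refl.
Qed.

Lemma norm_minus_sym (x y : plane) : norm (minus x y) = norm (minus y x).
Proof. by rewrite !norm_plane /dot !fst_minus !snd_minus; congr sqrt; ring. Qed.

(** * Averages over a rotation *)

(** The flow of the undamped, uncoupled oscillator [q' = p, p' = - q]. *)
Definition turn (tau : R) (z : plane) : plane :=
  (cos tau * fst z + sin tau * snd z, cos tau * snd z - sin tau * fst z).

Lemma turn_fst t z : fst (turn t z) = cos t * fst z + sin t * snd z :> R.
Proof. by []. Qed.

Lemma turn_snd t z : snd (turn t z) = cos t * snd z - sin t * fst z :> R.
Proof. by []. Qed.

Lemma dot_turn tau w z : dot (turn tau w) (turn tau z) = dot w z.
Proof.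
rewrite /dot !turn_fst !turn_snd; have := sin2_cos2 tau; rewrite /Rsqr => e.
by rewrite -[RHS]Rmult_1_l -e; ring.
Qed.

Lemma norm_turn tau z : norm (turn tau z) = norm z.
Proof. by rewrite !norm_plane dot_turn. Qed.

Lemma turn_minus tau x y : turn tau (minus x y) = minus (turn tau x) (turn tau y).
Proof. apply: plane_eq; rewrite ?(fst_minus, snd_minus, turn_fst, turn_snd); ring. Qed.

Lemma turn_scal th c (z : plane) : turn th (scal c z) = scal c (turn th z).
Proof. by apply: plane_eq; rewrite ?(fst_scal, snd_scal, turn_fst, turn_snd); ring. Qed.

Lemma turn_opp_turn tau z : turn (- tau) (turn tau z) = z.
Proof.
have := sin2_cos2 tau; rewrite /Rsqr => e.
apply: plane_eq; rewrite !(turn_fst, turn_snd) cos_neg sin_neg.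
  by rewrite -[RHS]Rmult_1_l -e; ring.
by rewrite -[RHS]Rmult_1_l -e; ring.
Qed.

Lemma turn_turn_opp tau z : turn tau (turn (- tau) z) = z.
Proof. by rewrite -{1}(Ropp_involutive tau) turn_opp_turn. Qed.

Lemma is_derive_turn_fst z tau : is_derive (fun t => fst (turn t z)) tau (snd (turn tau z)).
Proof.
have [x [y [ex ey]]] : exists x y : R, fst z = x /\ snd z = y by exists (fst z), (snd z).
by rewrite /turn /= ex ey; auto_derive => //; ring.
Qed.

Lemma is_derive_turn_snd z tau : is_derive (fun t => snd (turn t z)) tau (- fst (turn tau z)).
Proof.
have [x [y [ex ey]]] : exists x y : R, fst z = x /\ snd z = y by exists (fst z), (snd z).
by rewrite /turn /= ex ey; auto_derive => //; ring.
Qed.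

Lemma turn_2PI z : turn (2 * PI) z = z.
Proof.
by apply: plane_eq; rewrite !(turn_fst, turn_snd) cos_2PI sin_2PI; ring.
Qed.

Lemma turn_0 z : turn 0 z = z.
Proof.
by apply: plane_eq; rewrite !(turn_fst, turn_snd) cos_0 sin_0; ring.
Qed.

Lemma continuous_turn_fst z tau : continuous (fun t => fst (turn t z)) tau.
Proof. by apply: ex_derive_continuous; exists (snd (turn tau z)); apply: is_derive_turn_fst. Qed.

Lemma continuous_turn_snd z tau : continuous (fun t => snd (turn t z)) tau.
Proof. by apply: ex_derive_continuous; exists (- fst (turn tau z)); apply: is_derive_turn_snd. Qed.

Definition circle_mean (g : R -> R) : R := RInt g 0 (2 * PI) / (2 * PI).

Lemma twoPI_gt0 : 0 < 2 * PI.
Proof. by have := PI_RGT_0; lra. Qed.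

Lemma circle_mean_ext (g : R -> R) h : (forall t, g t = h t) -> circle_mean g = circle_mean h.
Proof. by move=> e; rewrite /circle_mean (RInt_ext _ h) // => x _; apply: e. Qed.

Lemma circle_mean_lin a b (g h : R -> R) :
  (forall t, continuous g t) -> (forall t, continuous h t) ->
  circle_mean (fun t => a * g t + b * h t) = a * circle_mean g + b * circle_mean h.
Proof.
move=> cg ch; rewrite /circle_mean.
rewrite (RInt_plus (fun t => a * g t) (fun t => b * h t)); last 2 first.
- by apply: ex_RInt_all => x; apply: (continuous_times (fun=> a)) => //; apply: continuous_const.
- by apply: ex_RInt_all => x; apply: (continuous_times (fun=> b)) => //; apply: continuous_const.
rewrite (RInt_scal g) ?(RInt_scal h); last 2 first.
- exact: ex_RInt_all.
- exact: ex_RInt_all.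
by rewrite /plus /scal /= /mult /=; have := twoPI_gt0 => ?; field; lra.
Qed.

Lemma circle_mean_const c : circle_mean (fun=> c) = c.
Proof.
rewrite /circle_mean RInt_const /scal /= /mult /=; have := twoPI_gt0 => ?; field; lra.
Qed.

Lemma circle_mean_le (g : R -> R) h :
  (forall t, continuous g t) -> (forall t, continuous h t) ->
  (forall t, g t <= h t) -> circle_mean g <= circle_mean h.
Proof.
move=> cg ch le; have := twoPI_gt0 => p0.
apply: Rmult_le_compat_r; first by left; apply: Rinv_0_lt_compat.
by apply: RInt_le => //; [lra | apply: ex_RInt_all | apply: ex_RInt_all].
Qed.

Lemma circle_mean_derivative (G g : R -> R) :
  (forall t, is_derive G t (g t)) -> (forall t, continuous g t) ->
  G (2 * PI) = G 0 -> circle_mean g = 0.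
Proof.
move=> dG cg e; rewrite /circle_mean.
rewrite (is_RInt_unique _ _ _ _ (is_RInt_derive G g 0 (2 * PI) (fun x _ => dG x) (fun x _ => cg x))).
by rewrite /minus /plus /opp /= e; lra.
Qed.

(** Momentum and position have the same mean square, their difference being the
    derivative of their product. *)
Lemma circle_mean_snd_sq z : circle_mean (fun t => snd (turn t z) * snd (turn t z)) = dot z z / 2.
Proof.
have c1 t := continuous_turn_fst z t; have c2 t := continuous_turn_snd z t.
have cp t : continuous (fun t => snd (turn t z) * snd (turn t z)) t by apply: continuous_times.
have cq t : continuous (fun t => fst (turn t z) * fst (turn t z)) t by apply: continuous_times.
have e1 : circle_mean (fun t => 1 * (snd (turn t z) * snd (turn t z))
                                + -1 * (fst (turn t z) * fst (turn t z))) = 0.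
  apply: (circle_mean_derivative (fun t => fst (turn t z) * snd (turn t z))).
  - move=> t; apply: is_derive_ext_loc; first exact: filter_forall (fun _ => erefl _).
    rewrite (_ : _ + _ = snd (turn t z) * snd (turn t z) + fst (turn t z) * (- fst (turn t z))); last ring.
    apply: (is_derive_mult (fun t => fst (turn t z))).
    + exact: is_derive_turn_fst.
    + exact: is_derive_turn_snd.
    + by move=> *; apply: Rmult_comm.
  - by move=> t; apply: (continuous_plus (fun t => 1 * _)); apply: continuous_times => //; apply: continuous_const.
  - by rewrite turn_2PI turn_0.
have e2 : circle_mean (fun t => 1 * (snd (turn t z) * snd (turn t z))
                                + 1 * (fst (turn t z) * fst (turn t z))) = dot z z.
  rewrite -(circle_mean_const (dot z z)); apply: circle_mean_ext => t.
  by rewrite -(dot_turn t z z) /dot; ring.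
by move: e1 e2; rewrite !circle_mean_lin //; lra.
Qed.

(** The averaged friction is [- damp f z] times [z], the averaged coupling [gain g z]
    times [z]; at the origin, where the quotients are 0, both products vanish as
    they should. *)
Definition damp (f : R -> R) (z : plane) : R :=
  circle_mean (fun t => f (fst (turn t z)) * snd (turn t z) * snd (turn t z)) / dot z z.

Definition gain (g : R -> R) (z : plane) : R :=
  circle_mean (fun t => g (snd (turn t z)) * snd (turn t z)) / dot z z.

(** Rotations are linear and commute with the quarter turn, which exchanges
    position and momentum up to sign. *)
Lemma turn_snd_decomp w z t : dot z z <> 0 ->
  snd (turn t w) = dot w z / dot z z * snd (turn t z)
    + (snd w * fst z - fst w * snd z) / dot z z * fst (turn t z) :> R.
Proof. by rewrite !(turn_fst, turn_snd) /dot => nz; field. Qed.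

Lemma dot_self_eq0 z : dot z z = 0 -> fst z = 0 /\ snd z = 0.
Proof. by rewrite /dot => h; split; nra. Qed.

(** The functional is split along [z] and its quarter turn; the mean against the
    latter vanishes when it is that of an exact derivative. *)
Lemma circle_mean_along (h : R -> R) w z : (forall t, continuous h t) -> dot z z <> 0 ->
  circle_mean (fun t => h t * fst (turn t z)) = 0 ->
  circle_mean (fun t => snd (turn t w) * h t)
  = circle_mean (fun t => h t * snd (turn t z)) / dot z z * dot w z.
Proof.
move=> ch nz z0.
have c1 t := continuous_turn_fst z t; have c2 t := continuous_turn_snd z t.
rewrite (circle_mean_ext _ (fun t => dot w z / dot z z * (h t * snd (turn t z))
  + (snd w * fst z - fst w * snd z) / dot z z * (h t * fst (turn t z)))).
  by rewrite circle_mean_lin ?z0; [field | move=> t; apply: continuous_times ..].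
by move=> t; rewrite {1}(turn_snd_decomp w z t nz); ring.
Qed.

(** The component orthogonal to [z] is the mean of an exact derivative, because
    along the rotation position is minus the derivative of momentum. *)
Lemma gain_mean (g : R -> R) w z : (forall x, continuous g x) -> g 0 = 0 ->
  circle_mean (fun t => snd (turn t w) * g (snd (turn t z))) = gain g z * dot w z.
Proof.
move=> cg g0; case: (Req_dec (dot z z) 0) => nz.
  have [z1 z2] := dot_self_eq0 z nz.
  rewrite (circle_mean_ext _ (fun=> 0)) ?circle_mean_const.
    by rewrite /dot z1 z2; ring.
  by move=> t; rewrite (turn_snd t z) z1 z2 !Rmult_0_r Rminus_diag g0 Rmult_0_r.
have c1 t := continuous_turn_fst z t; have c2 t := continuous_turn_snd z t.
have c3 t : continuous (fun t => g (snd (turn t z))) t by apply: continuous_comp_all.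
apply: (circle_mean_along (fun t => g (snd (turn t z)))) => //.
apply: (circle_mean_derivative (fun t => - RInt g 0 (snd (turn t z)))); last 2 first.
- by move=> t; apply: continuous_times.
- by rewrite turn_2PI turn_0.
move=> t; rewrite (_ : _ * _ = - ((- fst (turn t z)) * g (snd (turn t z)))); last ring.
apply: is_derive_opp; apply: (is_derive_comp (fun u => RInt g 0 u)).
  exact: primitive_derive.
exact: is_derive_turn_snd.
Qed.

(** Here the orthogonal component is the mean of [f q * q' * q], again an exact
    derivative. *)
Lemma damp_mean (f : R -> R) w z : (forall x, continuous f x) ->
  circle_mean (fun t => snd (turn t w) * (f (fst (turn t z)) * snd (turn t z))) = damp f z * dot w z.
Proof.
move=> cf; case: (Req_dec (dot z z) 0) => nz.
  have [z1 z2] := dot_self_eq0 z nz.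
  rewrite (circle_mean_ext _ (fun=> 0)) ?circle_mean_const.
    by rewrite /dot z1 z2; ring.
  by move=> t; rewrite (turn_snd t z) z1 z2; ring.
have c1 t := continuous_turn_fst z t; have c2 t := continuous_turn_snd z t.
have c3 t : continuous (fun t => f (fst (turn t z)) * snd (turn t z)) t.
  by apply: continuous_times => //; apply: continuous_comp_all.
apply: (circle_mean_along (fun t => f (fst (turn t z)) * snd (turn t z))) => //.
apply: (circle_mean_derivative (fun t => RInt (fun s => f s * s) 0 (fst (turn t z)))); last 2 first.
- by move=> t; apply: continuous_times.
- by rewrite turn_2PI turn_0.
move=> t; rewrite (_ : _ * _ * _ = snd (turn t z) * (f (fst (turn t z)) * fst (turn t z))); last ring.
apply: (is_derive_comp (fun u => RInt (fun s => f s * s) 0 u)).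
  apply: (primitive_derive (fun s => f s * s)) => s.
  by apply: continuous_times => //; apply: continuous_id.
exact: is_derive_turn_fst.
Qed.

Lemma snd_turn_sq_le t z : snd (turn t z) * snd (turn t z) <= dot z z.
Proof. by rewrite -(dot_turn t z z) /dot; nra. Qed.

Lemma turn_fst_bound t z : Rabs (fst (turn t z)) <= norm z.
Proof. by rewrite -(norm_turn t z); apply: fst_le_norm. Qed.

Lemma turn_snd_bound t z : Rabs (snd (turn t z)) <= norm z.
Proof. by rewrite -(norm_turn t z); apply: snd_le_norm. Qed.

Lemma div_dot_bounds N z a b : a <= 0 <= b -> a * dot z z <= N <= b * dot z z ->
  a <= N / dot z z <= b.
Proof.
move=> h0 h; case: (Rle_lt_or_eq_dec _ _ (dot_self_ge0 z)) => nz.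
  split; apply: (Rmult_le_reg_r (dot z z)) => //.
    by rewrite /Rdiv Rmult_assoc Rinv_l; lra.
  by rewrite /Rdiv Rmult_assoc Rinv_l; lra.
by rewrite -nz /Rdiv Rinv_0 Rmult_0_r.
Qed.

Lemma gain_bounds (g : R -> R) M L z : (forall x, continuous g x) -> g 0 = 0 ->
  (forall s, 0 <= s * g s) -> 0 <= L -> lipschitz_on g (- M) M L -> norm z <= M ->
  0 <= gain g z <= L.
Proof.
move=> cg g0 sg L0 lip zM; have c2 t := continuous_turn_snd z t.
have c3 t : continuous (fun t => g (snd (turn t z)) * snd (turn t z)) t.
  by apply: continuous_times => //; apply: continuous_comp_all.
apply: div_dot_bounds; first lra; split.
  rewrite Rmult_0_l -(circle_mean_const 0); apply: circle_mean_le => //.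
    by move=> t; apply: continuous_const.
  by move=> t; have := sg (snd (turn t z)); lra.
rewrite -(circle_mean_const (L * dot z z)); apply: circle_mean_le => //.
  by move=> t; apply: continuous_const.
move=> t; have hs := turn_snd_bound t z; have := snd_turn_sq_le t z.
set s := snd _ in hs *; have := lip s 0 ltac:(split_Rabs; lra) ltac:(split_Rabs; lra).
rewrite g0 !Rminus_0_r => h1 h2.
apply: (Rle_trans _ (L * (s * s))); last by apply: Rmult_le_compat_l.
apply: Rle_trans (Rle_abs _) _; rewrite Rabs_mult.
have := Rabs_pos s; have := pow2_abs s; nra.
Qed.

Lemma damp_bounds (f : R -> R) M K z : (forall x, continuous f x) -> 0 <= K ->
  (forall x, - M <= x <= M -> Rabs (f x) <= K) -> norm z <= M ->
  Rabs (damp f z) <= K.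
Proof.
move=> cf K0 fK zM; have c1 t := continuous_turn_fst z t; have c2 t := continuous_turn_snd z t.
have c3 t : continuous (fun t => f (fst (turn t z)) * snd (turn t z) * snd (turn t z)) t.
  by apply: continuous_times => //; apply: continuous_times => //; apply: continuous_comp_all.
apply/Rabs_le; apply: div_dot_bounds; first lra.
have bd t : Rabs (f (fst (turn t z)) * snd (turn t z) * snd (turn t z)) <= K * dot z z.
  have hq := turn_fst_bound t z; have hf : Rabs (f (fst (turn t z))) <= K.
    by apply: fK; move: hq; split_Rabs; lra.
  rewrite Rmult_assoc Rabs_mult (Rabs_pos_eq (_ * _)); last nra.
  by apply: Rmult_le_compat => //; [apply: Rabs_pos | nra | apply: snd_turn_sq_le].
split.
  rewrite -(circle_mean_const (- K * dot z z)); apply: circle_mean_le => //.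
    by move=> t; apply: continuous_const.
  by move=> t; have := bd t; split_Rabs; lra.
rewrite -(circle_mean_const (K * dot z z)); apply: circle_mean_le => //.
  by move=> t; apply: continuous_const.
by move=> t; have := bd t; split_Rabs; lra.
Qed.

(** The comparison [s g(s) >= alpha(r/4) (s^2/r - r/4)], valid for [|s| <= r],
    reduces the mean to that of [s^2]. *)
Lemma gain_lower (g : R -> R) alpha z : (forall x, continuous g x) ->
  (forall s, 0 <= s * g s) -> class_K alpha ->
  (forall s, alpha (Rabs s) <= Rabs (g s)) -> 0 < norm z ->
  alpha (norm z / 4) / (4 * norm z) <= gain g z.
Proof.
move=> cg sg [_ [a0 ainc]] ag nz; have c2 t := continuous_turn_snd z t.
have c3 t : continuous (fun t => g (snd (turn t z)) * snd (turn t z)) t.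
  by apply: continuous_times => //; apply: continuous_comp_all.
have c4 t : continuous (fun t => snd (turn t z) * snd (turn t z)) t by apply: continuous_times.
have sq := norm_sq z; set r := norm z in nz sq *.
have zz : 0 < dot z z by rewrite -sq; nra.
set A := alpha (r / 4); have A0 : 0 < A by rewrite -a0; apply: ainc; lra.
suff : A * r / 4 <= circle_mean (fun t => g (snd (turn t z)) * snd (turn t z)).
  move=> h; apply: (Rmult_le_reg_r (dot z z)) => //.
  rewrite /gain /Rdiv Rmult_assoc (Rmult_assoc (circle_mean _)) Rinv_l; last lra.
  rewrite -sq (_ : _ * _ = A * r / 4); first lra.
  by field; lra.
have e := circle_mean_snd_sq z.
apply: (Rle_trans _ (circle_mean (fun t => A / r * (snd (turn t z) * snd (turn t z)) + - (A * r / 4) * 1))).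
  rewrite circle_mean_lin //; last by move=> t; apply: continuous_const.
  rewrite e circle_mean_const -sq; right; field; lra.
apply: circle_mean_le => //.
  move=> t; apply: (continuous_plus (fun t => _ * _)); apply: continuous_times => //;
    exact: continuous_const.
move=> t; have hs := turn_snd_bound t z; set s := snd _ in hs *; rewrite -/r in hs.
have e1 : g s * s = Rabs (g s) * Rabs s.
  by rewrite -Rabs_mult Rabs_pos_eq //; have := sg s; lra.
have e2 : s * s = Rabs s * Rabs s by have := pow2_abs s; rewrite /=; lra.
rewrite e1 e2; have s0 := Rabs_pos s; have h := ag s.
set u := Rabs s in hs e1 e2 s0 h *.
have ir : 0 < / r by apply: Rinv_0_lt_compat.
have rir : r * / r = 1 by apply: Rinv_r; lra.
rewrite (_ : A / r * (u * u) = A * (u * (u * / r))); last by rewrite /Rdiv; ring.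
have w1 : u * (u * / r) <= u by nra.
case: (Rle_lt_dec (r / 4) u) => hu.
  have Au : A <= alpha u.
    by case: (Rle_lt_or_eq_dec _ _ hu) => [lt | <-]; [left; apply: ainc; lra | rewrite /A; lra].
  have : A * (u * (u * / r)) <= A * u by apply: Rmult_le_compat_l; lra.
  have : A * u <= Rabs (g s) * u by apply: Rmult_le_compat_r; lra.
  by have := Rmult_lt_0_compat _ _ A0 nz; lra.
have : A * (u * (u * / r)) <= A * (r / 4) by apply: Rmult_le_compat_l; lra.
have := Rmult_le_pos _ _ (Rabs_pos (g s)) s0; lra.
Qed.

(** * The sign of the averaged damping *)

Lemma RInt_periodic (g : R -> R) a : (forall x, continuous g x) ->
  (forall x, g (x + 2 * PI) = g x) -> RInt g a (a + 2 * PI) = RInt g 0 (2 * PI).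
Proof.
move=> cg per.
have ch b c d : RInt g b c + RInt g c d = RInt g b d.
  by apply: (RInt_Chasles g); apply: ex_RInt_all.
have sh : RInt g (2 * PI) (a + 2 * PI) = RInt g 0 a.
  have := RInt_comp_lin g 1 (2 * PI) 0 a (ex_RInt_all _ _ _ cg).
  rewrite Rmult_0_r Rplus_0_l Rmult_1_l => <-; apply: RInt_ext => x _.
  by rewrite /scal /= /mult /= !Rmult_1_l per.
by have := ch a 0 (a + 2 * PI); have := ch 0 (2 * PI) (a + 2 * PI); have := ch 0 a 0;
  rewrite sh RInt_point /zero /=; lra.
Qed.

(** Shifting the angle of integration by [phi] shows that the averaged friction
    depends on the radius only. *)
Lemma polar (z : plane) : exists phi,
  fst z = norm z * cos phi :> R /\ snd z = norm z * sin phi :> R.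
Proof.
case: (Req_dec (norm z) 0) => n0.
  exists 0; have := fst_le_norm z; have := snd_le_norm z; rewrite n0.
  by split_Rabs; lra.
have np : 0 < norm z by have := norm_pos z; lra.
have e := norm_sq z; have fb := fst_le_norm z; rewrite /dot in e.
have [x [y [ex ey]]] : exists x y : R, fst z = x :> R /\ snd z = y :> R by exists (fst z), (snd z).
rewrite ex ey in e fb *; set r := norm z in n0 np e fb *.
have b1 : -1 <= x / r <= 1.
  split; apply: (Rmult_le_reg_r r) => //; rewrite /Rdiv Rmult_assoc Rinv_l //.
    by split_Rabs; lra.
  by split_Rabs; lra.
have sq : r * sqrt (1 - (x / r)²) = Rabs y.
  rewrite -sqrt_Rsqr_abs (_ : y² = (r * r) * (1 - (x / r)²)).
    by rewrite sqrt_mult_alt ?sqrt_square //; nra.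
  by rewrite /Rsqr (_ : y * y = r * r - x * x); [field | lra].
case: (Rle_lt_dec 0 y) => y0.
  exists (acos (x / r)); rewrite cos_acos // sin_acos // sq Rabs_pos_eq //.
  by split=> //; field.
exists (- acos (x / r)); rewrite cos_neg sin_neg cos_acos // sin_acos //.
split; first by field.
by rewrite Ropp_mult_distr_r_reverse sq Rabs_left //; ring.
Qed.

(** One quarter of the circle suffices since [f] is even. *)
Definition quarter_damping (f : R -> R) (r : R) : R :=
  RInt (fun x => f (r * cos x) * (sin x * sin x)) 0 (PI / 2).

Lemma continuous_damping_integrand (f : R -> R) r x : (forall y, continuous f y) ->
  continuous (fun x => f (r * cos x) * (sin x * sin x)) x.
Proof.
move=> cf; apply: continuous_times.
  apply: (continuous_comp_all f) => //; apply: ex_derive_continuous; auto_derive => //.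
by apply: ex_derive_continuous; auto_derive.
Qed.

Lemma damp_quarter (f : R -> R) z : (forall y, continuous f y) -> cond_L1 f -> 0 < norm z ->
  damp f z = 2 / PI * quarter_damping f (norm z).
Proof.
move=> cf ev np; have [phi [e1 e2]] := polar z.
rewrite /damp /circle_mean -norm_sq; set r := norm z in np e1 e2 *.
pose H x := f (r * cos x) * (sin x * sin x).
have cH x : continuous H x by apply: continuous_damping_integrand.
have Hpi x : H (x + PI) = H x by rewrite /H neg_cos neg_sin Ropp_mult_distr_r_reverse ev; ring.
have per x : H (x + 2 * PI) = H x by rewrite (_ : x + 2 * PI = x + PI + PI) ?Hpi //; ring.
have pi0 := PI_RGT_0.
have -> : RInt (fun t => f (fst (turn t z)) * snd (turn t z) * snd (turn t z)) 0 (2 * PI)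
    = r * r * RInt H 0 (2 * PI).
  rewrite -(RInt_periodic H (- phi)) //.
  have := RInt_comp_lin H 1 (- phi) 0 (2 * PI) (ex_RInt_all _ _ _ cH).
  rewrite Rmult_0_r Rplus_0_l Rmult_1_l (Rplus_comm (2 * PI)) => <-.
  rewrite -(RInt_times (fun y => scal 1 (H (1 * y + - phi)))); last first.
    move=> x; apply: (continuous_times (fun=> 1)); first exact: continuous_const.
    by apply: continuous_comp_all => //; apply: ex_derive_continuous; auto_derive.
  apply: RInt_ext => x _; rewrite (turn_fst x z) (turn_snd x z) e1 e2 /scal /= /mult /= /H.
  rewrite !Rmult_1_l cos_plus sin_plus cos_neg sin_neg.
  rewrite (_ : r * (cos x * cos phi - sin x * - sin phi) =
               cos x * (r * cos phi) + sin x * (r * sin phi)); last ring.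
  by ring.
have ch b c d : RInt H b c + RInt H c d = RInt H b d.
  by apply: (RInt_Chasles H); apply: ex_RInt_all.
(* A half turn changes the sign of the argument of [f] only. *)
have half : RInt H PI (2 * PI) = RInt H 0 PI.
  have := RInt_comp_lin H 1 PI 0 PI (ex_RInt_all _ _ _ cH).
  rewrite Rmult_0_r Rplus_0_l Rmult_1_l (_ : PI + PI = 2 * PI); last ring.
  by move=> <-; apply: RInt_ext => x _; rewrite /scal /= /mult /= !Rmult_1_l Hpi.
have quart : RInt H PI (PI / 2) = - RInt H 0 (PI / 2).
  have := RInt_comp_lin H (-1) PI 0 (PI / 2) (ex_RInt_all _ _ _ cH).
  rewrite Rmult_0_r Rplus_0_l (_ : -1 * (PI / 2) + PI = PI / 2); last by field.
  move=> <-; rewrite -(Rmult_1_l (RInt H 0 _)) Ropp_mult_distr_l -RInt_times //.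
  apply: RInt_ext => x _; rewrite /scal /= /mult /= /H.
  rewrite (_ : -1 * x + PI = - x + PI); last ring.
  by rewrite neg_cos neg_sin cos_neg sin_neg Ropp_mult_distr_r_reverse ev; ring.
have := ch 0 PI (2 * PI); have := ch 0 (PI / 2) PI; have := ch PI (PI / 2) PI.
rewrite half quart RInt_point /zero /= => h1 h2 h3.
rewrite (_ : RInt H 0 (2 * PI) = 4 * RInt H 0 (PI / 2)); last lra.
by rewrite /quarter_damping -/H; field; lra.
Qed.

(** This is [pi/2] times [s] times [kappa f s]. In this form the dependence on [s]
    sits in a weight that increases with [s]. *)
Definition semicircle_moment (f : R -> R) (s : R) : R :=
  RInt (fun x => f x * sqrt (s ^ 2 - x ^ 2)) 0 s.

Lemma continuous_semicircle s x : continuous (fun x => sqrt (s ^ 2 - x ^ 2)) x.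
Proof.
apply: (continuous_comp (fun x => s ^ 2 - x ^ 2) sqrt); last exact: continuous_sqrt.
by apply: ex_derive_continuous; auto_derive.
Qed.

(** The substitution [x = s cos t] removes the singularity of the weight at the
    end point. *)
Lemma semicircle_moment_quarter (f : R -> R) s : (forall y, continuous f y) -> 0 <= s ->
  semicircle_moment f s = s * s * quarter_damping f s.
Proof.
move=> cf s0; have pi0 := PI_RGT_0.
have := RInt_comp (fun x => f x * sqrt (s ^ 2 - x ^ 2)) (fun x => s * cos x)
          (fun x => - (s * sin x)) 0 (PI / 2).
rewrite cos_0 cos_PI2 Rmult_1_r Rmult_0_r => H.
have cI x : continuous (fun x => f x * sqrt (s ^ 2 - x ^ 2)) x.
  by apply: continuous_times => //; apply: continuous_semicircle.
rewrite /semicircle_moment -(opp_RInt_swap (fun x => f x * sqrt (s ^ 2 - x ^ 2)) s);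
  last exact: ex_RInt_all.
rewrite -H /opp /=; last 2 first.
- by move=> x _; apply: cI.
- move=> x _; split; first by auto_derive => //; ring.
  by apply: ex_derive_continuous; auto_derive.
rewrite -(Rmult_1_l (RInt _ _ _)) Ropp_mult_distr_l.
rewrite -(RInt_times (fun y => scal (- (s * sin y)) (f (s * cos y) * sqrt (s ^ 2 - (s * cos y) ^ 2))));
  last first.
  move=> x; apply: (continuous_times (fun y => - (s * sin y))).
    by apply: ex_derive_continuous; auto_derive.
  apply: (continuous_comp_all (fun x => f x * sqrt (s ^ 2 - x ^ 2)) (fun y => s * cos y)) => //.
  by apply: ex_derive_continuous; auto_derive.
rewrite /quarter_damping -(RInt_times (fun x => f (s * cos x) * (sin x * sin x))); last first.
  by move=> x; apply: continuous_damping_integrand.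
apply: RInt_ext => x; rewrite Rmin_left ?Rmax_right; try lra.
  move=> hx; rewrite /scal /= /mult /=.
  have sx : 0 <= sin x by apply: sin_ge_0; lra.
  rewrite (_ : s * (s * 1) - _ = (s * sin x) * (s * sin x)).
      by rewrite sqrt_square; [ring | apply: Rmult_le_pos].
  have := sin2_cos2 x; rewrite /Rsqr => e.
  have : s * s * (sin x * sin x + cos x * cos x) = s * s by rewrite e; ring.
  lra.
Qed.

Lemma kappa_moment (f : R -> R) s : (forall y, continuous f y) -> 0 < s ->
  kappa f s = 2 / PI * (semicircle_moment f s / s).
Proof.
move=> cf s0; rewrite /kappa; congr (_ * _).
rewrite /semicircle_moment /Rdiv Rmult_comm -(RInt_times (fun x => f x * sqrt (s ^ 2 - x ^ 2))); last first.
  by move=> x; apply: continuous_times => //; apply: continuous_semicircle.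
apply: RInt_ext => x _ /=.
rewrite (_ : 1 - x * (x * 1) * / _ = (s * (s * 1) - x * (x * 1)) / (s * s)); last by field; lra.
rewrite sqrt_div_alt ?sqrt_square; [by field; lra | lra | nra].
Qed.

Lemma quarter_damping_continuous (f : R -> R) r : locally_lipschitz f ->
  continuity_pt (quarter_damping f) r.
Proof.
move=> lip; have cf x := locally_lipschitz_continuous f x lip.
have [L [L0 hL]] := locally_lipschitz_segment f (Rabs r + 1) lip.
have pi0 := PI_RGT_0.
have bd s : Rabs (s - r) < 1 -> Rabs (quarter_damping f s - quarter_damping f r)
    <= (PI / 2 - 0) * (L * Rabs (s - r)).
  move=> hs.
  have ci u x : continuous (fun x => f (u * cos x) * (sin x * sin x)) x.
    exact: continuous_damping_integrand.
  rewrite /quarter_damping -RInt_sub //.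
  apply: abs_RInt_le_const; first lra.
    apply: ex_RInt_all => x; apply: (continuous_minus (fun x => f (s * cos x) * (sin x * sin x))) => //.
  move=> x _.
  have cb : -1 <= cos x <= 1 by apply: COS_bound.
  have sb : 0 <= sin x * sin x <= 1.
    by have := SIN_bound x; nra.
  have cut u : Rabs u <= Rabs r + 1 -> - (Rabs r + 1) <= u * cos x <= Rabs r + 1.
    by move=> hu; have := Rabs_mult u (cos x); have : Rabs (cos x) <= 1 by [apply/Rabs_le; lra];
      have := Rabs_pos u; have := Rabs_pos (cos x);
      move=> h1 h2 h3 h4; apply/Rabs_le_between; nra.
  have h1 : Rabs s <= Rabs r + 1 by move: hs; split_Rabs; lra.
  have h2 : Rabs r <= Rabs r + 1 by lra.
  have := hL _ _ (cut _ h1) (cut _ h2).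
  rewrite -Rmult_minus_distr_r Rabs_mult => h3.
  rewrite (_ : _ - _ = (f (s * cos x) - f (r * cos x)) * (sin x * sin x)); last ring.
  rewrite Rabs_mult (Rabs_pos_eq (sin x * _)); last lra.
  have h4 : Rabs (cos x) <= 1 by apply/Rabs_le; lra.
  have h5 : Rabs (s - r) * Rabs (cos x) <= Rabs (s - r) * 1.
    by apply: Rmult_le_compat_l => //; apply: Rabs_pos.
  have h6 : Rabs (f (s * cos x) - f (r * cos x)) <= L * Rabs (s - r).
    by apply: Rle_trans h3 _; apply: Rmult_le_compat_l; lra.
  by have := Rabs_pos (f (s * cos x) - f (r * cos x)); nra.
move=> e e0; have K0 : 0 < PI / 2 * L + 1 by nra.
exists (Rmin 1 (e / (PI / 2 * L + 1))); split.
  by apply: Rmin_case; [lra | apply: Rdiv_lt_0_compat].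
move=> s [_]; rewrite /dist /= /R_dist => hs.
have y1 : Rabs (s - r) < 1 by apply: Rlt_le_trans hs (Rmin_l _ _).
have y2 : Rabs (s - r) < e / (PI / 2 * L + 1) by apply: Rlt_le_trans hs (Rmin_r _ _).
apply: Rle_lt_trans (bd s y1) _.
have := Rmult_lt_compat_l _ _ _ K0 y2.
rewrite (_ : (PI / 2 * L + 1) * (e / (PI / 2 * L + 1)) = e); last by field; lra.
have := Rabs_pos (s - r); nra.
Qed.

Section DampingSign.

Variables (f : R -> R) (s0 : R).
Hypotheses (f_lip : locally_lipschitz f) (s0_gt0 : 0 < s0).
Hypothesis F_s0 : Defs.primitive f s0 = 0.
Hypothesis F_neg : forall s, 0 < s -> s < s0 -> Defs.primitive f s < 0.
Hypothesis F_mono : forall s t, s0 < s -> s <= t -> Defs.primitive f s <= Defs.primitive f t.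

Let cf x : continuous f x := locally_lipschitz_continuous f x f_lip.

Lemma primitive_0 : Defs.primitive f 0 = 0.
Proof. exact: RInt_point. Qed.

Lemma is_derive_primitive x : is_derive (Defs.primitive f) x (f x).
Proof. exact: primitive_derive. Qed.

Lemma continuous_primitive x : continuous (Defs.primitive f) x.
Proof. by apply: ex_derive_continuous; exists (f x); apply: is_derive_primitive. Qed.

(** Integration by parts turns the damping into the mean of [F], which is
    negative up to [s0]. *)
Lemma quarter_damping_neg_small r : 0 < r <= s0 -> quarter_damping f r < 0.
Proof.
move=> hr; have pi0 := PI_RGT_0.
have cFc x : continuous (fun x => Defs.primitive f (r * cos x) * cos x) x.
  apply: continuous_times; last by apply: ex_derive_continuous; auto_derive.
  apply: (continuous_comp_all (Defs.primitive f)); first exact: continuous_primitive.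
  by apply: ex_derive_continuous; auto_derive.
have cD x : continuous (fun x => r * (f (r * cos x) * (sin x * sin x))) x.
  by apply: (continuous_times (fun=> r)); [apply: continuous_const | apply: continuous_damping_integrand].
have parts : r * quarter_damping f r = RInt (fun x => Defs.primitive f (r * cos x) * cos x) 0 (PI / 2).
  rewrite /quarter_damping -RInt_times; last by move=> x; apply: continuous_damping_integrand.
  apply: Rminus_diag_uniq; rewrite -RInt_sub //.
  rewrite (RInt_exact (fun x => - (Defs.primitive f (r * cos x) * sin x))) //; try lra; last 2 first.
  - move=> x _; rewrite (_ : _ - _ = - ((- (r * sin x) * f (r * cos x)) * sin x
                          + Defs.primitive f (r * cos x) * cos x)); last ring.
    apply: is_derive_opp.
    apply: (is_derive_mult (fun x => Defs.primitive f (r * cos x)) sin); last by move=> *; apply: Rmult_comm.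
      apply: (is_derive_comp (Defs.primitive f) (fun x => r * cos x)); first exact: is_derive_primitive.
      by auto_derive => //; ring.
    by auto_derive => //; ring.
  - by move=> x _; apply: (continuous_minus (fun x => r * (f (r * cos x) * (sin x * sin x)))).
  by rewrite cos_PI2 cos_0 sin_0 sin_PI2 Rmult_0_r primitive_0 /minus /plus /opp /=; ring.
have : 0 < RInt (fun x => -1 * (Defs.primitive f (r * cos x) * cos x)) 0 (PI / 2).
  apply: RInt_gt_0; first lra.
    move=> x hx; have c0 : 0 < cos x by apply: cos_gt_0; lra.
    have c1 : cos x < 1 by rewrite -cos_0; apply: cos_decreasing_1; lra.
    have := F_neg (r * cos x); nra.
  by move=> x _; apply: (continuous_times (fun=> -1)) => //; apply: continuous_const.
by rewrite RInt_times // -parts; nra.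
Qed.

Lemma damping_nonneg_beyond x : s0 < x -> 0 <= f x.
Proof.
move=> hx; case: (Rle_lt_dec 0 (f x)) => // neg; exfalso.
have /continuity_pt_filterlim cont := cf x.
have [d [d0 hd]] := cont (- f x) ltac:(lra).
have near y : x <= y < x + d -> f y < 0.
  move=> hy; case: (Req_dec x y) => [<- // | ne].
  have := hd y; rewrite /D_x /no_cond /dist /= /R_dist => H.
  by have {}H := H ltac:(split; [by split | split_Rabs; lra]); move: H; split_Rabs; lra.
have := F_mono x (x + d / 2) hx ltac:(lra).
have ch : Defs.primitive f x + RInt f x (x + d / 2) = Defs.primitive f (x + d / 2).
  by apply: (RInt_Chasles f); apply: ex_RInt_all.
have := RInt_lt f (fun=> 0) x (x + d / 2) ltac:(lra) (fun y _ => continuous_const 0 y) (fun y _ => cf y).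
rewrite RInt_const /scal /= /mult /= Rmult_0_r => H.
by have := H ltac:(move=> y hy; apply: near; lra); lra.
Qed.

(** The difference of the two weights is increasing in [x]; against it the
    negative part of [F] on [(0, s0)] and the sign of [f] beyond [s0] both count
    positively. *)
Lemma semicircle_moment_increasing s s' : s0 < s < s' ->
  semicircle_moment f s < semicircle_moment f s'.
Proof.
move=> hs; pose w u x := sqrt (u ^ 2 - x ^ 2).
have cw u x : continuous (fun x => f x * w u x) x.
  by apply: continuous_times => //; apply: continuous_semicircle.
have ch g b c d : (forall x, continuous g x) -> RInt g b c + RInt g c d = RInt g b d.
  by move=> cg; apply: (RInt_Chasles g); apply: ex_RInt_all.
(* The square root vanishes on negative arguments, so both moments live on [0, s']. *)
have ext : semicircle_moment f s = RInt (fun x => f x * w s x) 0 s'.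
  rewrite -(ch _ 0 s s') // (RInt_ext _ (fun=> 0) s s').
    by rewrite RInt_const /scal /= /mult /= Rmult_0_r Rplus_0_r.
  move=> x; rewrite Rmin_left ?Rmax_right; try lra.
  by move=> hx; rewrite /w sqrt_neg_0 ?Rmult_0_r //; nra.
apply: Rminus_gt_0_lt; rewrite ext /semicircle_moment -RInt_sub //; last by move=> x; apply: cw.
have cd x : continuous (fun x => f x * w s' x - f x * w s x) x.
  by apply: (continuous_minus (fun x => f x * w s' x)).
rewrite -(ch _ 0 s0 s') //; apply: Rplus_lt_le_0_compat; last first.
  apply: RInt_ge_0; [lra | exact: ex_RInt_all |] => x hx.
  rewrite -Rmult_minus_distr_l; apply: Rmult_le_pos; first by apply: damping_nonneg_beyond; lra.
  by have := sqrt_le_1_alt (s ^ 2 - x ^ 2) (s' ^ 2 - x ^ 2); rewrite /w; nra.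
have inside u x : s0 < u -> 0 <= x <= s0 -> 0 < u ^ 2 - x ^ 2 by move=> *; nra.
pose dw u x := - x / sqrt (u ^ 2 - x ^ 2).
have ddw u x : s0 < u -> 0 <= x <= s0 -> is_derive (w u) x (dw u x).
  move=> hu hx; have i := inside u x hu hx; rewrite /w /dw; auto_derive; first lra.
  have := sqrt_lt_R0 _ i; rewrite (_ : u ^ 2 + - x ^ 2 = u ^ 2 - x ^ 2); last by [].
  by rewrite /= => ?; field; lra.
have cdw u x : s0 < u -> 0 <= x <= s0 -> continuous (dw u) x.
  move=> hu hx; have i := inside u x hu hx; apply: ex_derive_continuous; rewrite /dw; auto_derive.
  split; first lra; split => //; apply: Rgt_not_eq; apply: sqrt_lt_R0; lra.
pose G' x := (f x * w s' x - f x * w s x) + Defs.primitive f x * (dw s' x - dw s x).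
have cG' x : 0 <= x <= s0 -> continuous G' x.
  move=> hx; apply: (continuous_plus (fun x => f x * w s' x - f x * w s x)) => //.
  apply: continuous_times; first exact: continuous_primitive.
  by apply: (continuous_minus (dw s')); apply: cdw => //; lra.
(* [G'] is the derivative of [F] times the weight difference, which vanishes at both ends. *)
have zero : RInt G' 0 s0 = 0.
  rewrite (RInt_exact (fun x => Defs.primitive f x * (w s' x - w s x))) //; last 2 first.
  - lra.
  - move=> x hx; rewrite /G' -Rmult_minus_distr_l.
    apply: (is_derive_mult (Defs.primitive f) (fun x => w s' x - w s x)).
    + exact: is_derive_primitive.
    + by apply: (is_derive_minus (w s')); apply: ddw => //; lra.
    + by move=> *; apply: Rmult_comm.
  by rewrite F_s0 primitive_0 !Rmult_0_l Rminus_diag.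
apply: (Rle_lt_trans _ (RInt G' 0 s0)); first by rewrite zero; apply: Rle_refl.
apply: RInt_lt => //.
move=> x hx; rewrite /G'.
have Fx := F_neg x ltac:(lra) ltac:(lra).
have ip := inside s x ltac:(lra) ltac:(lra).
have r1 := sqrt_lt_R0 _ ip.
have r2 : sqrt (s ^ 2 - x ^ 2) < sqrt (s' ^ 2 - x ^ 2) by apply: sqrt_lt_1_alt; nra.
suff d0 : 0 < dw s' x - dw s x.
  have : Defs.primitive f x * (dw s' x - dw s x) < 0 by nra.
  by rewrite /w; lra.
rewrite /dw /Rdiv.
have : / sqrt (s' ^ 2 - x ^ 2) < / sqrt (s ^ 2 - x ^ 2).
  by apply: Rinv_lt_contravar => //; apply: Rmult_lt_0_compat; lra.
by have x0 : 0 < x := proj1 hx; nra.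
Qed.

Variable rho : R.
Hypotheses (rho_gt0 : 0 < rho) (kappa_rho : kappa f rho = 0).

Lemma quarter_damping_rho : quarter_damping f rho = 0.
Proof.
have pi0 := PI_RGT_0; move: kappa_rho; rewrite kappa_moment // semicircle_moment_quarter //; last lra.
rewrite (_ : _ * _ * _ / rho = rho * quarter_damping f rho); last by field; lra.
have : 0 < / PI by apply: Rinv_0_lt_compat.
rewrite /Rdiv => i0 h; have : 0 < 2 * / PI * rho by apply: Rmult_lt_0_compat; lra.
nra.
Qed.

Lemma s0_lt_rho : s0 < rho.
Proof.
case: (Rlt_le_dec s0 rho) => // h.
by have := quarter_damping_neg_small rho (conj rho_gt0 h); rewrite quarter_damping_rho; lra.
Qed.

Lemma quarter_damping_neg r : 0 < r < rho -> quarter_damping f r < 0.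
Proof.
move=> hr; case: (Rle_lt_dec r s0) => h; first by apply: quarter_damping_neg_small; lra.
have := semicircle_moment_increasing r rho (conj h (proj2 hr)).
by rewrite !semicircle_moment_quarter ?quarter_damping_rho //; [nra | lra | lra].
Qed.

Lemma quarter_damping_pos r : rho < r -> 0 < quarter_damping f r.
Proof.
move=> hr; have := semicircle_moment_increasing rho r (conj s0_lt_rho hr).
by rewrite !semicircle_moment_quarter ?quarter_damping_rho //; [nra | lra | lra].
Qed.

Hypothesis f_even : cond_L1 f.

(** Uniformity comes from compactness in the radius. *)
Lemma damp_pos eta M : 0 < eta -> exists c, 0 < c /\
  forall z : plane, rho + eta <= norm z <= M -> c <= damp f z.
Proof.
move=> e0; case: (Rle_lt_dec (rho + eta) M) => hM; last first.
  by exists 1; split; [lra | move=> z hz; lra].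
have [r [hr1 hr2]] := continuity_ab_min (quarter_damping f) (rho + eta) M hM
  (fun x _ => quarter_damping_continuous f x f_lip).
have q0 := quarter_damping_pos r ltac:(lra).
have pi0 : 0 < 2 / PI by apply: Rdiv_lt_0_compat; [lra | apply: PI_RGT_0].
exists (2 / PI * quarter_damping f r); split; first exact: Rmult_lt_0_compat.
move=> z hz; rewrite damp_quarter //; last lra.
by apply: Rmult_le_compat_l; [lra | apply: hr1].
Qed.

Lemma damp_neg eta : 0 < eta -> exists c, 0 < c /\
  forall z : plane, eta <= norm z <= rho - eta -> damp f z <= - c.
Proof.
move=> e0; case: (Rle_lt_dec eta (rho - eta)) => hM; last first.
  by exists 1; split; [lra | move=> z hz; lra].
have [r [hr1 hr2]] := continuity_ab_maj (quarter_damping f) eta (rho - eta) hM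
  (fun x _ => quarter_damping_continuous f x f_lip).
have q0 := quarter_damping_neg r ltac:(lra).
have pi0 : 0 < 2 / PI by apply: Rdiv_lt_0_compat; [lra | apply: PI_RGT_0].
exists (2 / PI * - quarter_damping f r); split; first by apply: Rmult_lt_0_compat; lra.
move=> z hz; rewrite damp_quarter //; last lra.
rewrite Ropp_mult_distr_r Ropp_involutive.
by apply: Rmult_le_compat_l; [lra | apply: hr1].
Qed.

End DampingSign.

(** * Small parameters *)

(** A filter of small periods: constants are accumulated by [small_and] instead of
    explicit minima. *)
Definition small (P : R -> Prop) : Prop :=
  exists T0, 0 < T0 /\ forall T, 0 < T <= T0 -> P T.

Lemma small_and (P Q : R -> Prop) : small P -> small Q -> small (fun T => P T /\ Q T).
Proof.
move=> [a [a0 ha]] [b [b0 hb]]; exists (Rmin a b); split; first exact: Rmin_case.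
by move=> T hT; have := Rmin_l a b; have := Rmin_r a b; split; [apply: ha | apply: hb]; lra.
Qed.

Lemma small_imp (P Q : R -> Prop) :
  (forall T, 0 < T -> P T -> Q T) -> small P -> small Q.
Proof.
move=> imp [a [a0 ha]]; exists a; split=> // T hT.
by apply: imp; [lra | apply: ha].
Qed.

Lemma small_lin a c : 0 < c -> small (fun T => a * T <= c).
Proof.
move=> c0; have k0 : 0 < Rabs a + 1 by have := Rabs_pos a; lra.
exists (c / (Rabs a + 1)); split; first exact: Rdiv_lt_0_compat.
move=> T [T0 hT]; have := Rmult_le_compat_l _ _ _ (Rlt_le _ _ k0) hT.
rewrite (_ : (Rabs a + 1) * (c / (Rabs a + 1)) = c); last by field; lra.
by have := Rle_abs a; nra.
Qed.

(** * Frames and cones in the plane *)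

(** A vector with coordinates [a], [b] in the frame made of [u] and its quarter
    turn; used as a functional it expresses the side of a cone. *)
Definition comb (u : plane) (a b : R) : plane :=
  (a * fst u - b * snd u, a * snd u + b * fst u).

Definition perp (u : plane) : plane := (- snd u, fst u).

Lemma fst_comb u a b : fst (comb u a b) = a * fst u - b * snd u :> R.
Proof. by []. Qed.

Lemma snd_comb u a b : snd (comb u a b) = a * snd u + b * fst u :> R.
Proof. by []. Qed.

Lemma fst_perp u : fst (perp u) = - snd u :> R.
Proof. by []. Qed.

Lemma snd_perp u : snd (perp u) = fst u :> R.
Proof. by []. Qed.

Lemma dot_comb u a b z : dot (comb u a b) z = a * dot u z + b * dot (perp u) z.
Proof. by rewrite /dot fst_comb snd_comb fst_perp snd_perp; ring. Qed.

Lemma perp_comb u a b z : dot (perp (comb u a b)) z = - b * dot u z + a * dot (perp u) z.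
Proof. by rewrite /dot !fst_perp !snd_perp fst_comb snd_comb; ring. Qed.

Lemma dot_comb_self u a b : dot (comb u a b) (comb u a b) = (a * a + b * b) * dot u u.
Proof. by rewrite /dot fst_comb snd_comb; ring. Qed.

Lemma norm_comb u a b : norm u = 1 -> norm (comb u a b) <= Rabs a + Rabs b.
Proof.
move=> u1; have a0 := Rabs_pos a; have b0 := Rabs_pos b.
apply: norm_le_of_sq; first lra.
rewrite dot_comb_self -norm_sq u1; have := pow2_abs a; have := pow2_abs b; nra.
Qed.

Lemma norm_perp u : norm (perp u) = norm u.
Proof. by rewrite !norm_plane /dot fst_perp snd_perp; congr sqrt; ring. Qed.

Lemma dot_unit_le u z : norm u = 1 -> Rabs (dot u z) <= norm z.
Proof. by move=> u1; have := dot_norm u z; rewrite u1; lra. Qed.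

Lemma norm_le_frame u z : norm u = 1 -> norm z <= Rabs (dot u z) + Rabs (dot (perp u) z).
Proof.
move=> u1; have a0 := Rabs_pos (dot u z); have b0 := Rabs_pos (dot (perp u) z).
apply: norm_le_of_sq; first lra.
have e : dot z z = dot u z * dot u z + dot (perp u) z * dot (perp u) z.
  have := norm_sq u; rewrite u1 /dot fst_perp snd_perp => e.
  by rewrite -[LHS]Rmult_1_l -{1}(Rmult_1_l 1) e; ring.
by rewrite e; have := pow2_abs (dot u z); have := pow2_abs (dot (perp u) z); nra.
Qed.

(** Slopes relative to the axis [u] replace angles: the averaged system acts on
    them as a consensus algorithm, without any damping term. The level [c] keeps
    the slopes meaningful. *)
Definition in_cone (m : nat) (u : plane) (lo hi c : R) (z : state m) : Prop :=
  forall i, c <= dot u (z i) /\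
    lo * dot u (z i) <= dot (perp u) (z i) <= hi * dot u (z i).

Arguments in_cone {m} u lo hi c z.

Lemma in_cone_weaken (m : nat) u lo hi c lo' hi' c' (z : state m) :
  0 <= c -> lo' <= lo -> hi <= hi' -> c' <= c ->
  in_cone u lo hi c z -> in_cone u lo' hi' c' z.
Proof.
by move=> c0 hl hh hc h i; have [h1 h2] := h i; split; [lra | nra].
Qed.

(** The new axis is the lower side of the cone. No continuous choice of phase is
    needed, so the cone may wander around the origin for ever. *)
Lemma in_cone_recenter (m : nat) u lo hi c s (z : state m) :
  norm u = 1 -> 0 < c -> hi - lo <= s -> 0 <= s <= / 2 ->
  in_cone u lo hi c z ->
  exists u', norm u' = 1 /\ in_cone u' (- (2 * s)) (2 * s) (c * (1 - s)) z.
Proof.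
move=> u1 c0 hs s2 cone; set L := sqrt (1 + lo * lo).
have LL : L * L = 1 + lo * lo by apply: sqrt_sqrt; nra.
have L1 : 1 <= L by rewrite -sqrt_1; apply: sqrt_le_1_alt; nra.
have loL : Rabs lo <= L.
  by have := pow2_abs lo; have := Rabs_pos lo; nra.
exists (comb u (/ L) (lo / L)); split.
  have iL : L * / L = 1 by apply: Rinv_r; lra.
  rewrite norm_plane dot_comb_self -norm_sq u1.
  rewrite -[RHS]sqrt_1; congr sqrt.
  transitivity ((L * L) * (/ L * / L)); first by rewrite LL /Rdiv; ring.
  transitivity ((L * / L) * (L * / L)); first by ring.
  by rewrite iL; ring.
move=> i; have [h1 h2] := cone i; rewrite dot_comb perp_comb.
set h := dot u (z i) in h1 h2 *; set nu := dot (perp u) (z i) in h2 *.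
set x := nu - lo * h.
have x0 : 0 <= x <= s * h by rewrite /x; nra.
set il := / L; have ile : L * il = 1 by apply: Rinv_r; lra.
have il0 : 0 < il by apply: Rinv_0_lt_compat; lra.
have il1 : il <= 1 by nra.
have e1 : il * h + lo / L * nu = L * h + (lo * il) * x.
  have -> : L * h = il * (1 + lo * lo) * h.
    by rewrite -LL; transitivity ((L * il) * (L * h)); [rewrite ile | ]; ring.
  by rewrite /Rdiv -/il /x; ring.
have e2 : - (lo / L) * h + il * nu = il * x by rewrite /Rdiv -/il /x; ring.
rewrite e1 e2.
have lil : -1 <= lo * il.
  by have : - L <= lo by [move: loL; split_Rabs; lra]; nra.
split; first by nra.
have : h <= 2 * (L * h + lo * il * x) by nra.
by move=> ?; split; nra.
Qed.

(** * The averaged recursion *)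

Section Recursion.

Variables (m : nat) (damping : plane -> R) (coupling : 'I_m -> 'I_m -> plane -> R).
Variables (listens : 'I_m -> 'I_m -> Prop) (root : 'I_m) (rho M K A C : R).
Hypotheses (K_ge0 : 0 <= K) (A_ge0 : 0 <= A) (C_ge0 : 0 <= C).
Hypotheses (rho_gt0 : 0 < rho) (rho_M : rho < M).
Hypothesis damping_bound : forall z : plane, norm z <= M -> Rabs (damping z) <= K.
Hypothesis damping_pos : forall eta, 0 < eta -> exists c, 0 < c /\
  forall z : plane, rho + eta <= norm z <= M -> c <= damping z.
Hypothesis damping_neg : forall eta, 0 < eta -> exists c, 0 < c /\
  forall z : plane, eta <= norm z <= rho - eta -> damping z <= - c.
Hypothesis coupling_bound : forall i j (z : plane), j != i -> norm z <= 2 * M -> 0 <= coupling i j z <= A.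
Hypothesis listens_neq : forall i j, listens i j -> j != i.
Hypothesis coupling_pos : forall i j c, listens i j -> 0 < c -> exists b, 0 < b /\
  forall z : plane, c <= norm z <= 2 * M -> b <= coupling i j z.

Definition drift (z : state m) (w : plane) (i : 'I_m) : R :=
  - damping (z i) * dot w (z i)
  + \big[Rplus/0]_(j | j != i)
      (coupling i j (minus (z j) (z i)) * (dot w (z j) - dot w (z i))).

(** One period of length [T], tested against every linear functional; [C T^2] is
    the averaging error. *)
Definition avg_step (T : R) (z z' : state m) : Prop :=
  forall (w : plane) i,
    Rabs (dot w (z' i) - (dot w (z i) + T * drift z w i)) <= C * T ^ 2 * norm w.

Definition norms_le (V : R) (z : state m) : Prop := forall i, norm (z i) <= V.

Definition run (T : R) (N : nat) (z : nat -> state m) : Prop :=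
  (forall k, (k < N)%nat -> avg_step T (z k) (z k.+1)) /\
  (forall k, (k <= N)%nat -> norms_le M (z k)).

(** Bounds the relative speed at which one period can reduce a nonnegative
    functional; the added 1 keeps it positive. *)
Definition rate : R := K + INR m * A + 1.

Lemma rate_ge1 : 1 <= rate.
Proof. by have := Rmult_le_pos _ _ (pos_INR m) A_ge0; rewrite /rate; lra. Qed.

Lemma run_shift T N N' z : run T (N + N') z -> run T N' (fun k => z (N + k)%nat).
Proof.
move=> [h1 h2]; split=> k hk; last by apply: h2; lia.
by rewrite addnS; apply: h1; lia.
Qed.

Lemma run_take T N N' z : (N <= N')%nat -> run T N' z -> run T N z.
Proof. by move=> le [h1 h2]; split=> k hk; [apply: h1 | apply: h2]; lia. Qed.

Lemma norms_le_minus z i j : norms_le M z -> norm (minus (z j) (z i)) <= 2 * M.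
Proof. by move=> hz; have := norm_minus_le (z j) (z i); have := hz i; have := hz j; lra. Qed.

Definition inflow (z : state m) (i : 'I_m) : R :=
  \big[Rplus/0]_(j | j != i) coupling i j (minus (z j) (z i)).

Lemma inflow_bounds z i : norms_le M z -> 0 <= inflow z i <= INR m * A.
Proof.
move=> hz; split.
  by apply: sum_nonneg => j ji; case: (coupling_bound i j _ ji (norms_le_minus z i j hz)).
apply: Rle_trans (Rle_abs _) _; apply: sum_bound => // j ji.
by rewrite Rabs_pos_eq; case: (coupling_bound i j _ ji (norms_le_minus z i j hz)).
Qed.

Lemma drift_split z w i : drift z w i =
  - damping (z i) * dot w (z i) - inflow z i * dot w (z i)
  + \big[Rplus/0]_(j | j != i) (coupling i j (minus (z j) (z i)) * dot w (z j)).
Proof.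
rewrite /drift /inflow (Rmult_comm (\big[_/_]_(_ | _) _)) sum_distr.
rewrite (eq_bigr (fun j => coupling i j (minus (z j) (z i)) * dot w (z j)
   + -1 * (dot w (z i) * coupling i j (minus (z j) (z i))))); last by move=> j _; ring.
rewrite big_split /= -(sum_distr _ _ (-1)).
by set s1 := \big[_/_]_(j | _) (_ * dot w _); set s2 := \big[_/_]_(j | _) (dot w _ * _); ring.
Qed.

(** The neighbours contribute a convex combination of values at least [c], so that
    only the damping and the averaging error can lower the bound. *)
Lemma step_lower T z z' w i c : 0 < T -> norms_le M z -> avg_step T z z' ->
  (forall j, c <= dot w (z j)) ->
  dot w (z i) - T * inflow z i * (dot w (z i) - c)
    - T * damping (z i) * dot w (z i) - C * T ^ 2 * norm w <= dot w (z' i).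
Proof.
move=> T0 hz st low.
have : \big[Rplus/0]_(j | j != i) (c * coupling i j (minus (z j) (z i)))
     <= \big[Rplus/0]_(j | j != i) (coupling i j (minus (z j) (z i)) * dot w (z j)).
  apply: sum_le => j ji; have := coupling_bound i j _ ji (norms_le_minus z i j hz).
  by have := low j; nra.
have := st w i; rewrite drift_split -sum_distr -/(inflow z i).
set S := \big[_/_]_(_ | _) _ => /Rabs_le_between [h1 h1'] h2.
have := Rmult_le_compat_l _ _ _ (Rlt_le _ _ T0) h2; lra.
Qed.

(** The contribution of a single neighbour is kept: it is what propagates a margin
    along an edge. *)
Lemma step_lower_edge T z z' w i j : 0 < T -> T * rate <= 1 -> norms_le M z -> avg_step T z z' ->
  (forall k, 0 <= dot w (z k)) -> j != i ->
  (1 - T * rate) * dot w (z i) + T * coupling i j (minus (z j) (z i)) * dot w (z j)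
    - C * T ^ 2 * norm w <= dot w (z' i).
Proof.
move=> T0 TB hz st low ji.
have := @sum_ge_term _ (fun j => j != i)
  (fun j => coupling i j (minus (z j) (z i)) * dot w (z j)) j ji.
have pos k : k != i -> 0 <= coupling i k (minus (z k) (z i)) * dot w (z k).
  move=> ki; have [a0 _] := coupling_bound i k _ ki (norms_le_minus z i k hz).
  by have := Rmult_le_pos _ _ a0 (low k); lra.
move=> /(_ pos); have := st w i; rewrite drift_split.
set S := \big[_/_]_(_ | _) _ => /Rabs_le_between [h1 h1'] h2.
have [i0 i1] := inflow_bounds z i hz.
have hk := damping_bound _ (hz i); have l0 := low i.
have kb : damping (z i) + inflow z i <= rate by move: hk; rewrite /rate; split_Rabs; lra.
have h4 : T * ((damping (z i) + inflow z i) * dot w (z i)) <= T * (rate * dot w (z i)).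
  by apply: Rmult_le_compat_l; [lra | apply: Rmult_le_compat_r].
nra.
Qed.

Lemma step_nonneg T z z' w i : 0 < T -> T * rate <= 1 -> norms_le M z -> avg_step T z z' ->
  (forall k, 0 <= dot w (z k)) ->
  (1 - T * rate) * dot w (z i) - C * T ^ 2 * norm w <= dot w (z' i).
Proof.
move=> T0 TB hz st low; have := step_lower T z z' w i 0 T0 hz st low.
have [i0 i1] := inflow_bounds z i hz.
have hk := damping_bound _ (hz i); have l0 := low i.
have kb : damping (z i) + inflow z i <= rate by move: hk; rewrite /rate; split_Rabs; lra.
have h4 : T * ((damping (z i) + inflow z i) * dot w (z i)) <= T * (rate * dot w (z i)).
  by apply: Rmult_le_compat_l; [lra | apply: Rmult_le_compat_r].
nra.
Qed.

(** * Decay of the largest norm *)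

Lemma step_upper T z z' w i c : 0 < T -> norms_le M z -> avg_step T z z' ->
  (forall j, dot w (z j) <= c) ->
  dot w (z' i) <= dot w (z i) + T * inflow z i * (c - dot w (z i))
    - T * damping (z i) * dot w (z i) + C * T ^ 2 * norm w.
Proof.
move=> T0 hz st up.
have on (y : plane) : dot (opp w) y = - dot w y.
  by rewrite /dot (_ : fst (opp w) = - fst w :> R) // (_ : snd (opp w) = - snd w :> R) //; ring.
have := step_lower T z z' (opp w) i (- c) T0 hz st.
rewrite norm_opp !on => H.
have {}H := H ltac:(move=> j; rewrite on; have := up j; lra).
lra.
Qed.

(** A node of nearly maximal norm is not pushed outwards by the others and is
    damped; a node of norm below [rho + eta / 2] cannot cross [rho + eta] within
    one short period. *)
Lemma norm_step eta : 0 < eta -> exists c, 0 < c /\ small (fun T =>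
  forall V z z', V <= M -> norms_le V z -> avg_step T z z' ->
  norms_le (Rmax (V - T * c) (rho + eta)) z').
Proof.
move=> e0; have [c0 [c00 hc]] := damping_pos (eta / 2) ltac:(lra).
have cr : 0 < c0 * rho by apply: Rmult_lt_0_compat.
exists (c0 * rho / 2); split; first lra.
have H := small_and _ _ (small_lin C (c0 * rho / 2) ltac:(lra))
  (small_and _ _ (small_lin rate 1 Rlt_0_1) (small_and _ _ (small_lin 1 1 Rlt_0_1)
  (small_lin (INR m * A * M + K * M + C) (eta / 2) ltac:(lra)))).
move: H; apply: small_imp => T T0 [t1 [t2 [t3 t4]]] V z z' VM hV st i.
have hz : norms_le M z by move=> j; apply: Rle_trans (hV j) VM.
have [w [w1 <-]] := norm_dual (z' i).
have up j : dot w (z j) <= V.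
  by apply: Rle_trans (Rle_abs _) _; apply: Rle_trans (dot_unit_le _ _ w1) (hV j).
have := step_upper T z z' w i V T0 hz st up; rewrite w1.
have [i0 i1] := inflow_bounds z i hz; set q := inflow z i in i0 i1 *.
have hk := damping_bound _ (hz i); have hr := hV i; have r0 := norm_pos (z i).
have lr : dot w (z i) <= norm (z i).
  by apply: Rle_trans (Rle_abs _) _; apply: dot_unit_le.
set k := damping (z i) in hk *; set r := norm (z i) in hr r0 lr *; set l := dot w (z i) in lr *.
have co : 0 <= 1 - T * q - T * k.
  have : q + k <= rate by move: hk; rewrite /rate; split_Rabs; lra.
  by nra.
have h1 : (1 - T * q - T * k) * l <= (1 - T * q - T * k) * r by apply: Rmult_le_compat_l.
move=> h2; have {h1}h2 : dot w (z' i) <= (1 - T * q - T * k) * r + T * q * V + C * T ^ 2 * 1 by lra.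
case: (Rle_lt_dec (rho + eta / 2) r) => hr2.
  apply: Rle_trans (Rmax_l _ _).
  have kc : c0 <= k by apply: hc; rewrite -/r; lra.
  have Tq1 : T * q <= 1.
    have : T * q <= T * rate by apply: Rmult_le_compat_l; [lra | rewrite /rate; lra].
    lra.
  have h3 : T * (c0 * rho) <= T * (k * r) by apply: Rmult_le_compat_l; [lra | nra].
  have h4 : T * q * (V - r) <= 1 * (V - r) by apply: Rmult_le_compat_r; lra.
  have h5 : T * (C * T) <= T * (c0 * rho / 2) by apply: Rmult_le_compat_l; lra.
  have : C * T ^ 2 = T * (C * T) by ring.
  lra.
apply: Rle_trans (Rmax_r _ _).
have h3 : T * (q * (V - r)) <= T * (INR m * A * M).
  by apply: Rmult_le_compat_l; [lra | nra].
have h4 : T * (- k * r) <= T * (K * M).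
  apply: Rmult_le_compat_l; first lra.
  have kK : - k <= K by move: hk; split_Rabs; lra.
  apply: (Rle_trans _ (K * r)); first exact: Rmult_le_compat_r.
  by apply: Rmult_le_compat_l; lra.
have h5 : T * (T * C) <= T * (1 * C).
  by apply: Rmult_le_compat_l; [lra | apply: Rmult_le_compat_r; lra].
lra.
Qed.

(** A recursion that is only known to hold inside the ball of radius [M] never
    leaves it. *)
Lemma norm_invariant eta : 0 < eta -> exists c, 0 < c /\ small (fun T =>
  forall N z, rho + eta <= M -> norms_le M (z 0%nat) ->
  (forall k, (k < N)%nat -> norms_le M (z k) -> avg_step T (z k) (z k.+1)) ->
  forall V, V <= M -> norms_le V (z 0%nat) ->
  run T N z /\ forall k, (k <= N)%nat -> norms_le (Rmax (V - INR k * T * c) (rho + eta)) (z k)).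
Proof.
move=> e0; have [c [c0 hc]] := norm_step eta e0; exists c; split=> //.
move: hc; apply: small_imp => T T0 hc N z eM z0 st V VM hV.
have key k : (k <= N)%nat -> norms_le M (z k) /\
    norms_le (Rmax (V - INR k * T * c) (rho + eta)) (z k).
  elim: k => [|k IH] kN.
    split=> // i; apply: Rle_trans (hV i) _; apply: Rle_trans (Rmax_l _ _).
    by rewrite /=; lra.
  have [h1 h2] := IH ltac:(lia).
  have Vk : Rmax (V - INR k * T * c) (rho + eta) <= M.
    apply: Rmax_lub => //.
    by have := Rmult_le_pos _ _ (Rmult_le_pos _ _ (pos_INR k) (Rlt_le _ _ T0)) (Rlt_le _ _ c0); lra.
  have h3 := hc _ _ _ Vk h2 (st k kN h1).
  have Tc : 0 < T * c by apply: Rmult_lt_0_compat.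
  have h4 : norms_le (Rmax (V - INR k.+1 * T * c) (rho + eta)) (z k.+1).
    move=> i; apply: Rle_trans (h3 i) _; rewrite S_INR.
    have ml := Rmax_l (V - (INR k + 1) * T * c) (rho + eta).
    have mr := Rmax_r (V - (INR k + 1) * T * c) (rho + eta).
    by case: (Rmax_spec (V - INR k * T * c) (rho + eta)) => -[? ->]; apply: Rmax_lub; lra.
  by split=> // i; apply: Rle_trans (h3 i) _; apply: Rmax_lub; lra.
by split; [split=> k hk; [apply: st => //|] ; have [] := key k ltac:(lia) | move=> k hk; have [] := key k hk].
Qed.

(** * Motion of cones *)

Lemma cone_norm u lo hi c S (z : state m) i : norm u = 1 -> 0 <= c ->
  - S <= lo -> hi <= S -> in_cone u lo hi c z ->
  dot u (z i) <= norm (z i) <= (1 + S) * dot u (z i).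
Proof.
move=> u1 c0 hlo hhi cone; have [h1 h2] := cone i; split.
  by apply: Rle_trans (Rle_abs _) _; apply: dot_unit_le.
apply: Rle_trans (norm_le_frame u (z i) u1) _.
set h := dot u _ in h1 h2 *; set nu := dot _ _ in h2 *.
rewrite (Rabs_pos_eq h); last lra.
have : Rabs nu <= S * h by apply/Rabs_le; nra.
lra.
Qed.

(** Inside a cone a small projection on the axis forces a norm below [rho],
    where the damping is negative. *)
Lemma cone_level_step S eta cm cb :
  0 <= S -> 0 < eta -> 0 < cm -> (1 + S) * cb <= rho - eta ->
  exists c1, 0 < c1 /\ small (fun T =>
    forall u lo hi c z z', norm u = 1 -> - S <= lo -> hi <= S -> cm <= c ->
    in_cone u lo hi c z -> norms_le M z -> avg_step T z z' ->
    forall i, Rmin (c + T * c1) (cb - eta) <= dot u (z' i)).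
Proof.
move=> S0 e0 cm0 hcb.
have [k0 [k00 hk0]] := damping_neg (Rmin eta cm) (Rmin_case _ _ (fun x => 0 < x) e0 cm0).
have kc0 : 0 < k0 * cm by apply: Rmult_lt_0_compat.
exists (k0 * cm / 2); split; first lra.
have H := small_and _ _ (small_lin C (k0 * cm / 2) ltac:(lra))
  (small_and _ _ (small_lin rate 1 Rlt_0_1) (small_and _ _ (small_lin 1 1 Rlt_0_1)
  (small_lin (INR m * A * M + K * M + C) eta e0))).
move: H; apply: small_imp => T T0 [t1 [t2 [t3 t4]]] u lo hi c z z' u1 hlo hhi hc cone hz st i.
have := step_lower T z z' u i c T0 hz st (fun j => proj1 (cone j)); rewrite u1.
have [n1 n2] := cone_norm u lo hi c S z i u1 ltac:(lra) hlo hhi cone.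
have [h1 _] := cone i; have [i0 i1] := inflow_bounds z i hz.
have hM := hz i; have hk := damping_bound _ hM.
set q := inflow z i in i0 i1 *.
have CT : T * (T * C) <= T * (k0 * cm / 2) by apply: Rmult_le_compat_l; lra.
case: (Rle_lt_dec (dot u (z i)) cb) => hb.
  move=> H; apply: Rle_trans (Rmin_l _ _) _.
  have kn : damping (z i) <= - k0.
    apply: hk0; have := Rmin_l eta cm; have := Rmin_r eta cm.
    have : (1 + S) * dot u (z i) <= (1 + S) * cb by apply: Rmult_le_compat_l; lra.
    by lra.
  set h := dot u (z i) in h1 n1 hb H *.
  have h3 : T * (k0 * cm) <= T * (- damping (z i) * h) by apply: Rmult_le_compat_l; [lra | nra].
  have Tq1 : T * q <= 1.
    have : T * q <= T * rate by apply: Rmult_le_compat_l; [lra | rewrite /rate; lra].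
    lra.
  have h4 : T * q * (h - c) <= 1 * (h - c) by apply: Rmult_le_compat_r; lra.
  lra.
move=> H; apply: Rle_trans (Rmin_r _ _) _.
set h := dot u (z i) in h1 n1 hb H *.
have h3 : T * (q * (h - c)) <= T * (INR m * A * M).
  by apply: Rmult_le_compat_l; [lra | apply: Rmult_le_compat; lra].
have h4 : T * (damping (z i) * h) <= T * (K * M).
  apply: Rmult_le_compat_l; first lra.
  have kK : damping (z i) <= K by move: hk; split_Rabs; lra.
  apply: (Rle_trans _ (K * h)); first by apply: Rmult_le_compat_r; lra.
  by apply: Rmult_le_compat_l; lra.
have h5 : T * (T * C) <= T * (1 * C).
  by apply: Rmult_le_compat_l; [lra | apply: Rmult_le_compat_r; lra].
lra.
Qed.

(** Each side of a cone bounds a half-plane through the origin, which the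
    recursion respects up to the averaging error; dividing this error by the
    level turns it into a change of slope. *)
Lemma cone_slope_step T u lo hi c c' S z z' :
  0 < T -> T * rate <= 1 -> norm u = 1 -> 0 <= c -> 0 < c' -> 0 <= S ->
  Rabs lo <= S -> Rabs hi <= S -> in_cone u lo hi c z -> norms_le M z -> avg_step T z z' ->
  (forall i, c' <= dot u (z' i)) ->
  in_cone u (lo - C * (S + 1) / c' * T ^ 2) (hi + C * (S + 1) / c' * T ^ 2) c' z'.
Proof.
move=> T0 TB u1 c0 c'0 S0 hlo hhi cone hz st low i; split; first exact: low.
have err a b : Rabs a + Rabs b <= S + 1 -> (forall k, 0 <= dot (comb u a b) (z k)) ->
    - (C * (S + 1) / c' * T ^ 2 * dot u (z' i)) <= dot (comb u a b) (z' i).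
  move=> hab low0; have := step_nonneg T z z' _ i T0 TB hz st low0.
  have hn := norm_comb u a b u1.
  have h1 : 0 <= (1 - T * rate) * dot (comb u a b) (z i) by apply: Rmult_le_pos; [lra | apply: low0].
  have T2 : 0 <= T ^ 2 by apply: pow2_ge_0.
  have h2 : C * T ^ 2 * norm (comb u a b) <= C * T ^ 2 * (S + 1).
    by apply: Rmult_le_compat_l; [apply: Rmult_le_pos | lra].
  have h3 : C * (S + 1) / c' * T ^ 2 * c' <= C * (S + 1) / c' * T ^ 2 * dot u (z' i).
    apply: Rmult_le_compat_l => //; apply: Rmult_le_pos => //.
    by apply: Rdiv_le_0_compat => //; apply: Rmult_le_pos; lra.
  have h4 : C * (S + 1) / c' * T ^ 2 * c' = C * T ^ 2 * (S + 1) by field; lra.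
  lra.
split.
  have := err (- lo) 1; rewrite Rabs_Ropp Rabs_R1 dot_comb => /(_ ltac:(lra)) H.
  by have := H (fun k => ltac:(rewrite dot_comb; have := cone k; lra)); lra.
have := err hi (-1); rewrite Rabs_Ropp Rabs_R1 dot_comb => /(_ ltac:(lra)) H.
by have := H (fun k => ltac:(rewrite dot_comb; have := cone k; lra)); lra.
Qed.

(** Slopes drift by [O(T)] over a bounded time, so they stay within [s] of the
    initial cone, and meanwhile the level climbs to [cb - eta]. The two facts
    need each other and are proved by one induction. *)
Lemma cone_run S s eta cb c0 :
  0 <= S -> 0 < s -> 0 < eta -> 0 < c0 -> 0 < cb - eta -> (1 + (S + s)) * cb <= rho - eta ->
  exists c1, 0 < c1 /\ forall tau, 0 < tau -> small (fun T =>
    forall N u z, INR N * T <= tau -> norm u = 1 -> run T N z ->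
    in_cone u (- S) S c0 (z 0%nat) ->
    forall k, (k <= N)%nat ->
      in_cone u (- (S + s)) (S + s) (Rmin (c0 + INR k * T * c1) (cb - eta)) (z k)).
Proof.
move=> S0 s0 e0 c00 cb0 hcb; set cm := Rmin c0 (cb - eta).
have cm0 : 0 < cm by apply: Rmin_case.
have [c1 [c10 step]] := cone_level_step (S + s) eta cm cb ltac:(lra) e0 cm0 hcb.
exists c1; split=> // tau tau0; set D := C * (S + s + 1) / cm.
have D0 : 0 <= D by apply: Rdiv_le_0_compat => //; apply: Rmult_le_pos; lra.
have H := small_and _ _ step (small_and _ _ (small_lin rate 1 Rlt_0_1) (small_lin (D * tau) s s0)).
move: H {step}; apply: small_imp => T T0 [step [t1 t2]] N u z NT u1 [st hz] cone0.
pose lev k := Rmin (c0 + INR k * T * c1) (cb - eta).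
have lev_cm k : cm <= lev k.
  apply: Rmin_glb; last exact: Rmin_r.
  apply: Rle_trans (Rmin_l _ _) _.
  by have := Rmult_le_pos _ _ (Rmult_le_pos _ _ (pos_INR k) (Rlt_le _ _ T0)) (Rlt_le _ _ c10); lra.
have width k : (k <= N)%nat -> INR k * (D * T ^ 2) <= s.
  move=> kN; have : INR k * T <= tau.
    by apply: Rle_trans NT; apply: Rmult_le_compat_r; [lra | apply: le_INR; lia].
  move=> kT; have : D * T * (INR k * T) <= D * T * tau.
    by apply: Rmult_le_compat_l => //; apply: Rmult_le_pos; lra.
  by move=> /= *; lra.
suff key k : (k <= N)%nat ->
    in_cone u (- (S + INR k * (D * T ^ 2))) (S + INR k * (D * T ^ 2)) (lev k) (z k).
  move=> k kN; have wk := width k kN; have lk := lev_cm k.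
  by apply: in_cone_weaken (key k kN); rewrite /lev; try lra; rewrite -/(lev k); lra.
elim: k => [|k IH] kN.
  move=> i; have [h1 h2] := cone0 i; rewrite /lev /=.
  by split; [apply: Rle_trans (Rmin_l _ _) _; lra | lra].
have cone := IH ltac:(lia); have wk := width k ltac:(lia).
have kp : 0 <= INR k * (D * T ^ 2).
  by apply: Rmult_le_pos; [apply: pos_INR | apply: Rmult_le_pos => //; apply: pow2_ge_0].
have hzk : norms_le M (z k) by apply: hz; lia.
have low i : Rmin (lev k + T * c1) (cb - eta) <= dot u (z k.+1 i).
  by apply: (step u _ _ (lev k) (z k)) cone hzk (st k kN) i => //; lra.
have low' i : lev k.+1 <= dot u (z k.+1 i).
  apply: Rle_trans (low i); apply: Rmin_glb; last exact: Rmin_r.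
  have Tc : 0 < T * c1 by apply: Rmult_lt_0_compat.
  rewrite /lev S_INR.
  have := Rmin_l (c0 + (INR k + 1) * T * c1) (cb - eta).
  have := Rmin_r (c0 + (INR k + 1) * T * c1) (cb - eta).
  by case: (Rmin_spec (c0 + INR k * T * c1) (cb - eta)) => -[? ->]; lra.
have := cone_slope_step T u _ _ (lev k) cm (S + s) (z k) (z k.+1) T0 ltac:(lra) u1 _ cm0 _ _ _ cone hzk (st k kN).
have lk := lev_cm k; have lk1 := lev_cm k.+1.
move=> /(_ ltac:(lra) ltac:(lra) ltac:(split_Rabs; lra) ltac:(split_Rabs; lra)) H.
have {}H := H ltac:(move=> i; have := low' i; lra).
move=> i; have [_ h2] := H i; split; first exact: low'.
have h1 := low' i; rewrite S_INR; rewrite -/D in h2; lra.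
Qed.

(** * Contraction of a cone *)

(** The levels are cumulative: a node that has acquired a margin keeps part of it
    during the later stages. *)
Fixpoint reach (d : nat) (i : 'I_m) : Prop :=
  if d is d'.+1 then reach d' i \/ (exists2 j, listens i j & reach d' j) else i = root.

Lemma persist (y : nat -> R) b e n : 0 <= b <= 1 -> 0 <= e -> 0 <= y 0%nat ->
  (forall k, (k < n)%nat -> (1 - b) * y k - e <= y k.+1) ->
  forall k, (k <= n)%nat -> y 0%nat * (1 - INR k * b) - INR k * e <= y k.
Proof.
move=> hb he y0 step; elim=> [|k IH] kn; first by rewrite /=; lra.
have h1 := IH ltac:(lia); have h2 := step k kn; rewrite S_INR.
have k0 := pos_INR k.
have h3 : (1 - b) * (y 0%nat * (1 - INR k * b) - INR k * e) <= (1 - b) * y k.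
  by apply: Rmult_le_compat_l; lra.
have h4 : 0 <= y 0%nat * (INR k * (b * b)).
  by apply: Rmult_le_pos => //; apply: Rmult_le_pos => //; nra.
have h5 : 0 <= INR k * e * b by apply: Rmult_le_pos; [apply: Rmult_le_pos | lra].
lra.
Qed.

(** A quantity that increases steadily while small, and cannot fall below [c / 2]
    in one step when large, ends up above a threshold. *)
Lemma growth (y : nat -> R) c d n : 0 <= d -> 0 <= y 0%nat ->
  (forall k, (k < n)%nat -> y k <= c -> y k + d <= y k.+1) ->
  (forall k, (k < n)%nat -> c < y k -> c / 2 <= y k.+1) ->
  forall k, (k <= n)%nat -> Rmin (c / 2) (INR k * d) <= y k.
Proof.
move=> d0 y0 up stay; elim=> [|k IH] kn.
  by apply: Rle_trans (Rmin_r _ _) _; rewrite /=; lra.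
have h1 := IH ltac:(lia); rewrite S_INR.
case: (Rle_lt_dec (y k) c) => hc.
  have := up k kn hc; have := Rmin_l (c / 2) ((INR k + 1) * d).
  have := Rmin_r (c / 2) ((INR k + 1) * d).
  by case: (Rmin_spec (c / 2) (INR k * d)) h1 => -[? ->]; lra.
by apply: Rle_trans (Rmin_l _ _) _; apply: stay.
Qed.

(** Stages are short enough for a margin to lose at most half of itself. *)
Definition taus : R := / (8 * rate).

Lemma taus_gt0 : 0 < taus.
Proof. by apply: Rinv_0_lt_compat; have := rate_ge1; lra. Qed.

Lemma taus_rate : taus * rate = / 8.
Proof. by rewrite /taus; field; have := rate_ge1; lra. Qed.

Definition stage (T : R) (n : nat) : Prop := taus <= INR n * T <= 2 * taus.

Lemma stage_ex T : 0 < T <= taus -> exists n, stage T n.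
Proof.
move=> hT; have [n [h1 h2]] := nfloor_ex (taus / T) ltac:(apply: Rdiv_le_0_compat; lra).
exists n.+1; rewrite /stage S_INR.
have e : taus / T * T = taus by field; lra.
have h3 := Rmult_le_compat_r T _ _ ltac:(lra) h1.
have h4 := Rmult_lt_compat_r T _ _ (proj1 hT) h2.
by move: h3 h4; rewrite /= e; lra.
Qed.

Lemma listens_margin c : 0 < c -> exists b, 0 < b /\ forall i j, listens i j ->
  forall z : plane, c <= norm z <= 2 * M -> b <= coupling i j z.
Proof.
move=> c0.
have [||b [b0 hb]] := @fin_small ('I_m * 'I_m)%type (fun ij b => listens ij.1 ij.2 ->
    forall z : plane, c <= norm z <= 2 * M -> b <= coupling ij.1 ij.2 z).
- by move=> ij e e' he h l z hz; have := h l z hz; lra.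
- move=> [i j] /=; case: (Classical_Prop.classic (listens i j)) => l.
    by have [b [b0 hb]] := coupling_pos i j c l c0; exists b.
  by exists 1; split; [lra |].
by exists b; split=> // i j l z hz; apply: (hb (i, j)).
Qed.

(** During one stage a positive margin survives, and passes to the nodes that
    listen: as long as the listener lags, the coupling pulls it. *)
Lemma stage_margin W c : 0 < W -> 0 < c -> exists c', 0 < c' /\ small (fun T =>
  forall n z w, stage T n -> run T n z -> norm w <= W ->
  (forall k j, (k <= n)%nat -> 0 <= dot w (z k j)) ->
  (forall i, c <= dot w (z 0%nat i) -> c' <= dot w (z n i)) /\
  (forall i j, listens i j -> c <= dot w (z 0%nat j) -> c' <= dot w (z n i))).
Proof.
move=> W0 c0; have B1 := rate_ge1; have ts0 := taus_gt0; have tsB := taus_rate.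
have [b [b0 hb]] := listens_margin (c / (4 * W)) ltac:(apply: Rdiv_lt_0_compat; lra).
have bc0 : 0 < b * c by apply: Rmult_lt_0_compat.
(* Below [c2] a listener is at least [c / 4] behind, and the pull dominates the losses. *)
pose c2 := Rmin (c / 4) (b * c / (8 * rate)).
have c20 : 0 < c2 by apply: Rmin_case; [lra | apply: Rdiv_lt_0_compat; lra].
have c2c : c2 <= c / 4 by apply: Rmin_l.
have Bc2 : rate * c2 <= b * c / 8.
  have := Rmult_le_compat_l rate _ _ ltac:(lra) (Rmin_r (c / 4) (b * c / (8 * rate))).
  by rewrite -/c2 (_ : rate * (b * c / (8 * rate)) = b * c / 8) //; field; lra.
set E := C * W; have E0 : 0 <= E by apply: Rmult_le_pos; lra.
pose c' := Rmin (c / 2) (Rmin (c2 / 2) (taus * (b * c / 8))).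
have c'0 : 0 < c' by apply: Rmin_case; [lra | apply: Rmin_case; [lra | nra]].
exists c'; split=> //.
have H := small_and _ _ (small_lin (2 * taus * E) (c / 4) ltac:(lra))
  (small_and _ _ (small_lin E (b * c / 8) ltac:(lra)) (small_and _ _ (small_lin rate (/ 4) ltac:(lra))
  (small_and _ _ (small_lin E (c2 / 4) ltac:(lra)) (small_lin 1 1 Rlt_0_1)))).
move: H; apply: small_imp => T T0 [t1 [t2 [t3 [t4 t5]]]] n z w [n1 n2] [st hz] wW pos.
have T2 : 0 <= T ^ 2 by apply: pow2_ge_0.
have err : C * T ^ 2 * norm w <= E * T ^ 2.
  rewrite (_ : E * T ^ 2 = C * T ^ 2 * W); last by rewrite /E; ring.
  by apply: Rmult_le_compat_l => //; apply: Rmult_le_pos.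
have ET0 : 0 <= E * T ^ 2 by apply: Rmult_le_pos.
have stay j k : (k <= n)%nat -> c <= dot w (z 0%nat j) -> c / 2 <= dot w (z k j).
  move=> kn hj.
  have step l : (l < n)%nat -> (1 - T * rate) * dot w (z l j) - E * T ^ 2 <= dot w (z l.+1 j).
    move=> ln; have := step_nonneg T (z l) (z l.+1) w j T0 ltac:(lra) (hz l ltac:(lia)) (st l ln)
      (fun k => pos l k ltac:(lia)); lra.
  have TB0 : 0 <= T * rate by apply: Rmult_le_pos; lra.
  have h := persist (fun l => dot w (z l j)) (T * rate) (E * T ^ 2) n ltac:(lra) ET0 ltac:(lra) step k kn.
  have kT : INR k * T <= 2 * taus.
    by apply: Rle_trans n2; apply: Rmult_le_compat_r; [lra | apply: le_INR; lia].
  have h1 : INR k * T * rate <= 2 * taus * rate by apply: Rmult_le_compat_r; lra.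
  have h2 : INR k * T * (E * T) <= 2 * taus * (E * T).
    by apply: Rmult_le_compat_r => //; apply: Rmult_le_pos; lra.
  have h3 : c * (1 - INR k * (T * rate)) <= dot w (z 0%nat j) * (1 - INR k * (T * rate)).
    by apply: Rmult_le_compat_r; lra.
  have h4 : c * (3 / 4) <= c * (1 - INR k * (T * rate)) by apply: Rmult_le_compat_l; lra.
  lra.
split=> [i hi | i j ij hj].
  by apply: Rle_trans (Rmin_l _ _) _; apply: stay.
have ji := listens_neq i j ij.
have step k : (k < n)%nat ->
    (1 - T * rate) * dot w (z k i) + T * coupling i j (minus (z k j) (z k i)) * dot w (z k j)
      - E * T ^ 2 <= dot w (z k.+1 i).
  move=> kn; have := step_lower_edge T (z k) (z k.+1) w i j T0 ltac:(lra) (hz k ltac:(lia))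
    (st k kn) (fun l => pos k l ltac:(lia)) ji; lra.
have d0 : 0 <= T * (b * c / 8) by apply: Rmult_le_pos; lra.
apply: Rle_trans (Rmin_r _ _) _.
have := growth (fun k => dot w (z k i)) c2 (T * (b * c / 8)) n d0 (pos 0%nat i ltac:(lia)) _ _ n (leqnn n).
move=> H; apply: Rle_trans (H _ _).
- apply: Rmin_glb; first exact: Rmin_l.
  apply: Rle_trans (Rmin_r _ _) _; rewrite -Rmult_assoc.
  by apply: Rmult_le_compat_r; lra.
- move=> k kn hk; have := step k kn; have xj := stay j k ltac:(lia) hj.
  have p0 := pos k i ltac:(lia); set a := coupling i j _.
  have ab : b <= a.
    apply: hb => //; split; last by apply: norms_le_minus; apply: hz; lia.
    have := dot_norm w (minus (z k j) (z k i)); rewrite dot_minus => h.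
    have h1 : c / 4 <= norm w * norm (minus (z k j) (z k i)).
      by apply: Rle_trans h; apply: Rle_trans (Rle_abs _); lra.
    have n0 := norm_pos (minus (z k j) (z k i)).
    apply: (Rmult_le_reg_l W) => //.
    rewrite (_ : W * (c / (4 * W)) = c / 4); last by field; lra.
    by apply: Rle_trans h1 _; apply: Rmult_le_compat_r.
  have h2 : T * (b * (c / 2)) <= T * (a * dot w (z k j)).
    by apply: Rmult_le_compat_l; [lra | apply: Rmult_le_compat; lra].
  have h3 : T * (rate * dot w (z k i)) <= T * (b * c / 8).
    apply: Rmult_le_compat_l; first lra.
    by apply: Rle_trans Bc2; apply: Rmult_le_compat_l; lra.
  have h4 : T * (E * T) <= T * (b * c / 8) by apply: Rmult_le_compat_l; lra.
  lra.
- move=> k kn hk; have := step k kn.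
  have a0 : 0 <= T * coupling i j (minus (z k j) (z k i)) * dot w (z k j).
    apply: Rmult_le_pos; last by apply: pos; lia.
    apply: Rmult_le_pos; first lra.
    by case: (coupling_bound i j _ ji (norms_le_minus (z k) i j (hz k ltac:(lia)))).
  have h1 : (1 - T * rate) * c2 <= (1 - T * rate) * dot w (z k i) by apply: Rmult_le_compat_l; lra.
  have h2 : (T * rate) * c2 <= / 4 * c2 by apply: Rmult_le_compat_r; lra.
  have h3 : T * (E * T) <= 1 * (E * T) by apply: Rmult_le_compat_r; [apply: Rmult_le_pos|]; lra.
  lra.
Qed.

(** The margin of the root reaches every node after as many stages as the depth
    of the graph. *)
Lemma depth_margin W d : 0 < W -> forall c, 0 < c -> exists c', 0 < c' /\ small (fun T =>
  forall n z w, stage T n -> run T (d * n) z -> norm w <= W ->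
  (forall k j, (k <= d * n)%nat -> 0 <= dot w (z k j)) ->
  c <= dot w (z 0%nat root) -> forall i, reach d i -> c' <= dot w (z (d * n)%nat i)).
Proof.
move=> W0; elim: d => [|d IH] c c0.
  exists c; split=> //; exists 1; split; first lra.
  by move=> T _ n z w _ _ _ _ h i /= ->.
have [c1 [c10 H1]] := IH c c0; have [c' [c'0 H2]] := stage_margin W c1 W0 c10.
exists c'; split=> //; move: (small_and _ _ H1 H2); apply: small_imp.
move=> T T0 [h1 h2] n z w sn rn wW pos hr i.
have e : (d.+1 * n = d * n + n)%nat by rewrite mulSn addnC.
rewrite e in rn pos *.
have first_part := h1 n z w sn (run_take T _ _ z (leq_addr n _) rn) wW
  (fun k j hk => pos k j (leq_trans hk (leq_addr n _))) hr.
have := h2 n (fun k => z (d * n + k)%nat) w sn (run_shift T _ _ z rn) wW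
  (fun k j hk => pos (d * n + k)%nat j ltac:(lia)).
rewrite addn0 => -[keep pass] /= [ri | [j ij rj]].
  by apply: keep; apply: first_part.
by apply: (pass i j ij); apply: first_part.
Qed.

(** In a cone wider than [s] the root has a slope at distance at least [s / 2] from
    one side at the start. At the end every node is away from that side, by a
    smaller but definite margin, and the side can be moved inwards. *)
Lemma subwindow d S cm s : (forall i, reach d i) -> 0 <= S -> 0 < cm -> 0 < s ->
  exists c, 0 < c /\ small (fun T =>
    forall n u lo hi z, stage T n -> norm u = 1 -> run T (d * n) z ->
    (forall k, (k <= d * n)%nat -> in_cone u (- S) S cm (z k)) ->
    - S <= lo -> hi <= S -> in_cone u lo hi cm (z 0%nat) ->
    exists lo' hi', - S <= lo' /\ hi' <= S /\ hi' - lo' <= Rmax (hi - lo - c) (2 * s) /\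
      in_cone u lo' hi' cm (z (d * n)%nat)).
Proof.
move=> all_reach S0 cm0 s0; have M0 : 0 < M by lra.
have [c' [c'0 HD]] := depth_margin (S + 2) d ltac:(lra) (s / 2 * cm)
  ltac:(apply: Rmult_lt_0_compat; lra).
pose D := C * (S + 1 + 1) / cm.
have D0 : 0 <= D by apply: Rdiv_le_0_compat => //; apply: Rmult_le_pos; lra.
(* [dr] is the drift allowed within the window: it may cost at most half of the gain [c' / M]. *)
pose dr := Rmin (Rmin 1 (s / 2)) (c' / M / 4).
have cM0 : 0 < c' / M by apply: Rdiv_lt_0_compat.
have dr0 : 0 < dr by do !apply: Rmin_case; lra.
have [dr1 [dr2 dr3]] : dr <= 1 /\ dr <= s / 2 /\ dr <= c' / M / 4.
  have a1 := Rmin_l (Rmin 1 (s / 2)) (c' / M / 4); have a2 := Rmin_r (Rmin 1 (s / 2)) (c' / M / 4).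
  by have a3 := Rmin_l 1 (s / 2); have a4 := Rmin_r 1 (s / 2); rewrite -/dr in a1 a2; lra.
exists (c' / M / 2); split; first lra.
have H := small_and _ _ HD (small_and _ _ (small_lin rate 1 Rlt_0_1)
  (small_lin (D * (INR d * (2 * taus))) dr dr0)).
move: H {HD}; apply: small_imp => T T0 [HD [t1 t2]] n u lo hi z sn u1 rn region hlo hhi cone0.
have [st hz] := rn; have [n1 n2] := sn.
have h0 k i : (k <= d * n)%nat -> cm <= dot u (z k i) by move=> /region /(_ i) [].
have lohi : lo <= hi by have [h1 h2] := cone0 root; nra.
have width k : (k <= d * n)%nat -> 0 <= INR k * (D * T ^ 2) <= dr.
  move=> kn; split.
    by apply: Rmult_le_pos; [apply: pos_INR | apply: Rmult_le_pos => //; apply: pow2_ge_0].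
  have k1 : INR k * T <= INR d * (2 * taus).
    apply: (Rle_trans _ (INR (d * n) * T)).
      by apply: Rmult_le_compat_r; [lra | apply: le_INR; lia].
    by rewrite mult_INR Rmult_assoc; apply: Rmult_le_compat_l => //; apply: pos_INR.
  have : D * T * (INR k * T) <= D * T * (INR d * (2 * taus)).
    by apply: Rmult_le_compat_l => //; apply: Rmult_le_pos; lra.
  by move=> /= *; lra.
have track k : (k <= d * n)%nat ->
    in_cone u (lo - INR k * (D * T ^ 2)) (hi + INR k * (D * T ^ 2)) cm (z k).
  elim: k => [|k IH] kn.
    by move=> i; have [h1 h2] := cone0 i; split; rewrite /=; lra.
  have cone := IH ltac:(lia); have wk := width k ltac:(lia).
  have := cone_slope_step T u _ _ cm cm (S + 1) (z k) (z k.+1) T0 ltac:(lra) u1 ltac:(lra) cm0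
    ltac:(lra) _ _ cone (hz k ltac:(lia)) (st k kn) (fun i => h0 k.+1 i ltac:(lia)).
  move=> /(_ ltac:(split_Rabs; lra) ltac:(split_Rabs; lra)) H i.
  by have [h1 h2] := H i; split=> //; rewrite S_INR -/D in h2 *; lra.
have track' k i : (k <= d * n)%nat ->
    (lo - dr) * dot u (z k i) <= dot (perp u) (z k i) <= (hi + dr) * dot u (z k i).
  move=> kn; have [h1 h2] := track k kn i; have wk := width k kn.
  by have := h0 k i kn; nra.
(* The drifting sides are cut back to the slopes that the region allows. *)
have clip lo' hi' : (forall i, lo' * dot u (z (d * n)%nat i) <= dot (perp u) (z (d * n)%nat i)
      <= hi' * dot u (z (d * n)%nat i)) -> hi' - lo' <= Rmax (hi - lo - c' / M / 2) (2 * s) ->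
    exists lo' hi', - S <= lo' /\ hi' <= S /\ hi' - lo' <= Rmax (hi - lo - c' / M / 2) (2 * s) /\
      in_cone u lo' hi' cm (z (d * n)%nat).
  move=> sl sp; exists (Rmax (- S) lo'), (Rmin S hi').
  have m1 := Rmax_l (- S) lo'; have m2 := Rmax_r (- S) lo'.
  have m3 := Rmin_l S hi'; have m4 := Rmin_r S hi'.
  do 3 (split; first lra); move=> i; have [_ h2] := region _ (leqnn _) i.
  have h3 := sl i; split; first exact: h0.
  by case: (Rmax_spec (- S) lo') => -[_ ->]; case: (Rmin_spec S hi') => -[_ ->]; lra.
case: (Rlt_le_dec (hi - lo) s) => hs.
  apply: (clip (lo - dr) (hi + dr)) => [i|]; first by apply: track'.
  by apply: Rle_trans (Rmax_r _ _); lra.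
have c'h g i : c' <= g -> c' / M * dot u (z (d * n)%nat i) <= g.
  move=> hg; apply: Rle_trans hg.
  have hM : dot u (z (d * n)%nat i) <= M.
    by apply: Rle_trans (Rle_abs _) _; apply: Rle_trans (dot_unit_le _ _ u1) (hz _ (leqnn _) i).
  apply: Rle_trans (Rmult_le_compat_l _ _ _ (Rlt_le _ _ cM0) hM) _.
  by right; field; lra.
have [hr1 hr2] := cone0 root.
case: (Rle_lt_dec (s / 2 * dot u (z 0%nat root)) (hi * dot u (z 0%nat root) - dot (perp u) (z 0%nat root))) => side.
  have := HD n z (comb u (hi + dr) (-1)) sn rn _ _ _.
  have nw : norm (comb u (hi + dr) (-1)) <= S + 2.
    by apply: Rle_trans (norm_comb _ _ _ u1) _; split_Rabs; lra.
  move=> /(_ nw) H.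
  have {}H := H ltac:(move=> k j hk; rewrite dot_comb; have := track' k j hk; lra).
  have {}H := H ltac:(rewrite dot_comb; nra).
  apply: (clip (lo - dr) (hi + dr - c' / M)) => [i|]; last by apply: Rle_trans (Rmax_l _ _); lra.
  have := c'h _ i (H i (all_reach i)); rewrite dot_comb.
  by have := track' _ i (leqnn _); lra.
have := HD n z (comb u (- (lo - dr)) 1) sn rn _ _ _.
have nw : norm (comb u (- (lo - dr)) 1) <= S + 2.
  by apply: Rle_trans (norm_comb _ _ _ u1) _; split_Rabs; lra.
move=> /(_ nw) H.
have {}H := H ltac:(move=> k j hk; rewrite dot_comb; have := track' k j hk; lra).
have {}H := H ltac:(rewrite dot_comb; nra).
apply: (clip (lo - dr + c' / M) (hi + dr)) => [i|]; last by apply: Rle_trans (Rmax_l _ _); lra.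
have := c'h _ i (H i (all_reach i)); rewrite dot_comb.
by have := track' _ i (leqnn _); lra.
Qed.

Lemma windows d S cm s : (forall i, reach d i) -> 0 <= S -> 0 < cm -> 0 < s ->
  exists c, 0 < c /\ small (fun T =>
    forall W n u z, stage T n -> norm u = 1 -> run T (W * (d * n)) z ->
    (forall k, (k <= W * (d * n))%nat -> in_cone u (- S) S cm (z k)) ->
    exists lo hi, - S <= lo /\ hi <= S /\ hi - lo <= Rmax (2 * S - INR W * c) (2 * s) /\
      in_cone u lo hi cm (z (W * (d * n))%nat)).
Proof.
move=> all_reach S0 cm0 s0; have [c [c0 H]] := subwindow d S cm s all_reach S0 cm0 s0.
exists c; split=> //; move: H; apply: small_imp => T T0 H W n u z sn u1.
elim: W => [|W IH] rn region.
  exists (- S), S; do 2 (split; first lra); split; last exact: region.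
  by apply: Rle_trans (Rmax_l _ _); rewrite /=; lra.
have e : (W.+1 * (d * n) = W * (d * n) + d * n)%nat by rewrite mulSn addnC.
rewrite e in rn region *.
have [lo [hi [h1 [h2 [h3 h4]]]]] := IH (run_take T _ _ z (leq_addr _ _) rn)
  (fun k hk => region k (leq_trans hk (leq_addr _ _))).
have [||lo' [hi' [h1' [h2' [h3' h4']]]]] := H n u lo hi (fun k => z (W * (d * n) + k)%nat) sn u1
  (run_shift T _ _ z rn) _ h1 h2.
- by move=> k hk; apply: region; rewrite leq_add2l.
- by rewrite addn0.
exists lo', hi'; do 2 (split=> //); split=> //; apply: Rle_trans h3' _; rewrite S_INR.
have m1 := Rmax_l (2 * S - (INR W + 1) * c) (2 * s).
have m2 := Rmax_r (2 * S - (INR W + 1) * c) (2 * s).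
by apply: Rmax_lub => //; case: (Rmax_spec (2 * S - INR W * c) (2 * s)) h3 => -[? ->]; lra.
Qed.

Hypothesis connected : forall i, i <> root -> clos_trans 'I_m listens i root.

Lemma reach_mono d d' i : (d <= d')%nat -> reach d i -> reach d' i.
Proof.
elim: d' => [|d' IH]; first by rewrite leqn0 => /eqP ->.
by rewrite leq_eqVlt => /orP [/eqP -> // | /IH h r]; left; apply: h.
Qed.

Lemma reach_all : exists d, (0 < d)%nat /\ forall i, reach d i.
Proof.
have up i j : clos_trans 'I_m listens i j -> forall d, reach d j -> exists d', reach d' i.
  elim=> {i j} [i j ij d rj | i k j _ IH1 _ IH2 d rj].
    by exists d.+1; right; exists j.
  by have [d' rk] := IH2 d rj; apply: IH1 rk.
have [|||d hd] := @fin_uniform 'I_m nat (fun a b => (a <= b)%nat) (fun i d => reach d i) 0%nat.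
- by move=> a b; exists (a + b)%nat; split; [apply: leq_addr | apply: leq_addl].
- by move=> i a b ab; apply: reach_mono.
- move=> i; case: (Classical_Prop.classic (i = root)) => [-> | ne]; first by exists 0%nat.
  exact: (up i root (connected i ne) 0%nat erefl).
by exists d.+1; split=> // i; left; apply: hd.
Qed.

(** The number of shrinking steps is chosen large enough for three purposes: a
    narrow cone, a level close to its ceiling, and a duration of at least
    [tmin]. Shorter runs keep the intermediate bounds, which is what is
    available at the last, incomplete window of a trajectory. *)
Lemma window S s eta cb c0 tmin :
  0 <= S -> 0 < s -> 0 < eta -> 0 < c0 -> 0 < cb - eta ->
  (1 + (S + s)) * cb <= rho - eta -> 0 <= tmin ->
  exists tau, 0 < tau /\ small (fun T => exists N, tmin <= INR N * T <= tau /\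
    (forall N' u z, (N' <= N)%nat -> norm u = 1 -> run T N' z ->
      in_cone u (- S) S c0 (z 0%nat) ->
      in_cone u (- (S + s)) (S + s) (Rmin c0 (cb - eta)) (z N')) /\
    (forall u z, norm u = 1 -> run T N z -> in_cone u (- S) S c0 (z 0%nat) ->
      exists lo hi, hi - lo <= s /\ in_cone u lo hi (cb - eta) (z N))).
Proof.
move=> S0 s0 e0 c00 cb0 hcb tm0; have ts0 := taus_gt0; have [d [d0 all_reach]] := reach_all.
have [c1 [c10 HC]] := cone_run S s eta cb c0 S0 s0 e0 c00 cb0 hcb.
set cm := Rmin c0 (cb - eta) in HC *; have cm0 : 0 < cm by apply: Rmin_case.
have [c [cp HW]] := windows d (S + s) cm (s / 2) all_reach ltac:(lra) cm0 ltac:(lra).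
(* The three terms serve the width, the duration and the level, in this order. *)
pose X := 2 * (S + s) / c + tmin / taus + (cb - eta) / (c1 * taus).
have X1 : 0 <= 2 * (S + s) / c by apply: Rdiv_le_0_compat; lra.
have X2 : 0 <= tmin / taus by apply: Rdiv_le_0_compat; lra.
have X3 : 0 <= (cb - eta) / (c1 * taus).
  by apply: Rdiv_le_0_compat; [lra | apply: Rmult_lt_0_compat].
have [W' [_ hW]] := nfloor_ex X ltac:(rewrite /X; lra).
pose W := W'.+1; have WX : X < INR W by rewrite /W S_INR.
have W0 : 0 < INR W by rewrite /X in WX; lra.
have d1 : 1 <= INR d by apply: (le_INR 1); lia.
have Wd : 0 < INR W * INR d by apply: Rmult_lt_0_compat; lra.
exists (INR W * INR d * (2 * taus)); split; first by apply: Rmult_lt_0_compat; lra.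
have H := small_and _ _ (HC (INR W * INR d * (2 * taus)) ltac:(apply: Rmult_lt_0_compat; lra))
  (small_and _ _ HW (small_lin 1 taus ts0)).
move: H {HC HW}; apply: small_imp => T T0 [HC [HW t1]].
have [n sn] := stage_ex T ltac:(lra).
have [n1 n2] := sn; pose N := (W * (d * n))%nat.
have eN : INR N * T = INR W * INR d * (INR n * T) by rewrite /N !mult_INR; ring.
have N1 : INR W * INR d * taus <= INR N * T by rewrite eN; apply: Rmult_le_compat_l; lra.
have N2 : INR N * T <= INR W * INR d * (2 * taus) by rewrite eN; apply: Rmult_le_compat_l; lra.
have N3 : X * taus <= INR N * T.
  apply: Rle_trans N1; apply: Rmult_le_compat_r; first lra.
  have : INR W * 1 <= INR W * INR d by apply: Rmult_le_compat_l; lra.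
  lra.
have XT : X * taus = 2 * (S + s) / c * taus + tmin + (cb - eta) / c1.
  by rewrite /X; field; split; lra.
have X4 : 0 <= (cb - eta) / c1 by apply: Rdiv_le_0_compat; lra.
have X5 : 0 <= 2 * (S + s) / c * taus by apply: Rmult_le_pos; lra.
have small_cone N' u z : (N' <= N)%nat -> norm u = 1 -> run T N' z ->
    in_cone u (- S) S c0 (z 0%nat) -> forall k, (k <= N')%nat ->
    in_cone u (- (S + s)) (S + s) (Rmin (c0 + INR k * T * c1) (cb - eta)) (z k).
  move=> N'N u1 rn cone k kN'; apply: (HC N' u z _ u1 rn cone k kN').
  by apply: Rle_trans N2; apply: Rmult_le_compat_r; [lra | apply: le_INR; lia].
have level k : cm <= Rmin (c0 + INR k * T * c1) (cb - eta).
  apply: Rmin_glb; last exact: Rmin_r.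
  apply: Rle_trans (Rmin_l _ _) _.
  by have := Rmult_le_pos _ _ (Rmult_le_pos _ _ (pos_INR k) (Rlt_le _ _ T0)) (Rlt_le _ _ c10); lra.
have small_cone' N' u z : (N' <= N)%nat -> norm u = 1 -> run T N' z ->
    in_cone u (- S) S c0 (z 0%nat) -> forall k, (k <= N')%nat ->
    in_cone u (- (S + s)) (S + s) cm (z k).
  move=> N'N u1 rn cone k kN'; have lk := level k.
  by apply: in_cone_weaken (small_cone N' u z N'N u1 rn cone k kN'); lra.
exists N; split; first by lra.
split=> [N' u z N'N u1 rn cone | u z u1 rn cone].
  exact: (small_cone' N' u z N'N u1 rn cone N' (leqnn _)).
have [lo [hi [_ [_ [sp hc]]]]] := HW W n u z sn u1 rn (small_cone' N u z (leqnn _) u1 rn cone).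
exists lo, hi; split.
  apply: Rle_trans sp _; apply: Rmax_lub; last lra.
  have : 2 * (S + s) / c * c <= INR W * c.
    by apply: Rmult_le_compat_r; [lra | rewrite /X in WX; lra].
  rewrite (_ : 2 * (S + s) / c * c = 2 * (S + s)); last by field; lra.
  lra.
move=> i; have [_ h2] := hc i; split=> //.
have [h3 _] := small_cone N u z (leqnn _) u1 rn cone N (leqnn _) i.
apply: Rle_trans h3; apply: Rmin_glb; last lra.
have : (cb - eta) / c1 * c1 <= INR N * T * c1 by apply: Rmult_le_compat_r; lra.
rewrite (_ : (cb - eta) / c1 * c1 = cb - eta); last by field; lra.
lra.
Qed.

(** * Locking *)

(** Smallness of the tolerances: [eta] for radii, [s] for slopes, the latter
    negligible with respect to the former. *)
Definition tight (eta s : R) : Prop :=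
  0 < eta /\ 8 * eta <= rho /\ 0 < s /\ s <= / 4 /\ 8 * s * (rho + eta) <= eta.

(** The constants leave room for what one window costs: slopes may reach [3 s]
    before being reduced, and the level [rho - 3 * eta] is regained at the end. *)
Definition phase_locked (eta s : R) (z : state m) : Prop :=
  exists u, norm u = 1 /\ in_cone u (- (2 * s)) (2 * s) (rho - 3 * eta) z.

Definition near_orbit (e : R) (z : state m) : Prop :=
  exists u : plane, norm u = 1 /\ forall i, norm (minus (z i) (scal rho u)) <= e.

(** In a cone of half-width [3 s] a projection below this value forces the norm
    below [rho - eta]. *)
Definition narrow_level (eta s : R) : R := (rho - eta) / (1 + 3 * s).

Lemma narrow_level_bounds eta s : tight eta s ->
  (1 + (2 * s + s)) * narrow_level eta s <= rho - eta /\
  rho - 3 * eta <= (narrow_level eta s - eta) * (1 - s) /\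
  rho - 3 * eta <= narrow_level eta s - eta.
Proof.
move=> [e0 [er [s0 [s4 sr]]]]; rewrite /narrow_level; set cb := (_ - _) / _.
have e : (1 + 3 * s) * cb = rho - eta by rewrite /cb; field; lra.
have cbr : cb <= rho by nra.
by split; [lra | split; nra].
Qed.

Lemma lock_window eta s c0 tmin : tight eta s -> 0 < c0 -> 0 <= tmin ->
  exists tau, 0 < tau /\ small (fun T => exists N, tmin <= INR N * T <= tau /\
    (forall N' u z, (N' <= N)%nat -> norm u = 1 -> run T N' z ->
      in_cone u (- (2 * s)) (2 * s) c0 (z 0%nat) ->
      in_cone u (- (3 * s)) (3 * s) (Rmin c0 (rho - 3 * eta)) (z N')) /\
    (forall u z, norm u = 1 -> run T N z -> in_cone u (- (2 * s)) (2 * s) c0 (z 0%nat) ->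
      phase_locked eta s (z N))).
Proof.
move=> ti c00 tm0; have [b1 [b2 b3]] := narrow_level_bounds eta s ti.
have [e0 [er [s0 [s4 sr]]]] := ti.
have [tau [tau0 H]] := window (2 * s) s eta (narrow_level eta s) c0 tmin
  ltac:(lra) s0 e0 c00 ltac:(lra) b1 tm0.
exists tau; split=> //; move: H; apply: small_imp => T T0 [N [NT [h1 h2]]].
exists N; split=> //; split=> [N' u z N'N u1 rn cone | u z u1 rn cone].
  apply: in_cone_weaken (h1 N' u z N'N u1 rn cone); try lra.
    by apply: Rlt_le; apply: Rmin_case; lra.
  by apply: Rmin_glb; [apply: Rmin_l | apply: Rle_trans (Rmin_r _ _) b3].
have [lo [hi [sp hc]]] := h2 u z u1 rn cone.
have [u' [u'1 hc']] := in_cone_recenter m u lo hi (narrow_level eta s - eta) s (z N) u1 ltac:(lra) sp ltac:(lra) hc.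
exists u'; split=> //; apply: in_cone_weaken hc'; lra.
Qed.

(** The direction of the cone is not controlled, only its width: it is made narrow
    again and re-centred at the end of each window, which undoes the drift
    accumulated in between. *)
Lemma lock_forever eta s : tight eta s -> small (fun T => forall N z, run T N z ->
  phase_locked eta s (z 0%nat) -> exists u, norm u = 1 /\
    in_cone u (- (3 * s)) (3 * s) (rho - 3 * eta) (z N)).
Proof.
move=> ti; have [e0 [er [s0 [s4 sr]]]] := ti.
have [tau [tau0 H]] := lock_window eta s (rho - 3 * eta) 1 ti ltac:(lra) ltac:(lra).
move: H; apply: small_imp => T T0 [N [[NT _] [h1 h2]]].
have N0 : (0 < N)%nat by case: N NT {h1 h2} => [|N] //=; lra.
move=> N'; have [n] := ubnP N'; elim: n N' => [//|n IH] N' N'n z rn [u [u1 cone]].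
case: (leqP N' N) => hN.
  exists u; split=> //; have := h1 N' u z hN u1 rn cone.
  by rewrite Rmin_left; last lra.
have lk := h2 u z u1 (run_take T _ _ z (ltnW hN) rn) cone.
have e : (N + (N' - N) = N')%nat by lia.
rewrite -e in rn.
have [|u' hu'] := IH (N' - N)%nat ltac:(lia) (fun k => z (N + k)%nat) (run_shift T _ _ z rn).
  by rewrite addn0.
by rewrite e in hu'; exists u'.
Qed.

Lemma dot_perp_self u : dot (perp u) u = 0.
Proof. by rewrite /dot fst_perp snd_perp; ring. Qed.

Lemma near_orbit_of_cone eta s u z : tight eta s -> norm u = 1 ->
  in_cone u (- (3 * s)) (3 * s) (rho - 3 * eta) z -> norms_le (rho + eta) z ->
  near_orbit (5 * eta) z.
Proof.
move=> [e0 [er [s0 [s4 sr]]]] u1 cone hz; exists u; split=> // i.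
apply: Rle_trans (norm_le_frame u _ u1) _.
rewrite !dot_minus !dot_scal dot_perp_self -norm_sq u1.
have [h1 h2] := cone i; have := dot_unit_le u (z i) u1; have hzi := hz i.
set h := dot u _ in h1 h2 *; set nu := dot _ _ in h2 *; move=> hn.
have hr : h <= rho + eta by move: hn; split_Rabs; lra.
have : 3 * s * h <= 3 * s * (rho + eta) by apply: Rmult_le_compat_l; lra.
by move=> h3; split_Rabs; lra.
Qed.

Lemma phase_locked_near_orbit eta s : tight eta s -> small (fun T => forall N z, run T N z ->
  phase_locked eta s (z 0%nat) -> norms_le (rho + eta) (z N) -> near_orbit (5 * eta) (z N)).
Proof.
move=> ti; move: (lock_forever eta s ti); apply: small_imp => T T0 H N z rn lk hz.
by have [u [u1 cone]] := H N z rn lk; apply: (near_orbit_of_cone eta s u).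
Qed.

Lemma phase_locked_of_near_orbit eta s e z : tight eta s -> e <= s * rho / 2 -> e <= eta ->
  near_orbit e z -> phase_locked eta s z.
Proof.
clear damping_bound.
move=> [e0 [er [s0 [s4 sr]]]] es ee [u [u1 hu]]; exists u; split=> // i.
have h1 := dot_unit_le u (minus (z i) (scal rho u)) u1.
have h2 := dot_unit_le (perp u) (minus (z i) (scal rho u)) ltac:(by rewrite norm_perp).
move: h1 h2; rewrite !dot_minus !dot_scal dot_perp_self -norm_sq u1; have := hu i.
set h := dot u _; set nu := dot _ _ => h0 h1 h2.
have b : rho - eta <= h by move: h1; split_Rabs; lra.
split; first lra.
have : s * rho / 2 <= 2 * s * h by nra.
by move: h2; split_Rabs; lra.
Qed.

(** Two windows: the first makes the cone narrow, the second then lets all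
    projections climb close to [rho]. *)
Lemma capture S c0 eta s tmin : 0 <= S -> 0 < c0 -> tight eta s -> 0 <= tmin ->
  exists tau, 0 < tau /\ small (fun T => exists N, tmin <= INR N * T <= tau /\
    forall u z, norm u = 1 -> run T N z -> in_cone u (- S) S c0 (z 0%nat) ->
    phase_locked eta s (z N)).
Proof.
move=> S0 c00 ti tm0; have [e0 [er [s0 [s4 sr]]]] := ti.
(* In the wide cone a projection of at most [2 b] means a norm of at most [rho / 2]. *)
pose b := rho / (4 * (S + 2)).
have b0 : 0 < b by apply: Rdiv_lt_0_compat; lra.
have bS : (S + 2) * b = rho / 4 by rewrite /b; field; lra.
pose e1 := Rmin eta b; have e10 : 0 < e1 by apply: Rmin_case.
have e1e : e1 <= eta by apply: Rmin_l.
have e1b : e1 <= b by apply: Rmin_r.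
have hcb : (1 + (S + s)) * (2 * b) <= rho - e1.
  have : (1 + (S + s)) * (2 * b) <= (S + 2) * (2 * b) by apply: Rmult_le_compat_r; lra.
  lra.
have [tau1 [tau10 H1]] := window S s e1 (2 * b) c0 tmin S0 s0 e10 c00 ltac:(lra) hcb tm0.
have c20 : 0 < (2 * b - e1) * (1 - s) by apply: Rmult_lt_0_compat; lra.
have [tau2 [tau20 H2]] := lock_window eta s ((2 * b - e1) * (1 - s)) 0 ti c20 ltac:(lra).
exists (tau1 + tau2); split; first lra.
move: (small_and _ _ H1 H2); apply: small_imp.
move=> T T0 [[N1 [NT1 [_ h1]]] [N2 [NT2 [_ h2]]]].
exists (N1 + N2)%nat; split; first by rewrite plus_INR; lra.
move=> u z u1 rn cone.
have [lo [hi [sp hc]]] := h1 u z u1 (run_take T _ _ z (leq_addr _ _) rn) cone.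
have [u' [u'1 hc']] := in_cone_recenter m u lo hi (2 * b - e1) s (z N1) u1 ltac:(lra) sp ltac:(lra) hc.
apply: (h2 u' (fun k => z (N1 + k)%nat) u'1 (run_shift T _ _ z rn)).
by rewrite addn0.
Qed.

End Recursion.

(** * Curves in the plane *)

Lemma is_derive_fst (x : R -> plane) t (l : plane) :
  is_derive x t l -> is_derive (fun s => fst (x s) : R) t (fst l).
Proof.
move=> h; have lin : is_linear (fun z : plane => fst z : R_NormedModule) := is_linear_fst.
exact: (filterdiff_comp' x _ t _ _ h (filterdiff_linear _ lin)).
Qed.

Lemma is_derive_snd (x : R -> plane) t (l : plane) :
  is_derive x t l -> is_derive (fun s => snd (x s) : R) t (snd l).
Proof.
move=> h; have lin : is_linear (fun z : plane => snd z : R_NormedModule) := is_linear_snd.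
exact: (filterdiff_comp' x _ t _ _ h (filterdiff_linear _ lin)).
Qed.

Lemma is_derive_plane (a b : R -> R) t da db :
  is_derive a t da -> is_derive b t db -> is_derive (fun s => (a s, b s) : plane) t ((da, db) : plane).
Proof.
move=> ha hb.
apply: (filterdiff_comp'_2 a b (fun x y => (x, y) : plane) t _ _ (fun x y => (x, y) : plane) ha hb).
apply: (filterdiff_ext_lin _ (fun z : plane => z)) => [|[x y]] //.
apply: (filterdiff_ext (fun z : plane => z)) => [[x y]|] //.
exact: filterdiff_id.
Qed.

Lemma filterlim_pair_plane (T : Type) (F : (T -> Prop) -> Prop) (a b : T -> R) (la lb : R) :
  Filter F -> filterlim a F (locally la) -> filterlim b F (locally lb) ->
  filterlim (fun s => (a s, b s) : plane) F (locally ((la, lb) : plane)).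
Proof.
move=> FF ha hb P [e he].
have h1 := ha _ (locally_ball la e); have h2 := hb _ (locally_ball lb e).
rewrite /filtermapi /filtermap in h1 h2 *.
have h3 := @filter_and T F FF _ _ h1 h2; apply: (@filter_imp T F FF _ _ _ h3) => s [b1 b2].
by apply: he; split.
Qed.

Lemma curve_continuous_on (D : R -> Prop) (x : R -> plane) :
  continuous_on D x -> forall s e, D s -> 0 < e -> exists d, 0 < d /\
    forall s', D s' -> Rabs (s' - s) < d -> norm (minus (x s') (x s)) < e.
Proof.
move=> cont s e Ds e0.
have [d hd] := cont s Ds _ (locally_ball_norm (x s) (mkposreal e e0)).
exists d; split; first exact: cond_pos.
by move=> s' Ds' hs; apply: hd.
Qed.

Lemma norm_triangle_minus (x y : plane) : norm x <= norm y + norm (minus x y).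
Proof.
have := norm_triangle y (minus x y).
rewrite (_ : plus y (minus x y) = x) //.
by rewrite /minus (plus_comm x) plus_assoc plus_opp_r plus_zero_l.
Qed.

(** * Sums of averages *)

Lemma continuous_sum (I : finType) (P : pred I) (F : I -> R -> R) (x : R) :
  (forall j, P j -> continuous (F j) x) ->
  continuous (fun s => \big[Rplus/0]_(j | P j) F j s) x.
Proof.
move=> h; suff : forall r : seq I, continuous (fun s => \big[Rplus/0]_(j <- r | P j) F j s) x by exact.
elim=> [|j r IH].
  apply: (continuous_ext (fun=> 0)); first by move=> s; rewrite big_nil.
  exact: continuous_const.
case E: (P j); last by apply: (continuous_ext _ _ _ _ IH) => s; rewrite big_cons E.
apply: (continuous_ext (fun s => F j s + \big[Rplus/0]_(j <- r | P j) F j s)).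
  by move=> s; rewrite big_cons E.
by apply: (continuous_plus (F j)) => //; apply: h.
Qed.

Lemma circle_mean_sum (I : finType) (P : pred I) (F : I -> R -> R) :
  (forall j t, P j -> continuous (F j) t) ->
  circle_mean (fun s => \big[Rplus/0]_(j | P j) F j s)
  = \big[Rplus/0]_(j | P j) circle_mean (F j).
Proof.
move=> h; suff : forall r : seq I,
    (forall t, continuous (fun s => \big[Rplus/0]_(j <- r | P j) F j s) t) /\
    circle_mean (fun s => \big[Rplus/0]_(j <- r | P j) F j s)
    = \big[Rplus/0]_(j <- r | P j) circle_mean (F j) by move=> /(_ (index_enum I)) [].
elim=> [|j r [c IH]].
  split.
    by move=> t; apply: (continuous_ext (fun=> 0)); [move=> s; rewrite big_nil | apply: continuous_const].
  rewrite big_nil -(circle_mean_const 0); apply: circle_mean_ext => s.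
  by rewrite big_nil circle_mean_const.
case E: (P j); last first.
  split; first by move=> t; apply: (continuous_ext _ _ _ _ (c t)) => s; rewrite big_cons E.
  by rewrite big_cons E -IH; apply: circle_mean_ext => s; rewrite big_cons E.
have cj t : continuous (F j) t by apply: h.
split.
  move=> t; apply: (continuous_ext (fun s => F j s + \big[Rplus/0]_(j <- r | P j) F j s)).
    by move=> s; rewrite big_cons E.
  by apply: (continuous_plus (F j)).
rewrite big_cons E -IH -[X in X + _]Rmult_1_l -[X in _ + X]Rmult_1_l -circle_mean_lin //.
by apply: circle_mean_ext => s; rewrite big_cons E; ring.
Qed.

(** * The force of the array *)

Section Array.

Variables (m : nat) (f : R -> R) (gamma : 'I_m -> 'I_m -> R -> R).
Hypothesis f_lip : locally_lipschitz f.
Hypothesis gamma_lip : forall i j, i <> j -> locally_lipschitz (gamma i j).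
Hypothesis gamma0 : forall i j, i <> j -> gamma i j 0 = 0.

Definition force (x : state m) (i : 'I_m) : R :=
  - f (fst (x i)) * snd (x i)
  + \big[Rplus/0]_(j | j != i) gamma i j (snd (x j) - snd (x i)).

Definition box (M : R) (x : state m) : Prop :=
  forall i, Rabs (fst (x i)) <= M /\ Rabs (snd (x i)) <= M.

Lemma box_norms_le M (x : state m) : norms_le m M x -> box M x.
Proof.
by move=> h i; have := fst_le_norm (x i); have := snd_le_norm (x i); have := h i; split; lra.
Qed.

Lemma neq_sym_prop (i j : 'I_m) : j != i -> i <> j.
Proof. by move=> /eqP h e; apply: h. Qed.

Lemma abs_sub_between a b c : Rabs a <= c -> Rabs b <= c -> - (2 * c) <= a - b <= 2 * c.
Proof. by split_Rabs; lra. Qed.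

Lemma abs_sub_sub a b c d e : Rabs (a - c) <= e -> Rabs (b - d) <= e ->
  Rabs ((a - b) - (c - d)) <= 2 * e.
Proof. by split_Rabs; lra. Qed.

Lemma force_lip M : 0 <= M -> exists L, 0 <= L /\ forall x y D, box M x -> box M y ->
  (forall j, Rabs (fst (x j) - fst (y j)) <= D /\ Rabs (snd (x j) - snd (y j)) <= D) ->
  forall i, Rabs (force x i - force y i) <= L * D.
Proof.
move=> M0; have [Lf [Lf0 hf]] := locally_lipschitz_segment f M f_lip.
have [||Lg [Lg0 hg]] := @fin_large ('I_m * 'I_m)%type
  (fun ij L => ij.1 <> ij.2 -> lipschitz_on (gamma ij.1 ij.2) (- (2 * M)) (2 * M) L).
- move=> ij L L' le h ne x y hx hy; apply: Rle_trans (h ne x y hx hy) _.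
  by apply: Rmult_le_compat_r => //; apply: Rabs_pos.
- move=> [i j]; case: (Classical_Prop.classic (i = j)) => ne; first by exists 0.
  have [L [_ hL]] := locally_lipschitz_segment (gamma i j) (2 * M) (gamma_lip i j ne).
  by exists L.
pose Kf := Rabs (f 0) + Lf * M.
have Kf0 : 0 <= Kf by have := Rabs_pos (f 0); rewrite /Kf; nra.
have bf u : Rabs u <= M -> Rabs (f u) <= Kf.
  move=> hu; have := hf u 0 ltac:(split_Rabs; lra) ltac:(lra); rewrite Rminus_0_r.
  have : Lf * Rabs u <= Lf * M by apply: Rmult_le_compat_l.
  by rewrite /Kf; split_Rabs; lra.
exists (Lf * M + Kf + INR m * (Lg * 2)); split.
  have := Rmult_le_pos _ _ (pos_INR m) (Rmult_le_pos _ _ Lg0 (Rlt_le _ _ Rlt_0_2)).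
  by have := Rmult_le_pos _ _ Lf0 M0; lra.
move=> x y D hx hy hD i.
have D0 : 0 <= D by have [h _] := hD i; apply: Rle_trans h; apply: Rabs_pos.
have [x1 x2] := hx i; have [y1 y2] := hy i; have [d1 d2] := hD i.
have -> : force x i - force y i =
    - ((f (fst (x i)) - f (fst (y i))) * snd (x i)
       + f (fst (y i)) * (snd (x i) - snd (y i)))
    + (\big[Rplus/0]_(j | j != i) gamma i j (snd (x j) - snd (x i))
       - \big[Rplus/0]_(j | j != i) gamma i j (snd (y j) - snd (y i))).
  by rewrite /force; ring.
apply: Rle_trans (Rabs_triang _ _) _; rewrite Rabs_Ropp.
have t1 : Rabs ((f (fst (x i)) - f (fst (y i))) * snd (x i)) <= Lf * D * M.
  rewrite Rabs_mult; apply: Rmult_le_compat => //; try exact: Rabs_pos.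
  apply: (Rle_trans _ (Lf * Rabs (fst (x i) - fst (y i)))).
    by apply: hf; apply/Rabs_le_between.
  exact: Rmult_le_compat_l.
have t2 : Rabs (f (fst (y i)) * (snd (x i) - snd (y i))) <= Kf * D.
  by rewrite Rabs_mult; apply: Rmult_le_compat => //; try exact: Rabs_pos; apply: bf.
have t3 : Rabs (\big[Rplus/0]_(j | j != i) gamma i j (snd (x j) - snd (x i))
       - \big[Rplus/0]_(j | j != i) gamma i j (snd (y j) - snd (y i))) <= INR m * (Lg * (2 * D)).
  rewrite sum_sub.
  apply: sum_bound; first by apply: Rmult_le_pos; lra.
  move=> j ji; have [xj1 xj2] := hx j; have [yj1 yj2] := hy j; have [dj1 dj2] := hD j.
  apply: Rle_trans (hg (i, j) (neq_sym_prop i j ji) _ _ (abs_sub_between _ _ _ xj2 x2)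
    (abs_sub_between _ _ _ yj2 y2)) _.
  by apply: Rmult_le_compat_l => //; apply: abs_sub_sub.
have := Rabs_triang ((f (fst (x i)) - f (fst (y i))) * snd (x i)) (f (fst (y i)) * (snd (x i) - snd (y i))).
lra.
Qed.

Lemma force_bound M : 0 <= M -> exists F, 0 <= F /\ forall x, box M x ->
  forall i, Rabs (force x i) <= F.
Proof.
move=> M0; have [L [L0 hL]] := force_lip M M0; exists (L * M); split.
  exact: Rmult_le_pos.
pose o : state m := fun=> ((0, 0) : plane).
move=> x hx i; have f0 : force o i = 0.
  rewrite /force /= big1; first by ring.
  by move=> j ji; rewrite Rminus_0_r gamma0 //; apply: neq_sym_prop.
have ho : box M o by move=> j /=; rewrite Rabs_R0.
rewrite -(Rminus_0_r (force x i)) -f0; apply: hL => // j /=.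
by rewrite !Rminus_0_r.
Qed.

Lemma lienard_force (x : state m) w t i : lienard f gamma x w t i
  = ((w * snd (x i), - w * fst (x i) + force x i) : plane).
Proof. by rewrite /lienard /force /Rminus Ropp_mult_distr_l Rplus_assoc. Qed.

Definition mean_gain (i j : 'I_m) (z : plane) : R := gain (gamma i j) z.

(** By linearity the friction and each coupling are averaged separately, the
    latter along the difference of two rotating states, which rotates too. *)
Lemma force_rotated_mean (x : state m) w i :
  circle_mean (fun t => snd (turn t w) * force (fun j => turn t (x j)) i)
  = drift m (damp f) mean_gain x w i.
Proof.
have cf y : continuous f y by apply: locally_lipschitz_continuous.
have cg j y : j != i -> continuous (gamma i j) y.
  by move=> ji; apply: locally_lipschitz_continuous; apply: gamma_lip; apply: neq_sym_prop.
have cw t : continuous (fun t => snd (turn t w)) t by apply: continuous_turn_snd.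
have c1 t : continuous (fun t => snd (turn t w) * (f (fst (turn t (x i))) * snd (turn t (x i)))) t.
  apply: continuous_times => //; apply: continuous_times; last exact: continuous_turn_snd.
  by apply: continuous_comp_all => //; apply: continuous_turn_fst.
have c2 j t : j != i ->
    continuous (fun t => snd (turn t w) * gamma i j (snd (turn t (minus (x j) (x i))))) t.
  move=> ji; apply: continuous_times => //.
  by apply: continuous_comp_all; [move=> y; apply: cg | apply: continuous_turn_snd].
rewrite (circle_mean_ext _ (fun t =>
  -1 * (snd (turn t w) * (f (fst (turn t (x i))) * snd (turn t (x i))))
  + 1 * \big[Rplus/0]_(j | j != i)
      (snd (turn t w) * gamma i j (snd (turn t (minus (x j) (x i))))))).
  rewrite circle_mean_lin //; last by move=> t; apply: continuous_sum => j ji; apply: c2.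
  rewrite damp_mean // circle_mean_sum; last by move=> j t; apply: c2.
  rewrite /drift Rmult_1_l; congr (_ + _); first by ring.
  apply: eq_bigr => j ji; rewrite gain_mean ?dot_minus //.
    by move=> y; apply: cg.
  by apply: gamma0; apply: neq_sym_prop.
move=> t.
have -> : \big[Rplus/0]_(j | j != i) (snd (turn t w) * gamma i j (snd (turn t (minus (x j) (x i)))))
    = snd (turn t w) * \big[Rplus/0]_(j | j != i) gamma i j (snd (turn t (x j)) - snd (turn t (x i))).
  by rewrite sum_distr; apply: eq_bigr => j _; rewrite turn_minus snd_minus.
by rewrite /force; ring.
Qed.

Lemma force_rotated_continuous (x : state m) i t :
  continuous (fun t => force (fun j => turn t (x j)) i) t.
Proof.
have cf y : continuous f y by apply: locally_lipschitz_continuous.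
apply: (continuous_plus (fun t => - f (fst (turn t (x i))) * snd (turn t (x i)))).
  apply: continuous_times; last exact: continuous_turn_snd.
  apply: (continuous_opp (fun t => f (fst (turn t (x i))))).
  by apply: continuous_comp_all => //; apply: continuous_turn_fst.
apply: continuous_sum => j ji.
apply: (continuous_comp_all (gamma i j)).
  by move=> y; apply: locally_lipschitz_continuous; apply: gamma_lip; apply: neq_sym_prop.
by apply: (continuous_minus (fun t => snd (turn t (x j)))); apply: continuous_turn_snd.
Qed.

Section Flow.

Variables (omega t0 : R) (b : Rbar) (x : R -> state m).
Hypothesis omega_gt0 : 0 < omega.
Hypothesis sol : solution (fun y t => lienard f gamma y omega t) t0 b x.

Let D s := t0 <= s /\ Rbar_lt s b.

Lemma sol_continuous_on i : continuous_on D (fun s => x s i).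
Proof. by case: (sol i). Qed.

(** In the frame rotating with angular velocity [omega] only the force is felt. *)
Lemma rotating_frame_derive t (w : plane) i s : t0 < s -> Rbar_lt s b ->
  is_derive (fun s => dot (turn (omega * (s - t)) w) (x s i)) s
    (snd (turn (omega * (s - t)) w) * force (x s) i).
Proof.
move=> hs sb; have [_ /(_ s hs sb)] := sol i; rewrite lienard_force => d.
have d1 := is_derive_fst _ _ _ d; have d2 := is_derive_snd _ _ _ d.
rewrite /= in d1 d2.
have lin : is_derive (fun s => omega * (s - t)) s omega by auto_derive => //; ring.
have e1 : is_derive (fun s => fst (turn (omega * (s - t)) w) : R) s (omega * snd (turn (omega * (s - t)) w)).
  by apply: (is_derive_comp (fun u => fst (turn u w) : R)) lin; apply: is_derive_turn_fst.
have e2 : is_derive (fun s => snd (turn (omega * (s - t)) w) : R) s (omega * - fst (turn (omega * (s - t)) w)).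
  by apply: (is_derive_comp (fun u => snd (turn u w) : R)) lin; apply: is_derive_turn_snd.
set a := fst (turn _ w) in e2 *; set c := snd (turn _ w) in e1 e2 *.
have := is_derive_plus _ _ _ _ _
  (is_derive_mult _ _ _ _ _ e1 d1 Rmult_comm) (is_derive_mult _ _ _ _ _ e2 d2 Rmult_comm).
rewrite /plus /mult /= -/a -/c => H.
suff <- : omega * c * fst (x s i) + a * (omega * snd (x s i))
    + (omega * - a * snd (x s i) + c * (- omega * fst (x s i) + force (x s) i))
    = c * force (x s) i by exact: H.
ring.
Qed.

Lemma frame_functional t (w : plane) i s :
  dot (turn (omega * (s - t)) w) (x s i) = dot w (turn (- (omega * (s - t))) (x s i)).
Proof. by rewrite -(dot_turn (- (omega * (s - t)))) turn_opp_turn. Qed.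

Lemma frame_functional_continuous t (w : plane) i :
  continuous_on D (fun s => dot (turn (omega * (s - t)) w) (x s i)).
Proof.
move=> s Ds P [e he].
have w1 : 0 < norm w + 1 by have := norm_pos w; lra.
have e2 : 0 < e / 2 by have := cond_pos e; lra.
have ew : 0 < e / 2 / (norm w + 1) by apply: Rdiv_lt_0_compat.
have [d1 [d10 hd1]] := curve_continuous_on D _ (sol_continuous_on i) s _ Ds ew.
have : continuous (fun s' => dot (turn (omega * (s' - t)) w) (x s i)) s.
  by apply: ex_derive_continuous; rewrite /dot /turn /=; auto_derive.
move=> /(_ _ (locally_ball _ (mkposreal _ e2))) [d2 hd2].
exists (mkposreal (Rmin d1 d2) (Rmin_case _ _ (fun r => 0 < r) d10 (cond_pos d2))).
move=> s' hs' Ds'; apply: he.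
have b1 : Rabs (s' - s) < d1 by apply: Rlt_le_trans hs' (Rmin_l _ _).
have := hd2 s' (Rlt_le_trans _ _ _ hs' (Rmin_r _ _)).
rewrite /ball /= /AbsRing_ball /abs /minus /plus /opp /= => h2.
have h1 := dot_norm (turn (omega * (s' - t)) w) (minus (x s' i) (x s i)).
rewrite dot_minus norm_turn in h1.
have h3 : norm w * norm (minus (x s' i) (x s i)) < e / 2.
  have h4 := Rmult_lt_compat_l _ _ _ w1 (hd1 s' Ds' b1).
  move: h4; rewrite (_ : (norm w + 1) * (e / 2 / (norm w + 1)) = e / 2); last by field; lra.
  by have := norm_pos (minus (x s' i) (x s i)); lra.
have := Rabs_triang (dot (turn (omega * (s' - t)) w) (x s' i) - dot (turn (omega * (s' - t)) w) (x s i))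
  (dot (turn (omega * (s' - t)) w) (x s i) + - dot (turn (omega * (s - t)) w) (x s i)).
rewrite (_ : _ - _ + (_ + - _) = dot (turn (omega * (s' - t)) w) (x s' i)
             + - dot (turn (omega * (s - t)) w) (x s i)); last ring.
by move=> h5; apply: Rle_lt_trans h5 _; lra.
Qed.

Lemma continuous_on_sub {U : UniformSpace} (E E' : R -> Prop) (g : R -> U) :
  (forall s, E' s -> E s) -> continuous_on E g -> continuous_on E' g.
Proof.
move=> sub cont s Es P hP; have [e he] := cont s (sub s Es) P hP.
by exists e => y hy Ey; apply: he => //; apply: sub.
Qed.

Lemma continuous_on_minus (E : R -> Prop) (g h : R -> R) :
  continuous_on E g -> (forall s, continuous h s) -> continuous_on E (fun s => g s - h s).
Proof.
move=> cg ch s Es.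
have co : filterlim (fun u => opp (h u)) (within E (locally s)) (locally (opp (h s))).
  by move=> P hP; have [e he] := continuous_opp h s (ch s) P hP; exists e => y hy _; apply: he.
exact: (filterlim_comp_2 g (fun u => opp (h u)) plus (cg s Es) co (filterlim_plus (g s) (opp (h s)))).
Qed.

Lemma frame_displacement M F t s : 0 <= F ->
  (forall y, box (M + 1) y -> forall i, Rabs (force y i) <= F) ->
  t0 <= t <= s -> Rbar_lt s b -> (forall y, t <= y <= s -> norms_le m (M + 1) (x y)) ->
  forall i, norm (minus (turn (- (omega * (s - t))) (x s i)) (x t i)) <= F * (s - t).
Proof.
move=> F0 hF ts sb hM i.
have [w [w1 <-]] := norm_dual (minus (turn (- (omega * (s - t))) (x s i)) (x t i)).
rewrite dot_minus -frame_functional.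
have e : dot w (x t i) = dot (turn (omega * (t - t)) w) (x t i).
  by rewrite Rminus_diag Rmult_0_r turn_0.
rewrite e; apply: Rle_trans (Rle_abs _) _.
apply: (increment_bound (fun s => dot (turn (omega * (s - t)) w) (x s i))
  (fun s => snd (turn (omega * (s - t)) w) * force (x s) i)); first lra.
  apply: continuous_on_sub (frame_functional_continuous t w i) => u hu; split; first lra.
  by apply: Rbar_le_lt_trans sb; rewrite /=; lra.
move=> u hu; split.
  apply: rotating_frame_derive; first lra.
  by apply: Rbar_le_lt_trans sb; rewrite /=; lra.
have h1 := turn_snd_bound (omega * (u - t)) w; rewrite w1 in h1.
have h2 := hF (x u) (box_norms_le _ _ (hM u ltac:(lra))) i.
rewrite Rabs_mult -(Rmult_1_l F).
by apply: Rmult_le_compat => //; apply: Rabs_pos.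
Qed.

(** The force is bounded only as long as the state is, so the bound on the state
    has to be carried along in time. *)
Lemma short_time M F t s1 : 0 <= F ->
  (forall y, box (M + 1) y -> forall i, Rabs (force y i) <= F) ->
  t0 <= t <= s1 -> Rbar_lt s1 b -> norms_le m M (x t) -> F * (s1 - t) <= / 2 ->
  forall s, t <= s <= s1 -> norms_le m (M + 1) (x s).
Proof.
move=> F0 hF ts sb hM Fs.
have inD u : t <= u <= s1 -> D u.
  by move=> hu; split; [lra | apply: Rbar_le_lt_trans sb; rewrite /=; lra].
have near u e : t <= u <= s1 -> 0 < e -> exists d, 0 < d /\ forall v, t <= v <= s1 ->
    Rabs (v - u) < d -> forall i, norm (minus (x v i) (x u i)) < e.
  move=> hu e0.
  have [||d [d0 hd]] := @fin_small 'I_m (fun i d => forall v, t <= v <= s1 ->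
    Rabs (v - u) < d -> norm (minus (x v i) (x u i)) < e).
  - by move=> i d d' hd h v hv vu; apply: h => //; lra.
  - move=> i; have [d [d0 hd]] := curve_continuous_on D _ (sol_continuous_on i) u e (inD u hu) e0.
    by exists d; split=> // v hv; apply: hd; apply: inD.
  by exists d; split=> // v hv vu i; apply: hd.
apply: real_induction.
- by move=> i; have := hM i; lra.
- move=> u hu before; have [d [d0 hd]] := near u (/ 2) ltac:(lra) ltac:(lra).
  exists d; split=> // v hv vs i.
  have h1 := hd v ltac:(lra) ltac:(rewrite Rabs_pos_eq; lra) i.
  have h2 := frame_displacement M F t u F0 hF ltac:(lra) (proj2 (inD u ltac:(lra))) before i.
  have h3 := norm_triangle_minus (turn (- (omega * (u - t))) (x u i)) (x t i).
  have h4 := norm_triangle_minus (x v i) (x u i).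
  rewrite norm_turn in h3; have h5 := hM i.
  have h6 : F * (u - t) <= F * (s1 - t) by apply: Rmult_le_compat_l; lra.
  lra.
move=> u hu before i; case: (Rle_lt_dec (norm (x u i)) (M + 1)) => // big; exfalso.
have [d [d0 hd]] := near u (norm (x u i) - (M + 1)) ltac:(lra) ltac:(lra).
pose v := Rmax t (u - d / 2).
have hv : t <= v < u by rewrite /v; case: (Rmax_spec t (u - d / 2)) => -[? ->]; lra.
have hv' : u - d / 2 <= v by apply: Rmax_r.
have h1 := hd v ltac:(lra) ltac:(rewrite Rabs_left1; lra) i.
have h2 := norm_triangle_minus (x u i) (x v i).
rewrite norm_minus_sym in h1; have := before v hv i; lra.
Qed.

(** Over one period the force is compared with its value along the unperturbed
    motion, whose displacement error is itself of the order of the period. The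
    frame is back at its initial position after one period, hence the recursion
    concerns the states themselves. *)
Lemma period_step M F L T t : 0 <= F -> 0 <= L -> 0 < T -> omega * T = 2 * PI ->
  (forall y, box (M + 1) y -> forall i, Rabs (force y i) <= F) ->
  (forall y z e, box (M + 1) y -> box (M + 1) z ->
    (forall j, Rabs (fst (y j) - fst (z j)) <= e /\ Rabs (snd (y j) - snd (z j)) <= e) ->
    forall i, Rabs (force y i - force z i) <= L * e) ->
  t0 <= t -> Rbar_lt (t + T) b -> norms_le m M (x t) -> F * T <= / 2 ->
  avg_step m (damp f) mean_gain (L * F) T (x t) (x (t + T)).
Proof.
move=> F0 L0 T0 oT hF hL ht tb hM FT w i.
have hM1 := short_time M F t (t + T) F0 hF ltac:(lra) tb hM ltac:(rewrite (_ : t + T - t = T); lra).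
have sb s : s <= t + T -> Rbar_lt s b by move=> h; apply: Rbar_le_lt_trans tb; rewrite /=; lra.
pose y0 th := (fun j => turn th (x t j)) : state m.
pose G th := snd (turn th w) * force (y0 th) i.
have cG th : continuous G th.
  apply: continuous_times; first exact: continuous_turn_snd.
  exact: force_rotated_continuous.
(* In angular time [omega * (s - t)] one period is [2 * PI], whence the factor [1 / omega]. *)
pose psi s := RInt G 0 (omega * (s - t)) / omega.
have dpsi s : is_derive psi s (G (omega * (s - t))).
  rewrite (_ : G _ = scal omega (G (omega * (s - t))) * / omega); last first.
    by rewrite /scal /= /mult /=; field; lra.
  apply: (is_derive_ext (fun s => / omega * RInt G 0 (omega * (s - t)))).
    by move=> u; rewrite /psi /Rdiv Rmult_comm.
  rewrite Rmult_comm; apply: is_derive_scal.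
  apply: (is_derive_comp (fun u => RInt G 0 u)); first exact: primitive_derive.
  by auto_derive => //; ring.
have cpsi s : continuous psi s by apply: ex_derive_continuous; exists (G (omega * (s - t))).
have incr := increment_bound (fun s => dot (turn (omega * (s - t)) w) (x s i) - psi s)
  (fun s => snd (turn (omega * (s - t)) w) * force (x s) i - G (omega * (s - t)))
  t (t + T) (norm w * (L * (F * T))) ltac:(lra).
have {}incr := incr ltac:(apply: continuous_on_minus => //;
  apply: continuous_on_sub (frame_functional_continuous t w i) => u hu;
  split; [lra | apply: sb; lra]).
have bd s : t < s < t + T ->
    is_derive (fun s => dot (turn (omega * (s - t)) w) (x s i) - psi s) s
      (snd (turn (omega * (s - t)) w) * force (x s) i - G (omega * (s - t))) /\
    Rabs (snd (turn (omega * (s - t)) w) * force (x s) i - G (omega * (s - t)))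
      <= norm w * (L * (F * T)).
  move=> hs; split.
    apply: (is_derive_minus (fun s => dot (turn (omega * (s - t)) w) (x s i))) => //.
    by apply: rotating_frame_derive; [lra | apply: sb; lra].
  rewrite /G -Rmult_minus_distr_l Rabs_mult.
  apply: Rmult_le_compat; try exact: Rabs_pos; first exact: turn_snd_bound.
  apply: hL.
  - by apply: box_norms_le; apply: hM1; lra.
  - by apply: box_norms_le => j; rewrite norm_turn; have := hM j; lra.
  move=> j; set th := omega * (s - t).
  have h1 := frame_displacement M F t s F0 hF ltac:(lra) (sb s ltac:(lra))
    (fun y hy => hM1 y ltac:(lra)) j.
  have h2 : norm (minus (x s j) (turn th (x t j))) <= F * T.
    rewrite -(norm_turn (- th)) turn_minus turn_opp_turn.
    by apply: Rle_trans h1 _; apply: Rmult_le_compat_l; lra.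
  rewrite -fst_minus -snd_minus.
  by split; [apply: Rle_trans (fst_le_norm _) h2 | apply: Rle_trans (snd_le_norm _) h2].
have {incr bd} := incr bd.
have p0 : psi t = 0 by rewrite /psi Rminus_diag Rmult_0_r RInt_point /zero /= /Rdiv Rmult_0_l.
have e : omega * (t + T - t) = 2 * PI by rewrite -oT; ring.
have p1 : psi (t + T) = T * drift m (damp f) mean_gain (x t) w i.
  rewrite -force_rotated_mean /psi e /circle_mean -/(y0 _) -oT.
  by rewrite -/G; field; lra.
rewrite p0 p1 e turn_2PI Rminus_diag Rmult_0_r turn_0.
rewrite (_ : t + T - t = T); last ring.
by move=> h; apply: Rle_trans (Rle_trans _ _ _ _ h) _; right; [congr Rabs; ring | ring].
Qed.

End Flow.

(** * Existence of solutions *)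

(** Clipping every coordinate makes the field bounded and globally Lipschitz. The a
    priori bound keeps the solution in the region where clipping has no effect. *)
Lemma solution_exists M omega t0 (x0 : state m) : 0 <= M -> norms_le m M x0 ->
  (forall b x, solution (fun y t => lienard f gamma y omega t) t0 b x -> x t0 = x0 ->
     forall t, t0 <= t -> Rbar_lt t b -> norms_le m M (x t)) ->
  exists x, solution (fun y t => lienard f gamma y omega t) t0 p_infty x /\ x t0 = x0.
Proof.
move=> M0 hx0 apriori; set M1 := M + 1.
have M10 : - M1 <= M1 by rewrite /M1; lra.
pose cl c := Rmax (- M1) (Rmin M1 c).
have cl_in c : Rabs (cl c) <= M1 by apply/Rabs_le; apply: clamp_in.
have cl_lip c d : Rabs (cl c - cl d) <= Rabs (c - d) by apply: clamp_contraction.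
have cl_id c : Rabs c <= M1 -> cl c = c.
  by move=> h; apply: clamp_id; apply/Rabs_le_between.
pose st (y : 'I_m * bool -> R) : state m := fun i => ((y (i, false), y (i, true)) : plane).
pose cs (z : state m) : state m := fun i => ((cl (fst (z i)), cl (snd (z i))) : plane).
have cs_box z : box M1 (cs z) by move=> i; split; apply: cl_in.
have [F [F0 hF]] := force_bound M1 ltac:(rewrite /M1; lra).
have [L [L0 hL]] := force_lip M1 ltac:(rewrite /M1; lra).
pose g (y : 'I_m * bool -> R) (k : 'I_m * bool) : R :=
  if k.2 then - omega * cl (y (k.1, false)) + force (cs (st y)) k.1
  else omega * cl (y (k.1, true)).
have g_bound y k : Rabs (g y k) <= Rabs omega * M1 + F.
  have ow := Rabs_pos omega.
  have h c : Rabs omega * Rabs (cl c) <= Rabs omega * M1 by apply: Rmult_le_compat_l.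
  case: k => i [] /=; rewrite /g /=; last by rewrite Rabs_mult; have := h (y (i, true)); lra.
  apply: Rle_trans (Rabs_triang _ _) _; rewrite Rabs_mult Rabs_Ropp.
  by have := h (y (i, false)); have := hF _ (cs_box (st y)) i; lra.
have g_lip y z e : (forall k, Rabs (y k - z k) <= e) ->
    forall k, Rabs (g y k - g z k) <= (Rabs omega + L + 1) * e.
  move=> he; have ow := Rabs_pos omega.
  move=> k0; have e0 : 0 <= e by apply: Rle_trans (he k0); apply: Rabs_pos.
  have hc k : Rabs (cl (y k) - cl (z k)) <= e by apply: Rle_trans (cl_lip _ _) (he k).
  have h k : Rabs omega * Rabs (cl (y k) - cl (z k)) <= Rabs omega * e.
    by apply: Rmult_le_compat_l.
  have Le : 0 <= L * e by apply: Rmult_le_pos.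
  case: k0 => i [] /=; rewrite /g /=.
    rewrite (_ : _ - _ = - omega * (cl (y (i, false)) - cl (z (i, false)))
      + (force (cs (st y)) i - force (cs (st z)) i)); last ring.
    apply: Rle_trans (Rabs_triang _ _) _; rewrite Rabs_mult Rabs_Ropp.
    have := hL _ _ e (cs_box (st y)) (cs_box (st z)) (fun j => conj (hc (j, false)) (hc (j, true))) i.
    by have := h (i, false); lra.
  rewrite -Rmult_minus_distr_l Rabs_mult.
  by have := h (i, true); lra.
pose y0 (k : 'I_m * bool) : R := if k.2 then snd (x0 k.1) else fst (x0 k.1).
have Lp : 0 < Rabs omega + L + 1 by have := Rabs_pos omega; lra.
have [X [X0 [Xc Xd]]] := picard_forward_solution _ g _ _ y0 Lp g_bound g_lip.
pose x t : state m := st (X (t - t0)).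
have x_t0 : x t0 = x0.
  apply: FunctionalExtensionality.functional_extensionality => i.
  by apply: plane_eq; rewrite /x /st /= Rminus_diag X0.
have shift s : continuous (fun s => s - t0) s by apply: ex_derive_continuous; auto_derive.
have Xc' t k : continuous (fun s => X (s - t0) k) t.
  by apply: (continuous_comp (fun s => s - t0) (fun s => X s k)).
have Xd' t k : t0 < t -> is_derive (fun s => X (s - t0) k) t (g (X (t - t0)) k).
  move=> ht; rewrite -(Rmult_1_l (g _ _)).
  apply: (is_derive_comp (fun s => X s k)); first by apply: Xd; lra.
  by auto_derive => //; ring.
have xc i t : continuous (fun s => x s i) t.
  exact: filterlim_pair_plane (Xc' t (i, false)) (Xc' t (i, true)).
have x_sol b : (forall t, t0 <= t -> Rbar_lt t b -> norms_le m M1 (x t)) ->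
    solution (fun y t => lienard f gamma y omega t) t0 b x.
  move=> hb i; split.
    by move=> t _ P hP; have [e he] := xc i t P hP; exists e => y hy _; apply: he.
  move=> t ht tb; have hM := box_norms_le _ _ (hb t (Rlt_le _ _ ht) tb).
  have csE : cs (x t) = x t.
    apply: FunctionalExtensionality.functional_extensionality => j.
    by have [h1 h2] := hM j; apply: plane_eq; apply: cl_id.
  have [h1 h2] := hM i; rewrite lienard_force.
  apply: is_derive_plane.
    have := Xd' t (i, false) ht; rewrite /g /= cl_id //.
  have := Xd' t (i, true) ht; rewrite /g /= cl_id //.
  by rewrite -/(x t) csE.
have all_M t : t0 <= t -> norms_le m M (x t).
  move=> ht; apply: (real_induction t0 t (fun s => norms_le m M (x s))); last lra.
  - by rewrite x_t0.
  - move=> s hs before.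
    have [||d [d0 hd]] := @fin_small 'I_m (fun i d => forall v,
      Rabs (v - s) < d -> norm (minus (x v i) (x s i)) < 1).
    + by move=> i d d' hd h v vs; apply: h; lra.
    + move=> i; have [d hd] := xc i s _ (locally_ball_norm (x s i) (mkposreal 1 Rlt_0_1)).
      by exists d; split; [apply: cond_pos | move=> v hv; apply: hd].
    exists d; split=> // y hy _.
    apply: (apriori (Finite (s + d)) x) => //; [|lra|rewrite /=; lra].
    apply: x_sol => v hv vs i; case: (Rle_lt_dec v s) => hvs.
      by have := before v ltac:(lra) i; rewrite /M1; lra.
    have h1 := hd i v ltac:(move: vs; rewrite /= => vs; rewrite Rabs_pos_eq; lra).
    have h2 := norm_triangle_minus (x v i) (x s i).
    by have := before s ltac:(lra) i; rewrite /M1; lra.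
  - move=> s hs before i; case: (Rle_lt_dec (norm (x s i)) M) => // big; exfalso.
    have e0 : 0 < norm (x s i) - M by lra.
    have [d hd] := xc i s _ (locally_ball_norm (x s i) (mkposreal _ e0)).
    pose v := Rmax t0 (s - d / 2); have d0 := cond_pos d.
    have hv : t0 <= v < s by rewrite /v; case: (Rmax_spec t0 (s - d / 2)) => -[? ->]; lra.
    have hv' : s - d / 2 <= v by apply: Rmax_r.
    have h1 : norm (minus (x v i) (x s i)) < norm (x s i) - M.
      by apply: hd; rewrite /ball /= /AbsRing_ball /abs /minus /plus /opp /= Rabs_left1; lra.
    have h2 := norm_triangle_minus (x s i) (x v i).
    by rewrite norm_minus_sym in h1; have := before v hv i; lra.
exists x; split=> //; apply: x_sol => t ht _ i.
by have := all_M t ht i; rewrite /M1; lra.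
Qed.

End Array.

(** * Distances to the two target sets *)

Lemma norm_le_state_norm (m : nat) (x : state m) i : norm (x i) <= state_norm x.
Proof.
rewrite -(sqrt_square (norm (x i))); last exact: norm_pos.
apply: sqrt_le_1_alt.
have := @sum_ge_term _ xpredT (fun j => norm (x j) ^ 2) i isT (fun j _ => pow2_ge_0 _).
by rewrite /=; lra.
Qed.

Lemma state_norm_le (m : nat) (x : state m) e : 0 <= e -> (forall i, norm (x i) <= e) ->
  state_norm x <= INR m * e.
Proof.
move=> e0 h; have me : 0 <= INR m * e by apply: Rmult_le_pos => //; apply: pos_INR.
rewrite -(sqrt_square (INR m * e)) //; apply: sqrt_le_1_alt.
apply: (Rle_trans _ (\big[Rplus/0]_(i < m) (e * e))).
  by apply: sum_le => i _; have := norm_pos (x i); have := h i; rewrite /=; nra.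
rewrite sum_const; case: m {x h} me => [|m] me; first by rewrite /=; lra.
have : 1 <= INR m.+1 by apply: (le_INR 1); lia.
by nra.
Qed.

Lemma state_dist_ge0 (m : nat) (x y : state m) : 0 <= state_dist x y.
Proof. exact: sqrt_pos. Qed.

Lemma dist_set_glb (m : nat) (S : state m -> Prop) x : (exists y, S y) ->
  (forall y, S y -> dist_set S x <= state_dist x y) /\
  (forall r, (forall y, S y -> r <= state_dist x y) -> r <= dist_set S x).
Proof.
move=> [y0 Sy0]; rewrite /dist_set; set E := fun d => _.
have [lb glb] := Glb_Rbar_correct E.
have fin : is_finite (Glb_Rbar E).
  have h1 := lb (state_dist x y0) (ex_intro _ y0 (conj Sy0 erefl)).
  have h2 := glb (Finite 0) ltac:(move=> d [y [_ ->]]; apply: state_dist_ge0).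
  by move: h1 h2; case: (Glb_Rbar E).
split=> [y Sy | r hr].
  have := lb (state_dist x y) (ex_intro _ y (conj Sy erefl)).
  by rewrite -fin.
have := glb (Finite r) ltac:(move=> d [y [Sy ->]]; exact: hr).
by rewrite -fin.
Qed.

Lemma dist_set_approx (m : nat) (S : state m -> Prop) x e : (exists y, S y) ->
  dist_set S x < e -> exists y, S y /\ state_dist x y < e.
Proof.
move=> ne lt; apply: Classical_Prop.NNPP => no.
have [_ glb] := dist_set_glb m S x ne.
have := glb e; move=> H; have : e <= dist_set S x; last lra.
apply: H => y Sy; apply: Rnot_lt_le => h; apply: no; by exists y.
Qed.

Lemma norms_le_of_dist_B (m : nat) rho (x : state m) e : 0 <= rho ->
  dist_set (set_B rho) x <= e -> norms_le m (rho + e) x.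
Proof.
move=> r0 h i; apply: le_epsilon => d d0.
have ne : exists y : state m, set_B rho y.
  by exists (fun=> zero) => j; rewrite norm_zero.
have [y [Sy hy]] := dist_set_approx m _ x (e + d) ne ltac:(lra).
have h1 := norm_le_state_norm _ (fun i => minus (x i) (y i)) i.
have h2 := norm_triangle_minus (x i) (y i); have h3 := Sy i.
by rewrite /state_dist in hy; lra.
Qed.

(** At [z = 0] the quotient and the factor are 0, which gives the right point. *)
Lemma disk_projection rho e (z : plane) : 0 < rho -> 0 <= e -> norm z <= rho + e ->
  norm (scal (Rmin 1 (rho / norm z)) z) <= rho /\
  norm (minus z (scal (Rmin 1 (rho / norm z)) z)) <= e.
Proof.
move=> r0 e0 hz; set c := Rmin 1 (rho / norm z).
have nz := norm_pos z.
have c1 : c <= 1 by apply: Rmin_l.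
have c0 : 0 <= c.
  apply: Rmin_case; first lra.
  case: (Rle_lt_or_eq_dec _ _ nz) => [lt | <-]; last by rewrite /Rdiv Rinv_0; lra.
  by apply: Rlt_le; apply: Rdiv_lt_0_compat.
have -> : minus z (scal c z) = scal (1 - c) z.
  by apply: plane_eq; rewrite /minus /plus /opp /scal /= /prod_scal /plus /opp /scal /= /mult /=; ring.
rewrite !norm_scal_nonneg; try lra.
have [[lt e1] | [lt e1]] := Rmin_spec 1 (rho / norm z); rewrite -/c in e1; rewrite e1.
  split; last lra.
  case: (Rle_lt_or_eq_dec _ _ nz) => [lz | <-]; last lra.
  have := Rmult_le_compat_r (norm z) _ _ nz lt.
  by rewrite (_ : rho / norm z * norm z = rho); [lra | field; lra].
case: (Rle_lt_or_eq_dec _ _ nz) => [lz | <-]; last lra.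
have e2 : rho / norm z * norm z = rho by field; lra.
lra.
Qed.

Lemma dist_B_of_norms_le (m : nat) rho (x : state m) e : 0 < rho -> 0 <= e ->
  norms_le m (rho + e) x -> dist_set (set_B rho) x <= INR m * e.
Proof.
move=> r0 e0 hx; pose y : state m := fun i => scal (Rmin 1 (rho / norm (x i))) (x i).
have Sy : set_B rho y by move=> i; case: (disk_projection rho e (x i) r0 e0 (hx i)).
have [lb _] := dist_set_glb m (set_B rho) x (ex_intro _ y Sy).
apply: Rle_trans (lb y Sy) _; apply: state_norm_le => // i.
by case: (disk_projection rho e (x i) r0 e0 (hx i)).
Qed.

Lemma set_R_nonempty (m : nat) rho : 0 <= rho -> exists y : state m, set_R rho y.
Proof.
move=> r0; exists (fun=> ((rho, 0) : plane)) => i j; split=> //.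
by rewrite norm_plane /dot /= (_ : _ + _ = rho * rho) ?sqrt_square //; ring.
Qed.

Lemma near_orbit_of_dist_R (m : nat) rho (x : state m) (i0 : 'I_m) e e' : 0 < rho -> e < e' ->
  dist_set (set_R rho) x <= e -> near_orbit m rho e' x.
Proof.
move=> r0 ee h.
have [y [Sy hy]] := dist_set_approx m _ x e' (set_R_nonempty m rho (Rlt_le _ _ r0)) ltac:(lra).
have sy : scal rho (scal (/ rho) (y i0)) = y i0.
  rewrite scal_assoc (_ : mult rho (/ rho) = 1) ?scal_one //.
  by rewrite /mult /=; field; lra.
exists (scal (/ rho) (y i0)); split.
  have ir : 0 < / rho by apply: Rinv_0_lt_compat.
  by have [_ n1] := Sy i0 i0; rewrite norm_scal_nonneg ?n1; [field; lra | lra].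
move=> i; rewrite sy; have [-> _] := Sy i0 i.
have h1 := norm_le_state_norm _ (fun i => minus (x i) (y i)) i.
by rewrite /state_dist in hy; lra.
Qed.

Lemma dist_R_of_near_orbit (m : nat) rho (x : state m) e : 0 < rho -> 0 <= e ->
  near_orbit m rho e x -> dist_set (set_R rho) x <= INR m * e.
Proof.
move=> r0 e0 [u [u1 hu]]; pose y : state m := fun=> scal rho u.
have Sy : set_R rho y.
  by move=> i j; split=> //; rewrite norm_scal_nonneg ?u1; lra.
have [lb _] := dist_set_glb m (set_R rho) x (ex_intro _ y Sy).
exact: Rle_trans (lb y Sy) (state_norm_le _ _ _ e0 hu).
Qed.

(** * Separation of a compact convex set from the origin *)

Lemma open_norm_gt r : open (fun z : plane => r < norm z).
Proof.
move=> z hz; have e0 : 0 < norm z - r by lra.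
apply: filter_imp (locally_ball_norm z (mkposreal _ e0)) => y hy.
have := norm_triangle_minus z y; rewrite norm_minus_sym.
by rewrite /ball_norm /= in hy; lra.
Qed.

Lemma open_norm_lt r : open (fun z : plane => norm z < r).
Proof.
move=> z hz; have e0 : 0 < r - norm z by lra.
apply: filter_imp (locally_ball_norm z (mkposreal _ e0)) => y hy.
have := norm_triangle_minus y z.
by rewrite /ball_norm /= in hy; lra.
Qed.

Lemma compact_bounded (D : plane -> Prop) : compact_set D ->
  exists M, forall z, D z -> norm z <= M.
Proof.
move=> comp; have [|z Dz|l hl] := comp nat (fun n z => norm z < INR n).
- by move=> n; apply: open_norm_lt.
- have [n [_ hn]] := nfloor_ex (norm z) (norm_pos z); exists n.+1; rewrite S_INR; exact: hn.
have [M hM] : exists M, forall n, List.In n l -> INR n <= M.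
  elim: l {hl} => [|n l [M hM]]; first by exists 0.
  exists (Rmax (INR n) M) => k /= [<- | hk]; first exact: Rmax_l.
  by apply: Rle_trans (hM k hk) (Rmax_r _ _).
by exists M => z /hl [n [hn lt]]; have := hM n hn; lra.
Qed.

(** Were the norm not minimal anywhere on [D], the regions [|z| > |j|], for [j]
    in [D], would cover [D] without a finite subcover. *)
Lemma compact_min_norm (D : plane -> Prop) : compact_set D -> (exists z, D z) ->
  exists z, D z /\ forall y, D y -> norm z <= norm y.
Proof.
move=> comp [z0 Dz0]; apply: Classical_Prop.NNPP => no.
have lower z : D z -> exists y, D y /\ norm y < norm z.
  move=> Dz; apply: Classical_Prop.NNPP => none; apply: no; exists z; split=> // y Dy.
  by apply: Rnot_lt_le => lt; apply: none; exists y.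
have [|z Dz|l hl] := comp {z | D z} (fun j z => norm (proj1_sig j) < norm z).
- by move=> j; apply: open_norm_gt.
- by have [y [Dy lt]] := lower z Dz; exists (exist _ y Dy).
have [j [Dj hj]] : exists z, D z /\ forall k, List.In k l -> norm z <= norm (proj1_sig k).
  elim: l {hl} => [|k l [j [Dj hj]]]; first by exists z0.
  case: (Rle_lt_dec (norm j) (norm (proj1_sig k))) => h.
    by exists j; split=> // i /= [<- | ] //; apply: hj.
  exists (proj1_sig k); split; first exact: (proj2_sig k).
  by move=> i /= [<- | hi]; [apply: Rle_refl | apply: Rle_trans (Rlt_le _ _ h) (hj i hi)].
by have [k [hk lt]] := hl j Dj; apply: (Rlt_irrefl _ (Rle_lt_trans _ _ _ (hj k hk) lt)).
Qed.

(** The point of [D] nearest to the origin gives the axis of a cone containing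
    [D]. *)
Lemma separation (D : plane -> Prop) : compact_set D -> convex_set D -> ~ D (0, 0) ->
  exists u c M, norm u = 1 /\ 0 < c /\ 0 <= M /\
    forall z, D z -> c <= dot u z /\ norm z <= M.
Proof.
move=> comp conv no0; have [M hM] := compact_bounded D comp.
case: (Classical_Prop.classic (exists z, D z)) => [ne | empty]; last first.
  exists ((1, 0) : plane), 1, 0; split.
    by rewrite norm_plane /dot /= (_ : _ + _ = 1) ?sqrt_1 //; ring.
  do 2 (split; first lra); move=> z Dz; case: empty; by exists z.
have [p [Dp hp]] := compact_min_norm D comp ne.
have M0 : 0 <= M by apply: Rle_trans (norm_pos p) (hM p Dp).
have np : 0 < norm p.
  case: (Rle_lt_or_eq_dec _ _ (norm_pos p)) => // e; case: no0.
  have := norm_sq p; rewrite -e Rmult_0_l => /esym /dot_self_eq0 [h1 h2].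
  by rewrite (_ : ((0, 0) : plane) = p) //; apply: plane_eq.
have half z : D z -> dot p p <= dot p z.
  move=> Dz; apply: Rnot_lt_le => lt.
  set a := dot p p - dot p z; have a0 : 0 < a by rewrite /a; lra.
  set q := dot (minus z p) (minus z p); have q0 : 0 <= q by apply: dot_self_ge0.
  (* Moving from [p] towards [z] by this fraction would decrease the norm. *)
  pose l := Rmin 1 (a / (q + 1)).
  have aq : 0 < a / (q + 1) by apply: Rdiv_lt_0_compat; lra.
  have l0 : 0 < l by apply: Rmin_case; lra.
  have l1 : l <= 1 by apply: Rmin_l.
  have lq : l * (q + 1) <= a.
    have := Rmult_le_compat_r (q + 1) _ _ ltac:(lra) (Rmin_r 1 (a / (q + 1))).
    by rewrite -/l (_ : a / (q + 1) * (q + 1) = a) //; field; lra.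
  have := hp _ (conv z p l Dz Dp ltac:(lra) l1); set y := plus _ _ => hy.
  have : dot p p <= dot y y by rewrite -!norm_sq; have := norm_pos y; nra.
  have -> : dot y y = dot p p - 2 * l * a + l * l * q.
    rewrite /q /a /dot fst_minus snd_minus /y /plus /scal /= /prod_scal /plus /scal /= /mult /=; ring.
  by nra.
exists (scal (/ norm p) p), (norm p), M.
have ip : 0 < / norm p by apply: Rinv_0_lt_compat.
split; first by rewrite norm_scal_nonneg; [field; lra | lra].
do 2 (split; first lra); move=> z Dz; split; last exact: hM.
rewrite dot_scal_l.
have := half z Dz; rewrite -norm_sq => h.
apply: (Rmult_le_reg_l (norm p)) => //; rewrite -Rmult_assoc Rinv_r; lra.
Qed.

(** * From the recursion to the flow *)

Section Flow.

Variables (m : nat) (f : R -> R) (gamma : 'I_m -> 'I_m -> R -> R) (rho : R) (root : 'I_m).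
Hypotheses (f_lip : locally_lipschitz f) (f_L1 : cond_L1 f) (f_L2 : cond_L2 f).
Hypothesis gamma_int : interconnection gamma.
Hypothesis connected : forall i, i <> root -> clos_trans 'I_m (edge gamma) i root.
Hypothesis gamma_lip : forall i j, i <> j -> locally_lipschitz (gamma i j).
Hypotheses (rho_gt0 : 0 < rho) (kappa_rho : kappa f rho = 0).

Lemma gamma_at0 i j : i <> j -> gamma i j 0 = 0.
Proof. by move=> ne; have [[]] := gamma_int i j ne. Qed.

Lemma gamma_sign i j : i <> j -> forall s, 0 <= s * gamma i j s.
Proof. by move=> ne; have [[]] := gamma_int i j ne. Qed.

Lemma gamma_continuous i j x : i <> j -> continuous (gamma i j) x.
Proof. by move=> ne; apply: locally_lipschitz_continuous; apply: gamma_lip. Qed.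

Lemma damp_bounded M : exists K, 0 <= K /\ forall z : plane, norm z <= M -> Rabs (damp f z) <= K.
Proof.
have [L [L0 hL]] := locally_lipschitz_segment f M f_lip.
have K0 : 0 <= Rabs (f 0) + L * Rabs M.
  by have := Rabs_pos (f 0); have := Rmult_le_pos _ _ L0 (Rabs_pos M); lra.
exists (Rabs (f 0) + L * Rabs M); split=> // z zM.
apply: (damp_bounds f M) => // [x | x hx]; first exact: locally_lipschitz_continuous.
have := hL x 0 hx ltac:(lra); rewrite Rminus_0_r.
have : L * Rabs x <= L * Rabs M by apply: Rmult_le_compat_l => //; split_Rabs; lra.
by have := Rabs_triang_inv (f x) (f 0); lra.
Qed.

Lemma gain_bounded M : exists A, 0 <= A /\ forall (i j : 'I_m) (z : plane),
  j != i -> norm z <= 2 * M -> 0 <= mean_gain m gamma i j z <= A.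
Proof.
have [||A [A0 hA]] := @fin_large ('I_m * 'I_m)%type
  (fun ij A => ij.2 != ij.1 -> forall z : plane, norm z <= 2 * M ->
     0 <= mean_gain m gamma ij.1 ij.2 z <= A).
- by move=> ij a b ab h ne z hz; have := h ne z hz; lra.
- move=> [i j] /=; case E: (j != i); last by exists 0.
  have ne := neq_sym_prop m i j E.
  have [L [L0 hL]] := locally_lipschitz_segment (gamma i j) (2 * M) (gamma_lip i j ne).
  exists L => _ z hz; apply: (gain_bounds (gamma i j) (2 * M)) => //.
  + by move=> x; apply: gamma_continuous.
  + exact: gamma_at0.
  + exact: gamma_sign.
by exists A; split=> // i j z ji hz; apply: (hA (i, j) ji z hz).
Qed.

Lemma edge_neq i j : edge gamma i j -> j != i.
Proof. by move=> [ne _]; apply/eqP => e; apply: ne. Qed.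

(** In [gain_lower] the numerator increases with the norm and the denominator is
    bounded, hence a bound that is uniform on an annulus. *)
Lemma gain_pos M i j c : 0 < M -> edge gamma i j -> 0 < c -> exists b, 0 < b /\
  forall z : plane, c <= norm z <= 2 * M -> b <= mean_gain m gamma i j z.
Proof.
move=> M0 [ne nz] c0; have [_ [z0 | [alpha [ka ha]]]] := gamma_int i j ne; first by case: nz.
have [_ [a0 ainc]] := ka.
have ac : 0 < alpha (c / 4) by rewrite -a0; apply: ainc; lra.
exists (alpha (c / 4) / (4 * (2 * M))); split; first by apply: Rdiv_lt_0_compat; lra.
move=> z hz; have zp : 0 < norm z by lra.
apply: Rle_trans (gain_lower (gamma i j) alpha z (fun x => gamma_continuous i j x ne)
  (gamma_sign i j ne) ka ha zp).
have mono : alpha (c / 4) <= alpha (norm z / 4).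
  case: (Rle_lt_or_eq_dec _ _ (proj1 hz)) => [lt | <-]; last exact: Rle_refl.
  by left; apply: ainc; lra.
apply: Rmult_le_compat; [lra | by apply: Rlt_le; apply: Rinv_0_lt_compat; lra | done |].
by apply: Rinv_le_contravar; lra.
Qed.

Let damping_pos eta : forall M, 0 < eta -> exists c, 0 < c /\
  forall z : plane, rho + eta <= norm z <= M -> c <= damp f z.
Proof.
move=> M e0; have [s0 [h1 [h2 [h3 [h4 [h5 h6]]]]]] := f_L2.
exact: (damp_pos f s0 f_lip h1 h2 h3 h5 rho rho_gt0 kappa_rho f_L1 eta M e0).
Qed.

Let damping_neg eta : 0 < eta -> exists c, 0 < c /\
  forall z : plane, eta <= norm z <= rho - eta -> damp f z <= - c.
Proof.
move=> e0; have [s0 [h1 [h2 [h3 [h4 [h5 h6]]]]]] := f_L2.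
exact: (damp_neg f s0 f_lip h1 h2 h3 h5 rho rho_gt0 kappa_rho f_L1 eta e0).
Qed.

Definition flow omega t0 b x :=
  solution (fun (y : state m) t => lienard f gamma y omega t) t0 b x.

(** [period_step] together with the displacement within the period, with one
    constant for both. *)
Lemma period_map M : 0 <= M -> exists C, 0 <= C /\ small (fun T =>
  forall omega t0 b x t, omega * T = 2 * PI -> flow omega t0 b x -> t0 <= t ->
  norms_le m M (x t) ->
  (forall s, t <= s <= t + T -> Rbar_lt s b ->
     forall i, norm (minus (turn (- (omega * (s - t))) (x s i)) (x t i)) <= C * T) /\
  (Rbar_lt (t + T) b ->
     avg_step m (damp f) (mean_gain m gamma) C T (x t) (x (t + T)))).
Proof.
move=> M0.
have [F [F0 hF]] := force_bound m f gamma f_lip gamma_lip gamma_at0 (M + 1) ltac:(lra).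
have [L [L0 hL]] := force_lip m f gamma f_lip gamma_lip (M + 1) ltac:(lra).
have LF : 0 <= L * F by apply: Rmult_le_pos.
exists (L * F + F); split; first lra.
move: (small_lin F (/ 2) ltac:(lra)); apply: small_imp.
move=> T T0 FT omega t0 b x t oT sol ht hx.
have o0 : 0 < omega by have := twoPI_gt0; nra.
split=> [s hs sb i | tb w i].
  have FTs : F * (s - t) <= F * T by apply: Rmult_le_compat_l; lra.
  have hM1 := short_time m f gamma omega t0 b x sol M F t s F0 hF ltac:(lra) sb hx ltac:(lra).
  apply: Rle_trans (frame_displacement m f gamma omega t0 b x sol M F t s F0 hF ltac:(lra) sb hM1 i) _.
  by have := Rmult_le_pos _ _ LF (Rlt_le _ _ T0); lra.
have := period_step m f gamma f_lip gamma_lip gamma_at0 omega t0 b x o0 sol M F L T t F0 L0 T0 oT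
  hF hL ht tb hx FT w i.
move=> h; apply: Rle_trans h _; apply: Rmult_le_compat_r; first exact: norm_pos.
by apply: Rmult_le_compat_r; [apply: pow2_ge_0 | lra].
Qed.

Lemma last_sample T t0 t : 0 < T -> t0 <= t ->
  exists k, t0 + INR k * T <= t < t0 + INR k * T + T.
Proof.
move=> T0 ht; have [k [h1 h2]] := nfloor_ex ((t - t0) / T) ltac:(apply: Rdiv_le_0_compat; lra).
exists k; have e : (t - t0) / T * T = t - t0 by field; lra.
have h3 := Rmult_le_compat_r T _ _ (Rlt_le _ _ T0) h1.
have h4 := Rmult_lt_compat_r T _ _ T0 h2.
by move: h3 h4; rewrite e /=; lra.
Qed.

Lemma Rbar_lt_le_trans_finite (s t : R) b : s <= t -> Rbar_lt t b -> Rbar_lt s b.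
Proof. by move=> st tb; apply: Rbar_le_lt_trans tb; rewrite /=. Qed.

Definition samples T t0 (x : R -> state m) (k : nat) : state m := x (t0 + INR k * T).

(** The samples of a solution form a run, whose norms sink towards [rho]; between
    samples the state is a rotated sample up to [eta]. *)
Lemma flow_run M eta : 0 < eta -> rho + eta <= M -> exists C c, 0 <= C /\ 0 < c /\ small (fun T =>
  C * T <= eta /\ forall omega t0 b x, omega * T = 2 * PI -> flow omega t0 b x ->
  forall V, V <= M -> norms_le m V (x t0) -> forall N, Rbar_lt (t0 + INR N * T) b ->
  run m (damp f) (mean_gain m gamma) M C T N (samples T t0 x) /\
  norms_le m (Rmax (V - INR N * T * c) (rho + eta)) (samples T t0 x N) /\
  forall t, t0 + INR N * T <= t <= t0 + INR N * T + T -> Rbar_lt t b ->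
    exists th, forall i, norm (minus (turn th (x t i)) (samples T t0 x N i)) <= eta).
Proof.
move=> e0 eM; have M0 : 0 <= M by lra.
have [C [C0 HC]] := period_map M M0.
have [K [K0 hK]] := damp_bounded M; have [A [A0 hA]] := gain_bounded M.
have [c [c0 Hc]] := norm_invariant m (damp f) (mean_gain m gamma) rho M K A C K0 A0 C0 rho_gt0
  hK (fun eta e0 => damping_pos eta M e0) hA eta e0.
exists C, c; split=> //; split=> //.
move: (small_and _ _ HC (small_and _ _ Hc (small_lin C eta e0))); apply: small_imp.
move=> T T0 [HCT [HcT CT]]; split=> // omega t0 b x oT sol V VM hV N Nb.
have x0 : norms_le m V (samples T t0 x 0) by rewrite /samples /= Rmult_0_l Rplus_0_r.
have x0M : norms_le m M (samples T t0 x 0) by move=> i; apply: Rle_trans (x0 i) VM.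
have time k : 0 <= INR k * T by apply: Rmult_le_pos; [apply: pos_INR | lra].
have step k : (k < N)%nat -> norms_le m M (samples T t0 x k) ->
    avg_step m (damp f) (mean_gain m gamma) C T (samples T t0 x k) (samples T t0 x k.+1).
  move=> kN hk; have tk := time k.
  have [_ h] := HCT omega t0 b x (t0 + INR k * T) oT sol ltac:(lra) hk.
  rewrite /samples S_INR (_ : t0 + (INR k + 1) * T = t0 + INR k * T + T); last ring.
  apply: h; apply: Rbar_lt_le_trans_finite Nb.
  have : INR k.+1 <= INR N by apply: le_INR; lia.
  by rewrite S_INR => h; have := Rmult_le_compat_r T _ _ (Rlt_le _ _ T0) h; lra.
have [rn bd] := HcT N (samples T t0 x) eM x0M step V VM x0.
split=> //; split; first exact: bd.
move=> t ht tb; have tN := time N.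
have hN : norms_le m M (x (t0 + INR N * T)) by case: rn => _ h; apply: (h N).
have [h _] := HCT omega t0 b x (t0 + INR N * T) oT sol ltac:(lra) hN.
exists (- (omega * (t - (t0 + INR N * T)))) => i.
by apply: Rle_trans (h t ltac:(lra) tb i) CT.
Qed.

Lemma norm_from_sample (x y : plane) th e : norm (minus (turn th x) y) <= e -> norm x <= norm y + e.
Proof. by have := norm_triangle_minus (turn th x) y; rewrite norm_turn; lra. Qed.

(** The orbit is invariant under rotations, so the free rotation between two
    samples does not count. *)
Lemma near_orbit_turn (z z' : state m) th e e' : near_orbit m rho e z ->
  (forall i, norm (minus (turn th (z' i)) (z i)) <= e') -> near_orbit m rho (e + e') z'.
Proof.
move=> [u [u1 hu]] hz; exists (turn (- th) u); split; first by rewrite norm_turn.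
move=> i; rewrite -(norm_turn th) turn_minus.
rewrite turn_scal turn_turn_opp.
have -> : minus (turn th (z' i)) (scal rho u)
    = plus (minus (turn th (z' i)) (z i)) (minus (z i) (scal rho u)).
  by rewrite -minus_trans.
by apply: Rle_trans (norm_triangle _ _) _; have := hu i; have := hz i; lra.
Qed.

Lemma flow_bound M eta : 0 < eta -> rho + eta <= M -> exists c, 0 < c /\ small (fun T =>
  forall omega t0 b x, omega * T = 2 * PI -> flow omega t0 b x ->
  forall V, V <= M -> norms_le m V (x t0) -> forall t, t0 <= t -> Rbar_lt t b ->
  norms_le m (Rmax (V - (t - t0 - T) * c) (rho + eta) + eta) (x t)
  /\ norms_le m (Rmax V (rho + eta) + eta) (x t)).
Proof.
move=> e0 eM; have [C [c [C0 [c0 H]]]] := flow_run M eta e0 eM; exists c; split=> //.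
move: H; apply: small_imp => T T0 [CT H] omega t0 b x oT sol V VM hV t ht tb.
have [k hk] := last_sample T t0 t T0 ht.
have kb : Rbar_lt (t0 + INR k * T) b by apply: Rbar_lt_le_trans_finite tb; lra.
have [_ [h1 h2]] := H omega t0 b x oT sol V VM hV k kb.
have [th h3] := h2 t ltac:(lra) tb.
have kT0 : 0 <= INR k * T by apply: Rmult_le_pos; [apply: pos_INR | lra].
have kc : (t - t0 - T) * c <= INR k * T * c by apply: Rmult_le_compat_r; lra.
have kc0 : 0 <= INR k * T * c by apply: Rmult_le_pos; lra.
split=> i; have h4 := norm_from_sample _ _ _ _ (h3 i); have := h1 i.
  have := Rle_max_compat_r (V - INR k * T * c) (V - (t - t0 - T) * c) (rho + eta) ltac:(lra); lra.
have := Rle_max_compat_r (V - INR k * T * c) V (rho + eta) ltac:(lra); lra.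
Qed.

Lemma flow_restart omega t0 t1 b x : t0 <= t1 -> flow omega t0 b x -> flow omega t1 b x.
Proof.
move=> le sol i; have [h1 h2] := sol i; split.
  by apply: continuous_on_sub h1 => s [h3 h4]; split=> //; lra.
by move=> t ht tb; apply: h2 => //; lra.
Qed.

Lemma flow_lock M eta s : rho < M -> rho + eta <= M -> tight rho eta s -> small (fun T =>
  forall omega t0 b x, omega * T = 2 * PI -> flow omega t0 b x ->
  norms_le m (rho + eta) (x t0) -> phase_locked m rho eta s (x t0) ->
  forall t, t0 <= t -> Rbar_lt t b -> near_orbit m rho (6 * eta) (x t)).
Proof.
move=> rM eM ti; have [e0 _] := ti.
have [C [c [C0 [c0 H]]]] := flow_run M eta e0 eM.
have [K [K0 hK]] := damp_bounded M; have [A [A0 hA]] := gain_bounded M.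
have M0 : 0 < M by lra.
have HL := phase_locked_near_orbit m (damp f) (mean_gain m gamma) (edge gamma) root rho M K A C
  K0 A0 C0 rho_gt0 rM hK damping_neg hA edge_neq (fun i j c => gain_pos M i j c M0) connected eta s ti.
move: (small_and _ _ H HL); apply: small_imp.
move=> T T0 [[CT {}H] {}HL] omega t0 b x oT sol hV lk t ht tb.
have [k hk] := last_sample T t0 t T0 ht.
have kb : Rbar_lt (t0 + INR k * T) b by apply: Rbar_lt_le_trans_finite tb; lra.
have [rn [h1 h2]] := H omega t0 b x oT sol (rho + eta) eM hV k kb.
have [th h3] := h2 t ltac:(lra) tb.
have kc0 : 0 <= INR k * T * c.
  by apply: Rmult_le_pos; [apply: Rmult_le_pos; [apply: pos_INR | lra] | lra].
have h4 : norms_le m (rho + eta) (samples T t0 x k).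
  by move=> i; have := h1 i; rewrite Rmax_right; lra.
have lk0 : phase_locked m rho eta s (samples T t0 x 0) by rewrite /samples /= Rmult_0_l Rplus_0_r.
rewrite (_ : 6 * eta = 5 * eta + eta); last ring.
exact: near_orbit_turn (HL k _ rn lk0 h4) h3.
Qed.

Lemma flow_capture M eta s S c0 : rho < M -> rho + eta <= M -> tight rho eta s -> 0 <= S -> 0 < c0 ->
  exists tau, 0 < tau /\ small (fun T =>
  forall omega t0 b x, omega * T = 2 * PI -> flow omega t0 b x ->
  norms_le m M (x t0) -> (exists u, norm u = 1 /\ in_cone u (- S) S c0 (x t0)) ->
  forall t, t0 + tau <= t -> Rbar_lt t b -> near_orbit m rho (6 * eta) (x t)).
Proof.
move=> rM eM ti S0 c00; have [e0 _] := ti.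
have [C [c [C0 [cp H]]]] := flow_run M eta e0 eM.
have [K [K0 hK]] := damp_bounded M; have [A [A0 hA]] := gain_bounded M.
have M0 : 0 < M by lra.
have Mc : 0 <= M / c by apply: Rdiv_le_0_compat; lra.
have [tau [tau0 HC]] := capture m (damp f) (mean_gain m gamma) (edge gamma) root rho M K A C
  K0 A0 C0 rho_gt0 rM hK damping_neg hA edge_neq (fun i j c => gain_pos M i j c M0) connected
  S c0 eta s (M / c) S0 c00 ti Mc.
exists tau; split=> //; have HL := flow_lock M eta s rM eM ti.
move: (small_and _ _ H (small_and _ _ HC HL)); apply: small_imp.
move=> T T0 [[CT {}H] [[N [NT {}HC]] {}HL]] omega t0 b x oT sol hM [u [u1 cone]] t ht tb.
have Nb : Rbar_lt (t0 + INR N * T) b by apply: Rbar_lt_le_trans_finite tb; lra.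
have [rn [h1 _]] := H omega t0 b x oT sol M (Rle_refl M) hM N Nb.
have lk := HC u _ u1 rn ltac:(by rewrite /samples /= Rmult_0_l Rplus_0_r).
apply: (HL omega (t0 + INR N * T) b x oT (flow_restart _ _ _ _ _ _ sol)) => //; try lra.
move=> i; have := h1 i; rewrite Rmax_right //.
have := Rmult_le_compat_r c _ _ (Rlt_le _ _ cp) (proj1 NT).
by rewrite (_ : M / c * c = M); [lra | field; lra].
Qed.

End Flow.

(** * Stability of the array *)

Lemma norms_le_of_near_orbit (m : nat) rho e (z : state m) : 0 <= rho ->
  near_orbit m rho e z -> norms_le m (rho + e) z.
Proof.
move=> r0 [u [u1 hu]] i; have := norm_triangle_minus (z i) (scal rho u).
by rewrite norm_scal_nonneg // u1; have := hu i; lra.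
Qed.

Lemma near_orbit_of_norms_le (m : nat) rho M (z : state m) : 0 <= rho ->
  norms_le m M z -> near_orbit m rho (M + rho) z.
Proof.
move=> r0 hz; exists ((1, 0) : plane).
have u1 : norm ((1, 0) : plane) = 1 by rewrite norm_plane /dot /= (_ : _ + _ = 1) ?sqrt_1 //; ring.
split=> // i; apply: Rle_trans (norm_minus_le _ _) _.
by rewrite norm_scal_nonneg // u1; have := hz i; lra.
Qed.

Section Main.

Variables (m : nat) (f : R -> R) (gamma : 'I_m -> 'I_m -> R -> R) (rho : R) (root : 'I_m).
Hypotheses (f_lip : locally_lipschitz f) (f_L1 : cond_L1 f) (f_L2 : cond_L2 f).
Hypothesis gamma_int : interconnection gamma.
Hypothesis connected : forall i, i <> root -> clos_trans 'I_m (edge gamma) i root.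
Hypothesis gamma_lip : forall i j, i <> j -> locally_lipschitz (gamma i j).
Hypotheses (rho_gt0 : 0 < rho) (kappa_rho : kappa f rho = 0).

(** Forward completeness comes with any bound valid along all solutions. *)
Lemma forward_of_bound M omega t0 (P : state m -> Prop) (Q : R -> state m -> Prop) :
  0 <= M -> (forall x0, P x0 -> norms_le m M x0) ->
  (forall b x, flow m f gamma omega t0 b x -> P (x t0) ->
     forall t, t0 <= t -> Rbar_lt t b -> norms_le m M (x t) /\ Q t (x t)) ->
  forward_implies (fun x t => lienard f gamma x omega t) t0 P Q.
Proof.
move=> M0 hP h x0 Px0; split.
  apply: (solution_exists m f gamma f_lip gamma_lip (gamma_at0 m gamma gamma_int) M) => //.
    exact: hP.
  by move=> b x sol e t ht tb; case: (h b x sol _ t ht tb); rewrite ?e.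
by move=> b x sol e t ht tb; case: (h b x sol _ t ht tb); rewrite ?e.
Qed.

Lemma small_period P : small P -> exists omega_star, 0 < omega_star /\
  forall omega, omega_star <= omega -> exists T, 0 < T /\ omega * T = 2 * PI /\ P T.
Proof.
move=> [T0 [T00 h]]; have pi0 := twoPI_gt0.
exists (2 * PI / T0); split; first exact: Rdiv_lt_0_compat.
move=> omega ho; have o0 : 0 < omega by have := Rdiv_lt_0_compat _ _ pi0 T00; lra.
have e : omega * (2 * PI / omega) = 2 * PI by field; lra.
exists (2 * PI / omega); split; first exact: Rdiv_lt_0_compat.
split=> //; apply: h; split; first exact: Rdiv_lt_0_compat.
apply: (Rmult_le_reg_l omega) => //; rewrite e.
have := Rmult_le_compat_r T0 _ _ (Rlt_le _ _ T00) ho.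
by rewrite (_ : 2 * PI / T0 * T0 = 2 * PI) //; field; lra.
Qed.

Lemma B_practically_stable :
  semiglobally_practically_asymptotically_stable (lienard f gamma) (set_B rho).
Proof.
move=> Delta delta D0 d0; have n0 := pos_INR m; set n := INR m in n0.
(* A distance is at most [m] times the largest distance of a node; [eta] is spent
   once on the samples and once between them. *)
pose eta := delta / (2 * (n + 1)); have e0 : 0 < eta by apply: Rdiv_lt_0_compat; lra.
have ne : n * (2 * eta) <= delta.
  have : (n + 1) * (2 * eta) = delta by rewrite /eta; field; lra.
  lra.
pose M := rho + Delta + eta.
have [c [c0 H]] := flow_bound m f gamma rho f_lip f_L1 f_L2 gamma_int gamma_lip rho_gt0 kappa_rho
  M eta e0 ltac:(rewrite /M; lra).
have [os [os0 hos]] := small_period _ H; exists os; split=> // omega /hos [T [T0 [oT {}H]]] v.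
have M20 : 0 <= M + 2 * eta by rewrite /M; lra.
have final z : norms_le m (rho + eta + eta) z -> dist_set (set_B rho) z <= delta.
  move=> hz; apply: Rle_trans ne; apply: dist_B_of_norms_le; [lra | lra |].
  by move=> i; have := hz i; lra.
have start eps (x0 : state m) : dist_set (set_B rho) x0 <= eps -> norms_le m (rho + eps) x0.
  by apply: norms_le_of_dist_B; lra.
have forward eps t0 (Q : R -> state m -> Prop) : eps <= Delta ->
    (forall t z, t0 <= t -> norms_le m (Rmax (rho + eps - (t - t0 - T) * c) (rho + eta) + eta) z ->
       norms_le m (Rmax (rho + eps) (rho + eta) + eta) z -> Q t z) ->
    forward_implies v t0 (fun x => dist_set (set_B rho) x <= eps) Q.
  move=> he hQ; apply: (forward_of_bound (M + 2 * eta)) => //.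
    by move=> x0 /start h i; have := h i; rewrite /M; lra.
  move=> b x sol /start hV t ht tb.
  have [h1 h2] := H omega t0 b x oT sol (rho + eps) ltac:(rewrite /M; lra) hV t ht tb.
  have mx : Rmax (rho + eps) (rho + eta) <= M by rewrite /M; apply: Rmax_lub; lra.
  by split; [move=> i; have := h2 i; lra | apply: hQ].
split; [|split].
- move=> r hr; exists (Rmin eta Delta); split; first exact: Rmin_case.
  have h1 := Rmin_l eta Delta; have h2 := Rmin_r eta Delta; set eps := Rmin _ _ in h1 h2 *.
  move=> t0; apply: forward => // t z _ _; rewrite Rmax_right; last lra.
  by move=> /final; lra.
- move=> eps heps; exists (n * (Delta + 2 * eta) + 1).
  have nD : 0 <= n * (Delta + 2 * eta) by apply: Rmult_le_pos; lra.
  split; first lra.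
  move=> t0; apply: forward; first lra.
  move=> t z _ _ hz; have mx : Rmax (rho + eps) (rho + eta) <= rho + Delta + eta.
    by apply: Rmax_lub; lra.
  apply: (Rle_trans _ (n * (Delta + 2 * eta))); last lra.
  by apply: dist_B_of_norms_le; [lra | lra | move=> i; have := hz i; lra].
- move=> r eps hr heps; have Mc : 0 < M / c by apply: Rdiv_lt_0_compat; rewrite /M; lra.
  exists (M / c + T); split; first lra.
  move=> t0; apply: forward; first lra.
  move=> t z ht hz _ late; apply: (Rle_trans _ delta); last lra.
  apply: final; move: hz; rewrite Rmax_right //.
  have := Rmult_le_compat_r c (M / c) (t - t0 - T) ltac:(lra) ltac:(lra).
  by rewrite (_ : M / c * c = M); [rewrite /M; lra | field; lra].
Qed.

Lemma R_practically_attractive (D : plane -> Prop) (delta : R) :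
  compact_set D -> convex_set D -> ~ D (0, 0) -> 0 < delta ->
  exists omega_star, 0 < omega_star /\
  forall omega, omega_star <= omega ->
  let v := fun x t => lienard f gamma x omega t in
  (exists eps, 0 < eps /\
     forward_implies v 0
       (fun x => dist_set (set_R rho) x <= eps)
       (fun _ x => dist_set (set_R rho) x <= delta)) /\
  (exists r, 0 < r /\
     forward_implies v 0
       (fun x => forall i, D (x i))
       (fun _ x => dist_set (set_R rho) x <= r)) /\
  (exists T, 0 < T /\
     forward_implies v 0
       (fun x => forall i, D (x i))
       (fun t x => T <= t -> dist_set (set_R rho) x <= delta)).
Proof.
move=> comp conv no0 d0; have n0 := pos_INR m; set n := INR m in n0.
have [u [c0 [MD [u1 [c00 [MD0 hD]]]]]] := separation D comp conv no0.
(* [6 eta] is the final precision of each node, shared by [m] nodes. *)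
pose eta := Rmin (rho / 8) (delta / (6 * (n + 1))).
have e0 : 0 < eta by apply: Rmin_case; [lra | apply: Rdiv_lt_0_compat; lra].
have er : eta <= rho / 8 by apply: Rmin_l.
have ne : n * (6 * eta) <= delta.
  have h1 : eta <= delta / (6 * (n + 1)) by apply: Rmin_r.
  have h2 := Rmult_le_compat_l (6 * (n + 1)) _ _ ltac:(lra) h1.
  move: h2; rewrite (_ : 6 * (n + 1) * (delta / (6 * (n + 1))) = delta); last by field; lra.
  lra.
pose s := Rmin (/ 4) (eta / (8 * (rho + eta))).
have s0 : 0 < s by apply: Rmin_case; [lra | apply: Rdiv_lt_0_compat; lra].
have ti : tight rho eta s.
  do 2 (split; first lra); split=> //; split; first exact: Rmin_l.
  have h1 : s <= eta / (8 * (rho + eta)) by apply: Rmin_r.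
  have h2 := Rmult_le_compat_l (8 * (rho + eta)) _ _ ltac:(lra) h1.
  move: h2; rewrite (_ : 8 * (rho + eta) * (eta / (8 * (rho + eta))) = eta); last by field; lra.
  lra.
(* All initial states considered have norms at most [M]. *)
pose M := rho + eta + MD + 1.
have rM : rho < M by rewrite /M; lra.
have eM : rho + eta <= M by rewrite /M; lra.
have S0 : 0 <= MD / c0 by apply: Rdiv_le_0_compat.
have [c [cp HB]] := flow_bound m f gamma rho f_lip f_L1 f_L2 gamma_int gamma_lip rho_gt0 kappa_rho
  M eta e0 eM.
have HL := flow_lock m f gamma rho root f_lip f_L1 f_L2 gamma_int connected gamma_lip rho_gt0
  kappa_rho M eta s rM eM ti.
have [tau [tau0 HC]] := flow_capture m f gamma rho root f_lip f_L1 f_L2 gamma_int connected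
  gamma_lip rho_gt0 kappa_rho M eta s (MD / c0) c0 rM eM ti S0 c00.
have [os [os0 hos]] := small_period _ (small_and _ _ HB (small_and _ _ HL HC)).
exists os; split=> // omega /hos [T [T0 [oT [{}HB [{}HL {}HC]]]]] v.
have M20 : 0 <= M + 2 * eta by rewrite /M; lra.
have bound b x : flow m f gamma omega 0 b x -> norms_le m M (x 0) ->
    forall t, 0 <= t -> Rbar_lt t b -> norms_le m (M + 2 * eta) (x t).
  move=> sol hx t ht tb i.
  have [_ h] := HB omega 0 b x oT sol M (Rle_refl M) hx t ht tb.
  by have := h i; rewrite Rmax_left; lra.
have close z : near_orbit m rho (6 * eta) z -> dist_set (set_R rho) z <= delta.
  by move=> hz; apply: Rle_trans ne; apply: dist_R_of_near_orbit => //; lra.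
have D_norm x0 : (forall i, D (x0 i)) -> norms_le m M x0.
  by move=> hx i; have [_ h] := hD _ (hx i); rewrite /M; lra.
split; [|split].
- pose e := Rmin (s * rho / 2) eta.
  have ep : 0 < e by apply: Rmin_case => //; have := Rmult_lt_0_compat _ _ s0 rho_gt0; lra.
  have e1 : e <= s * rho / 2 by apply: Rmin_l.
  have e2 : e <= eta by apply: Rmin_r.
  exists (e / 2); split; first lra.
  have near (x0 : state m) : dist_set (set_R rho) x0 <= e / 2 -> near_orbit m rho e x0.
    by apply: (near_orbit_of_dist_R m rho x0 root) => //; lra.
  have nb x0 : near_orbit m rho e x0 -> norms_le m (rho + eta) x0.
    by move=> /norms_le_of_near_orbit h i; have := h ltac:(lra) i; lra.
  apply: (forward_of_bound (M + 2 * eta)) => //.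
    by move=> x0 /near /nb h i; have := h i; lra.
  move=> b x sol /near hx t ht tb; have hb := nb _ hx; split.
    by apply: (bound b x sol) => // i; have := hb i; lra.
  apply: close; apply: (HL omega 0 b x oT sol hb) => //.
  exact: (phase_locked_of_near_orbit m rho eta s e).
- exists (n * (M + 2 * eta + rho) + 1).
  have nM : 0 <= n * (M + 2 * eta + rho) by apply: Rmult_le_pos; lra.
  split; first lra.
  apply: (forward_of_bound (M + 2 * eta)) => //.
    by move=> x0 /D_norm h i; have := h i; lra.
  move=> b x sol /D_norm hx t ht tb; have hb := bound b x sol hx t ht tb; split=> //.
  apply: (Rle_trans _ (n * (M + 2 * eta + rho))); last lra.
  apply: dist_R_of_near_orbit; [lra | lra |].
  by apply: near_orbit_of_norms_le => //; lra.
- exists tau; split=> //.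
  apply: (forward_of_bound (M + 2 * eta)) => //.
    by move=> x0 /D_norm h i; have := h i; lra.
  move=> b x sol hx t ht tb; have hM := D_norm _ hx; split; first exact: (bound b x sol hM t ht tb).
  move=> late; apply: close; apply: (HC omega 0 b x oT sol hM) => //; last lra.
  exists u; split=> // i; have [h1 h2] := hD _ (hx i); split=> //.
  have h3 := dot_unit_le (perp u) (x 0 i) ltac:(by rewrite norm_perp).
  have h4 := Rmult_le_compat_l _ _ _ S0 h1.
  move: h4; rewrite (_ : MD / c0 * c0 = MD); last by field; lra.
  move=> h4; have /Rabs_le_between := Rle_trans _ _ _ h3 (Rle_trans _ _ _ h2 h4); lra.
Qed.

End Main.

Theorem theorem5 (m : nat) (f : R -> R) (gamma : 'I_m -> 'I_m -> R -> R) (rho : R)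
  (m_ge2 : (2 <= m)%nat)
  (f_lip : locally_lipschitz f) (f_L1 : cond_L1 f) (f_L2 : cond_L2 f)
  (gamma_int : interconnection gamma)
  (gamma_conn : connected_interconnection gamma)
  (gamma_lip : forall i j, i <> j -> locally_lipschitz (gamma i j))
  (rho_gt0 : 0 < rho) (kappa_rho : kappa f rho = 0) :
  semiglobally_practically_asymptotically_stable (lienard f gamma) (set_B rho)
  /\
  (forall (D : plane -> Prop) (delta : R),
     compact_set D -> convex_set D -> ~ D (0, 0) -> 0 < delta ->
     exists omega_star, 0 < omega_star /\
     forall omega, omega_star <= omega ->
     let v := fun x t => lienard f gamma x omega t in
     (exists eps, 0 < eps /\
        forward_implies v 0
          (fun x => dist_set (set_R rho) x <= eps)
          (fun _ x => dist_set (set_R rho) x <= delta)) /\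
     (exists r, 0 < r /\
        forward_implies v 0
          (fun x => forall i, D (x i))
          (fun _ x => dist_set (set_R rho) x <= r)) /\
     (exists T, 0 < T /\
        forward_implies v 0
          (fun x => forall i, D (x i))
          (fun t x => T <= t -> dist_set (set_R rho) x <= delta))).
Proof.
split; first exact: B_practically_stable.
have [root connected] := gamma_conn.
move=> D delta; exact: (R_practically_attractive m f gamma rho root).
Qed.
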